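(* There exists $c>0$ such that for all $g\in D(\bar{\mathcal D})\cap\bar H^{odd}$, $$\langle\bar{\mathcal A}g,g\rangle_{\bar H}\ge c\|g\|_{\bar H}^2.$$ In particular, the kernel of $\bar{\mathcal A}:D(\bar{\mathcal D}^2)\cap\bar H^{odd}\to\bar H^{odd}$ is trivial.
   Context: Plane symmetric setting: $x\in\mathbb R$, $v=(v_1,\bar v)\in\mathbb R\times\mathbb R^2$. Steady state $f_0(x,v)=\varphi(E,\bar v)=\alpha(E)\beta(\bar v)$ with $E=\tfrac12v_1^2+U_0(x)$, where $\beta\ge0$ is continuous with compact support and $\int\beta=1$, $\alpha(E)=(E_0-E)_+^k$ with $k>\tfrac12$ or $\alpha(E)=(e^{E_0-E}-1)_+$ ($t_+^k=t^k$ for $t>0$, else $0$), $\rho_0(x)=\int f_0(x,v)dv$, $U_0(x)=2\pi\int|x-y|\rho_0(y)dy$; $U_0,\rho_0$ even, $\mathrm{supp}\,\rho_0=[-R_0,R_0]$, $\rho_0(0)>0$, $E_0=U_0(R_0)$. Let $\bar\Omega_0=\{f_0>0\}$, $\varphi'=\partial_E\varphi=\alpha'(E)\beta(\bar v)$. $\bar H$ is the Hilbert space of measurable $g:\bar\Omega_0\to\mathbb R$ with $\|g\|_{\bar H}^2=\int_{\bar\Omega_0}|\varphi'(E,\bar v)|^{-1}|g|^2d(x,v)<\infty$; $\bar H^{odd}=\{g\in\bar H: g(x,v)=-g(-x,v)=-g(x,-v_1,\bar v)$ a.e.$\}$. For $g\in L^1_{loc}(\bar\Omega_0)$, $\bar{\mathcal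 D}g=\mu$ weakly if $\mu\in L^1_{loc}$ and $\int|\varphi'|^{-1}g\,\bar{\mathcal D}\xi=-\int|\varphi'|^{-1}\mu\xi$ for all $\xi\in C^1_c(\bar\Omega_0)$, where $\bar{\mathcal D}\xi=v_1\partial_x\xi-U_0'(x)\partial_{v_1}\xi$. $D(\bar{\mathcal D})=\{g\in\bar H:\bar{\mathcal D}g$ exists weakly and lies in $\bar H\}$, $D(\bar{\mathcal D}^2)=\{g\in D(\bar{\mathcal D}):\bar{\mathcal D}g\in D(\bar{\mathcal D})\}$. $\bar{\mathcal J}(g)(x)=\int v_1g(x,v)dv$, $(\bar{\mathcal B}g)(x,v)=4\pi|\varphi'(E,\bar v)|v_1\bar{\mathcal J}(g)(x)$, $\bar{\mathcal A}=-\bar{\mathcal D}^2-\bar{\mathcal B}$ on $D(\bar{\mathcal D}^2)$; its quadratic form on $D(\bar{\mathcal D})$ is $\langle\bar{\mathcal A}g,g\rangle_{\bar H}:=\|\bar{\mathcal D}g\|_{\bar H}^2-4\pi\int_{\mathbb R}\bar{\mathcal J}(g)(x)^2dx$. *)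

(* Defs.v *)
(* Plane symmetric Vlasov-Poisson setting:
   a phase-space point is z = (x, (v1, (v2, v3))) : R * (R * (R * R)),
   so z.1 = x, z.2 = v, z.2.1 = v1, z.2.2 = vbar = (v2, v3). *)
From mathcomp Require Import all_boot all_order all_algebra.
From mathcomp Require Import all_classical all_reals all_analysis.
Import Order.TTheory GRing.Theory Num.Theory numFieldNormedType.Exports.
Set Implicit Arguments.
Unset Strict Implicit.
Unset Printing Implicit Defensive.
Local Open Scope classical_set_scope.
Local Open Scope ring_scope.

Notation phase R := (R * (R * (R * R)))%type.

Notation leb1 R := (@lebesgue_measure R).
Notation leb2 R := (leb1 R \x leb1 R)%E.
Notation leb3 R := (leb1 R \x leb2 R)%E.
Notation leb4 R := (leb1 R \x leb3 R)%E.

Inductive ansatz (R : realType) := Polytrope of R | King.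

Definition ansatz_ok (R : realType) (a : ansatz R) : Prop :=
  match a with Polytrope k => 1 / 2 < k | King => True end.

Definition alpha (R : realType) (a : ansatz R) (E0 E : R) : R :=
  match a with
  | Polytrope k => if E < E0 then powR (E0 - E) k else 0
  | King => if E < E0 then expR (E0 - E) - 1 else 0
  end.

(* alpha'(E), the derivative of alpha for E < E0 (the only region used,
   since phi' is only evaluated on the support {f0 > 0} where E < E0) *)
Definition alpha' (R : realType) (a : ansatz R) (E0 E : R) : R :=
  match a with
  | Polytrope k => if E < E0 then - (k * powR (E0 - E) (k - 1)) else 0
  | King => if E < E0 then - expR (E0 - E) else 0
  end.

Definition energy (R : realType) (U0 : R -> R) (z : phase R) : R :=
  z.2.1 ^+ 2 / 2 + U0 z.1.

Definition f0 (R : realType) (a : ansatz R) (E0 : R) (U0 : R -> R)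
  (beta : R * R -> R) (z : phase R) : R :=
  alpha a E0 (energy U0 z) * beta z.2.2.

Definition phi' (R : realType) (a : ansatz R) (E0 : R) (U0 : R -> R)
  (beta : R * R -> R) (z : phase R) : R :=
  alpha' a E0 (energy U0 z) * beta z.2.2.

Definition Omega0 (R : realType) (a : ansatz R) (E0 : R) (U0 : R -> R)
  (beta : R * R -> R) : set (phase R) :=
  [set z | 0 < f0 a E0 U0 beta z].

Section Space.
Variables (R : realType) (Om : set (phase R)) (w : phase R -> R).
(* In the application: Om = Omega0, w = phi'. *)

Definition Hnorm2 (g : phase R -> R) : \bar R :=
  (\int[leb4 R]_(z in Om) ((`|w z|)^-1 * g z ^+ 2)%:E)%E.

Definition inH (g : phase R -> R) : Prop :=
  measurable_fun Om g /\ (Hnorm2 g < +oo)%E.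

Definition inHodd (g : phase R -> R) : Prop :=
  inH g /\
  {ae leb4 R, forall z, Om z ->
     g z = - g (- z.1, z.2) /\ g z = - g (z.1, (- z.2.1, z.2.2))}.

Definition locint (g : phase R -> R) : Prop :=
  forall K : set (phase R), compact K -> K `<=` Om ->
    (leb4 R).-integrable K (EFin \o g).

Definition C1c (xi : phase R -> R) : Prop :=
  (forall z e, derivable xi z e) /\
  (forall e, continuous ('D_e xi)) /\
  compact (closure [set z | xi z != 0]) /\
  closure [set z | xi z != 0] `<=` Om.

Definition ex : phase R := (1, (0, (0, 0))).
Definition ev1 : phase R := (0, (1, (0, 0))).

Definition Dop (U0 : R -> R) (xi : phase R -> R) (z : phase R) : R :=
  z.2.1 * 'D_ex xi z - derive1 U0 z.1 * 'D_ev1 xi z.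

Definition weakD (U0 : R -> R) (g mu : phase R -> R) : Prop :=
  locint g /\ locint mu /\
  forall xi, C1c xi ->
    (\int[leb4 R]_(z in Om) ((`|w z|)^-1 * g z * Dop U0 xi z)%:E =
     - \int[leb4 R]_(z in Om) ((`|w z|)^-1 * mu z * xi z)%:E)%E.

(* J(g)(x) = int v1 g(x,v) dv  (g extended by 0 outside Om) *)
Definition Jop (g : phase R -> R) (x : R) : R :=
  fine (\int[leb3 R]_(v in [set v | Om (x, v)]) (v.1 * g (x, v))%:E)%E.

Definition Bop (g : phase R -> R) (z : phase R) : R :=
  4 * pi * `|w z| * z.2.1 * Jop g z.1.

(* <A g, g> := ||D g||^2 - 4 pi int J(g)^2 dx, where Dg = mu *)
Definition quadform (g mu : phase R -> R) : R :=
  fine (Hnorm2 mu) - 4 * pi * fine (\int[leb1 R]_x (Jop g x ^+ 2)%:E)%E.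

End Space.

(* Main.v *)
Require Import Defs.
From HB Require Import structures.
From mathcomp Require Import all_boot all_order all_algebra.
From mathcomp Require Import all_classical all_reals all_analysis.
From mathcomp Require Import measurable_realfun.
From mathcomp Require Import ring lra.
Import Order.TTheory GRing.Theory Num.Theory numFieldNormedType.Exports.
Set Implicit Arguments.
Unset Strict Implicit.
Unset Printing Implicit Defensive.
Local Open Scope classical_set_scope.
Local Open Scope ring_scope.

(** The quadratic form is bounded below orbit by orbit.  In the variables
    (|x|, E, vbar), where dv1 = dE / |v1|, the weak equation D g = mu, tested
    against theta(x) chi(E) b(vbar), says that on almost every orbit {U0 < E} the
    even part M of mu / |v1| has mean zero and that the odd part G of g is, up to
    sign, its tail integral.  A Schur test with weights built from x |v1| and
    q = v1^2 - x U0' yields  int V G^2 / |v1| dx <= int |v1| M^2 dx  with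
    V = U0'' + 3 U0'/x, hence  ||D g||^2 >= int |phi'|^-1 V g^2.  Here
    U0'' = 4 pi rho0, and J(g)^2 <= rho0 int |phi'|^-1 g^2 dv because
    int v1^2 |phi'| dv <= rho0; so the part U0'' of V absorbs 4 pi int J(g)^2, and
    U0'/x >= kappa > 0 on the support leaves 3 kappa ||g||^2.

    For the kernel one cannot pair the weak equation - D^2 g = B g with g itself.
    Testing it against sgn(v1) theta(x) chi(E) b(vbar), with theta odd, of mean-zero
    derivative and supported away from the turning points, shows that on almost
    every orbit |phi'|^-1 |v1| M equals a constant plus 4 pi times the tail
    integral of 2 (J(x) - J(-x)).  Pairing this with M, which has mean zero, gives
    16 times 4 pi int J(g)^2 for the energy of the even fold of D g, and the first
    part then forces g = 0. *)

(** * Bump functions and the fundamental lemma of the calculus of variations *)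

(** Origin of [V]: along an orbit, with D = v1 d/dx, the function h = x v1 satisfies D h = q and D q
    = - V h, so - D^2 h = V h, and h > 0 between the centre and the turning point. The Hardy
    inequality is thus the ground state inequality of Jacobi and Barta for h. Its usual derivation
    differentiates g / h, which asks for regularity of g and for control at the turning point, where
    1 / v1 blows up; the Schur test asks only for tail bounds on g.

    Both g and D g are known only through test functions with compact support in {f0 > 0}. The
    reduction to orbits works because energies in a segment below E0, with vbar in a box, fill a
    compact set made of entire orbits: a function of the invariants alone is then a test function.
    The price is the bookkeeping of null sets. A statement on almost every orbit has to come from
    countably many tests, which is why the bumps have rational ends.

    Instead of splitting by parity, all values at the four points (+-x, +-v1) are summed; this is
    where the factors 4 and 16 come from. *)

Lemma ge0_integral_cauchy_schwarz d (T : measurableType d) (R : realType)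
    (mu : {measure set T -> \bar R}) (f g : T -> R) :
  measurable_fun setT f -> measurable_fun setT g ->
  (forall x, 0 <= f x) -> (forall x, 0 <= g x) ->
  ((\int[mu]_x (f x * g x)%:E) * (\int[mu]_x (f x * g x)%:E) <=
   (\int[mu]_x (f x ^+ 2)%:E) * (\int[mu]_x (g x ^+ 2)%:E))%E.
Proof.
move=> mf mg f0 g0.
(* Hoelder's inequality is used in squared form: no square root is taken in the extended reals, and
   infinite integrals, which occur before integrability is established, are covered. *)
have key (u : T -> R) : (forall x, 0 <= u x) ->
    (Lnorm mu 2%:E (EFin \o u) * Lnorm mu 2%:E (EFin \o u) =
     \int[mu]_x (u x ^+ 2)%:E)%E.
  move=> u0.
  have := @poweR_Lnorm _ _ _ mu (EFin \o u) 2 ltac:(by rewrite pnatr_eq0).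
  have -> : 2 = 1 + 1 :> R by [].
  rewrite poweRD ?poweRe1 ?Lnorm_ge0//; last first.
    by rewrite poweRD_defE -[1 + 1]/(2%:R) pnatr_eq0.
  move=> ->.
  apply: eq_integral => x _ /=.
  by rewrite -[1 + 1]/(2%:R) powR_mulrn// ger0_norm.
have pq : 2^-1 + 2^-1 = 1 :> R by lra.
have H := hoelder mu mf mg (ltr0n R 2) (ltr0n R 2) pq.
rewrite -(key _ f0) -(key _ g0) muleACA.
rewrite Lnorm1 in H.
have E : (\int[mu]_x `|(EFin \o (f \* g)%R) x| = \int[mu]_x (f x * g x)%:E)%E.
  by apply: eq_integral => x _ /=; rewrite ger0_norm// mulr_ge0.
rewrite E in H.
apply: lee_pmul => //; apply: integral_ge0 => x _; rewrite lee_fin mulr_ge0//.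
Qed.

(* [bump a b n] is of class C^1, and it increases with [n] to the indicator of [`]a, b[]. *)
Definition bump {R : realType} (a b : R) (n : nat) (x : R) : R :=
  let s := (Num.max 0 (x - a) * Num.max 0 (b - x)) ^+ 2 in
  n%:R * s / (1 + n%:R * s).

Lemma bump_ge0 (R : realType) (a b : R) n x : 0 <= bump a b n x.
Proof.
rewrite /bump; have h : 0 <= n%:R * (Num.max 0 (x - a) * Num.max 0 (b - x)) ^+ 2.
  by rewrite mulr_ge0// sqr_ge0.
by rewrite divr_ge0// addr_ge0.
Qed.

Lemma bump_le1 (R : realType) (a b : R) n x : bump a b n x <= 1.
Proof.
rewrite /bump; have h : 0 <= n%:R * (Num.max 0 (x - a) * Num.max 0 (b - x)) ^+ 2.
  by rewrite mulr_ge0// sqr_ge0.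
by rewrite ler_pdivrMr ?mul1r ?lerDr// ltr_pwDl.
Qed.

Lemma bump_out (R : realType) (a b : R) n x : ~~ (a < x < b) -> bump a b n x = 0.
Proof.
rewrite /bump negb_and -!leNgt => /orP[h|h].
- by rewrite (max_idPl _) ?subr_le0// mul0r expr0n/= mulr0 mul0r.
- by rewrite (@max_idPl _ _ 0 (b - x) _) ?subr_le0// mulr0 expr0n/= mulr0 mul0r.
Qed.

Lemma bumpE (R : realType) (a b : R) n x : a < x < b ->
  bump a b n x = n%:R * ((x - a) * (b - x)) ^+ 2 / (1 + n%:R * ((x - a) * (b - x)) ^+ 2).
Proof.
move=> /andP[ax xb]; rewrite /bump.
by rewrite !(max_idPr _) ?subr_ge0 ?ltW.
Qed.

Lemma bump_gt0 (R : realType) (a b : R) n x : a < x < b -> 0 < bump a b n.+1 x.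
Proof.
move=> axb; rewrite bumpE//; case/andP: axb => ax xb.
have h : 0 < n.+1%:R * ((x - a) * (b - x)) ^+ 2.
  by rewrite mulr_gt0 ?ltr0n// exprn_gt0// mulr_gt0// subr_gt0.
by rewrite divr_gt0// addr_gt0.
Qed.

Lemma measurable_invr (R : realType) : measurable_fun setT (@GRing.inv R).
Proof.
rewrite -(setvU [set 0 : R]); apply/measurable_funU => //.
  by apply: measurableC.
split.
- apply: open_continuous_measurable_fun.
    by apply: closed_openC; exact: closed_eq.
  move=> x; rewrite inE/= => /eqP x0; exact: inv_continuous.
- move=> _ Y mY; have [Y0|Y0] := pselect (Y 0).
    rewrite (_ : _ `&` _ = [set 0])//; apply/seteqP; split => [x []//|x /= ->].
    by split => //=; rewrite invr0.
  rewrite (_ : _ `&` _ = set0)//; apply/seteqP; split => [x [/= ->]|//].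
  by rewrite invr0.
Qed.

Lemma measurable_bump (R : realType) (a b : R) n : measurable_fun setT (bump a b n).
Proof.
pose p x : R := (Num.max 0 (x - a) * Num.max 0 (b - x)) ^+ 2.
have mp : measurable_fun setT p.
  apply: measurable_funX; apply: measurable_funM; apply: measurable_maxr => //.
  - exact: measurable_funB.
  - exact: measurable_funB.
rewrite (_ : bump a b n = fun x => n%:R * p x * (1 + n%:R * p x)^-1)//.
apply: measurable_funM; first exact: measurable_funM.
apply: measurableT_comp; first exact: measurable_invr.
by apply: measurable_funD => //; exact: measurable_funM.
Qed.

(** The left end moves with [n] so that rational ends, of which there are countably many, can reach
    an arbitrary real [a]. The same [n] steepens the bump. *)
Lemma bump_cvg (R : realType) (a b : R) (r : nat -> R) (x : R) :
  (forall n, a < r n) -> r @ \oo --> a ->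
  (bump (r n) b n x @[n --> \oo] --> (\1_(`]a, b[%classic) x : R)).
Proof.
move=> ar ra; rewrite indicE; case: (boolP (x \in `]a, b[%classic)) => /=.
  rewrite inE/= in_itv/= => /andP[ax xb].
  (* As soon as [r n] lies left of the midpoint of [a] and [x], this is a lower bound for the square
     in the bump that no longer depends on [n]. *)
  pose c := ((x - a) / 2 * (b - x)) ^+ 2.
  have c0 : 0 < c by rewrite exprn_gt0// mulr_gt0 ?divr_gt0 ?subr_gt0.
  apply/cvgrPdist_le => e e0; near=> n.
  have rn : r n < (x + a) / 2.
    near: n; apply: cvgr_lt ra _ _; lra.
  have nc : n%:R > (e * c)^-1 by near: n; exact: nbhs_infty_gtr.
  rewrite bumpE; last by apply/andP; split => //; lra.
  set s := ((x - r n) * (b - x)) ^+ 2.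
  have cs : c <= s.
    rewrite /c /s ler_sqr ?nnegrE ?mulr_ge0//; [|lra..].
    by rewrite ler_wpM2r//; lra.
  have n0 : 0 < n%:R :> R by rewrite (lt_trans _ nc)// invr_gt0 mulr_gt0.
  have ns : 0 < n%:R * s by rewrite mulr_gt0// (lt_le_trans c0).
  have -> : 1 - n%:R * s / (1 + n%:R * s) = (1 + n%:R * s)^-1.
    by field; lra.
  rewrite ger0_norm ?invr_ge0; last by lra.
  rewrite -[leRHS]invrK lef_pV2 ?posrE ?invr_gt0//; last by lra.
  have : (e * c)^-1 * c <= n%:R * s.
    apply: ler_pM; [|exact: ltW|exact: ltW|exact: cs].
    by rewrite invr_ge0 mulr_ge0// ltW.
  by rewrite invfM -mulrA mulVf ?mulr1 ?gt_eqF//; lra.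
rewrite notin_setE/= in_itv/= => /negP axb.
under eq_fun => n.
  rewrite bump_out; last first.
    apply: contra axb => /andP[h ->]; rewrite andbT; exact: lt_trans h.
  over.
exact: cvg_cst.
Unshelve. all: by end_near. Qed.

Lemma exists_rat_cvg (R : realType) (a b : R) : a < b ->
  exists2 r : nat -> rat, (forall n, a < ratr (r n) < b) &
    (fun n => ratr (r n) : R) @ \oo --> a.
Proof.
move=> ab.
have H n : {q : rat | a < ratr q < b /\ ratr q < a + n.+1%:R^-1 :> R}.
  apply: cid; have : a < Num.min b (a + n.+1%:R^-1).
    by rewrite lt_min ab/= ltrDl invr_gt0 ltr0n.
  move=> /rat_in_itvoo[q]; rewrite in_itv/= lt_min => /and3P[aq qb qn].
  by exists q; rewrite aq qb qn.
exists (fun n => sval (H n)) => [n|]; first by have [] := svalP (H n).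
apply: (@squeeze_cvgr _ _ _ _ (fun=> a) (fun n => a + n.+1%:R^-1)).
- near=> n; have [/andP[h1 h2] h3] := svalP (H n).
  by rewrite ltW//= ltW.
- exact: cvg_cst.
- rewrite -[X in _ --> X]addr0; apply: cvgD; first exact: cvg_cst.
  exact: cvg_harmonic.
Unshelve. all: by end_near. Qed.

Lemma integral_preimage_indic d d' (T : measurableType d) (X : measurableType d')
    (R : realType) (mu : {measure set T -> \bar R}) (h : T -> R) (phi : T -> X) B :
  (\int[mu]_(t in phi @^-1` B) (h t)%:E = \int[mu]_t (h t * \1_B (phi t))%:E)%E.
Proof.
rewrite integral_mkcond; apply: eq_integral => t _.
rewrite patchE indicE.
have -> : (t \in phi @^-1` B) = (phi t \in B) by apply/idP/idP; rewrite !inE.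
by case: (phi t \in B); rewrite ?mulr1 ?mulr0.
Qed.

(** The sets [A] over which the integral vanishes form a Dynkin system: the vanishing total integral
    gives complements, integrability of [h] gives countable disjoint unions. *)
Lemma integral_dynkin d d' (T : measurableType d) (X : measurableType d')
    (R : realType) (mu : {measure set T -> \bar R}) (h : T -> R) (phi : T -> X)
    (G : set (set X)) :
  mu.-integrable setT (EFin \o h) -> measurable_fun setT phi ->
  @measurable _ X = <<s G >> -> setI_closed G ->
  (\int[mu]_t (h t)%:E = 0)%E ->
  (forall B, G B -> (\int[mu]_t (h t * \1_B (phi t))%:E = 0)%E) ->
  forall A, measurable A -> (\int[mu]_t (h t * \1_A (phi t))%:E = 0)%E.
Proof.
move=> ih mphi XG GI h0 HG A mA.
have mpre B : measurable B -> measurable (phi @^-1` B).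
  by move=> mB; rewrite -[X in measurable X]setTI; exact: mphi.
have mh : measurable_fun setT (EFin \o h) by exact: measurable_int ih.
rewrite -integral_preimage_indic.
have {mA} : <<s G >> A by rewrite -XG.
move: A; apply: (@dynkin_induction _ X G
  (fun A => (\int[mu]_(t in phi @^-1` A) (h t)%:E = 0)%E)) => //.
- by move=> B /HG; rewrite -integral_preimage_indic.
- move=> S mS S0; move: h0; rewrite -(setvU (phi @^-1` S)) integral_setU//=.
  + by rewrite S0 adde0.
  + by apply: measurableC; exact: mpre.
  + exact: mpre.
  + by rewrite setvU.
  + by rewrite disj_set2E setICl.
- move=> F mF tF HF; rewrite preimage_bigcup integral_bigcup//.
  + by rewrite eseries0// => k _ _; exact: HF.
  + by move=> i j _ _ [t [ti tj]]; apply: tF => //; exists (phi t).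
  + by move=> k; exact: mpre.
  + apply: integrableS ih => //; apply: bigcup_measurable => k _; exact: mpre.
Qed.

(** The map [phi] will be a coordinate: one bump is traded for a Borel set at a time, while the
    remaining bumps are absorbed into [h]. *)
Lemma integral_bump_eq0 d (T : measurableType d) (R : realType)
    (mu : {measure set T -> \bar R}) (h phi : T -> R) (a b : R) :
  mu.-integrable setT (EFin \o h) -> measurable_fun setT phi -> a < b ->
  (forall (r : rat) n, a < ratr r < b ->
     (\int[mu]_t (h t * bump (ratr r) b n (phi t))%:E = 0)%E) ->
  forall A, measurable A ->
  (\int[mu]_t (h t * \1_(A `&` `]a, b[) (phi t))%:E = 0)%E.
Proof.
move=> ih mphi ab H.
have mh : measurable_fun setT h by apply/measurable_EFinP; exact: measurable_int ih.
have mI (B : set R) : measurable B -> measurable_fun setT (fun t => \1_B (phi t) : R).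
  by move=> mB; apply: measurableT_comp => //; exact: measurable_indic.
have iI (B : set R) : measurable B -> mu.-integrable setT (fun t => (h t * \1_B (phi t))%:E).
  move=> mB; apply: le_integrable ih => //.
    by apply/measurable_EFinP; apply: measurable_funM => //; exact: mI.
  move=> t _ /=; rewrite lee_fin normrM ler_piMr// indicE; case: (_ \in _) => /=;
    by rewrite ?normr1 ?normr0.
(* Dominated convergence along rational ends decreasing to [x], with [|h|] as the majorant since
   bumps are at most 1. *)
have step1 x : a <= x -> x < b ->
    (\int[mu]_t (h t * \1_(`]x, b[) (phi t))%:E = 0)%E.
  move=> ax xb.
  have [r rxb rx] := exists_rat_cvg xb.
  have [] := @dominated_convergence _ _ _ mu setT measurableT
    (fun n t => (h t * bump (ratr (r n)) b n (phi t))%:E)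
    (fun t => (h t * \1_(`]x, b[) (phi t))%:E) (fun t => `|h t|%:E).
  - move=> n; apply/measurable_EFinP; apply: measurable_funM => //.
    by apply: measurableT_comp => //; exact: measurable_bump.
  - by apply/measurable_EFinP; apply: measurable_funM => //; exact: mI.
  - apply: aeW => t _; apply: cvg_EFin; first by near=> n.
    apply: cvgM; first exact: cvg_cst.
    by apply: bump_cvg => // n; have /andP[] := rxb n.
  - by have := integrable_abse ih.
  - apply: aeW => t n _; rewrite /= lee_fin normrM ler_piMr//.
    by rewrite ger0_norm ?bump_ge0 ?bump_le1.
  - move=> _ _; rewrite /=.
    have -> : (fun n => \int[mu]_t (h t * bump (ratr (r n)) b n (phi t))%:E)%E = fun=> 0%E.
      apply/funext => n; apply: H; have /andP[h1 ->] := rxb n.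
      by rewrite andbT (le_lt_trans ax h1).
    by move=> /cvg_unique => /(_ _ 0%E) <- //; exact: cvg_cst.
have HG (B : set R) : RGenOInfty.G B ->
    (\int[mu]_t (h t * \1_(B `&` `]a, b[) (phi t))%:E = 0)%E.
  move=> [x ->]; have [bx|xb] := leP b x.
    rewrite (_ : _ `&` _ = set0); last first.
      apply/seteqP; split => y //=; rewrite !in_itv/= andbT => -[xy /andP[_ yb]].
      by move: (lt_trans xy yb); rewrite ltNge bx.
    by under eq_integral do rewrite indic0 /cst mulr0; rewrite integral0.
  have [ax|xa] := leP a x.
    rewrite (_ : _ `&` _ = `]x, b[%classic); first exact: step1.
    apply/seteqP; split => y /=; rewrite !in_itv/= ?andbT; first by case=> -> /andP[].
    by move=> /andP[xy yb]; rewrite xy yb (le_lt_trans ax xy).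
  rewrite (_ : _ `&` _ = `]a, b[%classic); first exact: step1.
  apply/seteqP; split => y /=; rewrite !in_itv/= ?andbT; first by case.
  by move=> /andP[ay yb]; rewrite ay yb (lt_trans xa ay).
have mab : measurable (`]a, b[%classic : set R) by [].
have EI (B : set R) t : (h t * \1_(B `&` `]a, b[) (phi t) =
    h t * \1_(`]a, b[%classic) (phi t) * \1_B (phi t) :> R)%R.
  by rewrite indicI /= (mulrC (\1_B _)) mulrA.
move=> A mA; under eq_integral do rewrite EI.
apply: (@integral_dynkin _ _ T (measurableTypeR R) R mu _ phi (@RGenOInfty.G R)) => //.
- exact: iI.
- exact: RGenOInfty.measurableE.
- move=> _ _ [x ->] [y ->]; exists (Num.max x y).
  by apply/seteqP; split => z /=; rewrite !in_itv/= !andbT gt_max => /andP.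
- exact: step1.
- move=> B GB; under eq_integral do rewrite -EI.
  exact: HG.
Unshelve. all: by end_near. Qed.

Lemma ae_eq0_of_integral_indic d (T : measurableType d) (R : realType)
    (mu : {measure set T -> \bar R}) (h : T -> R) :
  mu.-integrable setT (EFin \o h) ->
  (forall A, measurable A -> (\int[mu]_t (h t * \1_A t)%:E = 0)%E) ->
  {ae mu, forall t, h t = 0}.
Proof.
move=> ih H.
have := @integral_ae_eq _ T R mu setT measurableT (cst 0%E) (EFin \o h) ih
  (measurable_cst _).
have K : forall E, E `<=` [set: T] -> measurable E ->
    (\int[mu]_(x in E) (EFin \o h) x = \int[mu]_(x in E) cst 0 x)%E.
  move=> E _ mE; rewrite integral0 -(H E mE).
  by rewrite -(@integral_preimage_indic _ _ T T R mu h id E).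
by move=> /(_ K); apply: filterS => t /(_ I) [].
Qed.

(* Countably many test functions, so that the exceptional null sets of a
   family of such statements can be merged. *)
Lemma ae_eq0_of_bump (R : realType) (h : R -> R) (a b : R) :
  measurable_fun setT h ->
  (leb1 R).-integrable `]a, b[%classic (EFin \o h) -> a < b ->
  (forall (r : rat) n, a < ratr r < b ->
     (\int[leb1 R]_t (h t * bump (ratr r) b n t)%:E = 0)%E) ->
  {ae leb1 R, forall t, a < t < b -> h t = 0}.
Proof.
move=> mh ih ab H.
pose k t := h t * \1_(`]a, b[%classic) t.
have ik : (leb1 R).-integrable setT (EFin \o k).
  rewrite (_ : _ \o _ = (EFin \o h) \_ `]a, b[); last first.
    apply/funext => t; rewrite /= patchE /k indicE; case: (_ \in _) => //=;
    by rewrite ?mulr1 ?mulr0.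
  by apply/(integrable_mkcond _ _).1.
have K A : measurable A -> (\int[leb1 R]_t (k t * \1_A t)%:E = 0)%E.
  move=> mA.
  have := @integral_bump_eq0 _ _ R (leb1 R) k id a b ik (@measurable_id _ _ _) ab _ A mA.
  have E t : (k t * \1_(A `&` `]a, b[) t = k t * \1_A t)%R.
    by rewrite indicI /k /= !indicE; case: (t \in `]a, b[%classic); rewrite ?mulr1 ?mulr0 ?mul0r.
  under eq_integral do rewrite E.
  apply => r n arb; rewrite -[RHS](H r n arb); apply: eq_integral => t _.
  rewrite /k -mulrA indicE; case: (boolP (t \in _)) => [_|]; first by rewrite mul1r.
  by rewrite notin_setE/= in_itv/= => /negP atb; rewrite bump_out ?mulr0//; apply: contra atb => /andP[h1 ->];
    rewrite andbT; case/andP: arb => h2 _; exact: lt_trans h1.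
have := ae_eq0_of_integral_indic ik K.
apply: filterS => t; rewrite /k indicE => + atb; rewrite mem_set ?mulr1//=.
Qed.

(** * Functions of three variables tested against products of bumps *)

Section box.
Context {R : realType}.
Let T : measurableType _ := (measurableTypeR R * (measurableTypeR R * measurableTypeR R))%type.
Implicit Types (h : T -> R) (nu : {measure set T -> \bar R}).

Definition bump3 (a0 b0 a1 b1 a2 b2 : R) (n0 n1 n2 : nat) (y : R * (R * R)) : R :=
  bump a0 b0 n0 y.1 * (bump a1 b1 n1 y.2.1 * bump a2 b2 n2 y.2.2).

(** Bumps are exchanged for Borel sets in the three coordinates in turn. Measurable rectangles then
    generate the product sigma-algebra in two rounds, one for each binary product in the nested
    pair. *)
Lemma ae_eq0_of_bump3 nu h (a0 b0 a1 b1 a2 b2 : R) :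
  nu.-integrable setT (EFin \o h) -> a0 < b0 -> a1 < b1 -> a2 < b2 ->
  (forall (r0 r1 r2 : rat) n0 n1 n2, a0 < ratr r0 < b0 -> a1 < ratr r1 < b1 ->
     a2 < ratr r2 < b2 ->
     (\int[nu]_y (h y * bump3 (ratr r0) b0 (ratr r1) b1 (ratr r2) b2 n0 n1 n2 y)%:E = 0)%E) ->
  {ae nu, forall y, a0 < y.1 < b0 -> a1 < y.2.1 < b1 -> a2 < y.2.2 < b2 -> h y = 0}.
Proof.
move=> ih ab0 ab1 ab2 H.
have mh : measurable_fun setT h by apply/measurable_EFinP; exact: measurable_int ih.
have imul (k : T -> R) (u : R -> R) (phi : T -> R) : nu.-integrable setT (EFin \o k) ->
    measurable_fun setT phi -> measurable_fun setT u -> (forall x, 0 <= u x <= 1) ->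
    nu.-integrable setT (EFin \o (fun y => k y * u (phi y))).
  move=> ik mphi muu u01.
  have mk : measurable_fun setT k by apply/measurable_EFinP; exact: measurable_int ik.
  apply: le_integrable ik => //.
    apply/measurable_EFinP; apply: measurable_funM => //.
    exact: measurableT_comp.
  move=> t _ /=; rewrite lee_fin normrM ler_piMr//.
  by rewrite ger0_norm; case/andP: (u01 (phi t)).
have bump01 (a b : R) n x : 0 <= bump a b n x <= 1 by rewrite bump_ge0 bump_le1.
have indic01 (A : set R) x : 0 <= (\1_A x : R) <= 1.
  by rewrite indicE; case: (_ \in _); rewrite /= ?lexx ler01.
have m1 : measurable_fun setT (fun y : T => y.1) by exact: measurable_fst.
have m2 : measurable_fun setT (fun y : T => y.2.1).
  by apply: (measurableT_comp measurable_fst); exact: measurable_snd.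
have m3 : measurable_fun setT (fun y : T => y.2.2).
  by apply: (measurableT_comp measurable_snd); exact: measurable_snd.
have mI (A B : set R) : measurable A -> measurable B ->
   measurable_fun setT (\1_(A `&` B) : R -> R).
  by move=> mA mB; apply: measurable_indic; exact: measurableI.
have mo (a b : R) : measurable (`]a, b[%classic : set R) by [].
have ib (k : T -> R) a b n phi : nu.-integrable setT (EFin \o k) ->
    measurable_fun setT phi -> nu.-integrable setT (EFin \o (fun y => k y * bump a b n (phi y))).
  by move=> ik mphi; apply: (imul) => //; exact: measurable_bump.
have ii' (k : T -> R) (A : set R) phi : nu.-integrable setT (EFin \o k) -> measurable A ->
    measurable_fun setT phi -> nu.-integrable setT (EFin \o (fun y => k y * \1_A (phi y))).
  by move=> ik mA mphi; apply: (imul) => //; exact: measurable_indic.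
have ii (k : T -> R) (A B : set R) phi : nu.-integrable setT (EFin \o k) -> measurable A -> measurable B ->
    measurable_fun setT phi -> nu.-integrable setT (EFin \o (fun y => k y * \1_(A `&` B) (phi y))).
  by move=> ik mA mB; apply: ii' => //; exact: measurableI.
have H1 (r1 r2 : rat) n1 n2 A0 : a1 < ratr r1 < b1 -> a2 < ratr r2 < b2 -> measurable A0 ->
  (\int[nu]_y ((h y * bump (ratr r1) b1 n1 y.2.1 * bump (ratr r2) b2 n2 y.2.2) *
     \1_(A0 `&` `]a0, b0[) y.1)%:E = 0)%E.
  move=> h1 h2 mA.
  apply: (@integral_bump_eq0 _ T R nu _ (fun y => y.1)) => //.
    by apply: (ib) => //; exact: ib.
  move=> r0 n0 h0; rewrite -[RHS](H r0 r1 r2 n0 n1 n2)//; apply: eq_integral => y _.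
  by congr (_%:E); rewrite /bump3; ring.
have H2 (r2 : rat) n2 A0 A1 : a2 < ratr r2 < b2 -> measurable A0 -> measurable A1 ->
  (\int[nu]_y ((h y * \1_(A0 `&` `]a0, b0[) y.1 * bump (ratr r2) b2 n2 y.2.2) *
     \1_(A1 `&` `]a1, b1[) y.2.1)%:E = 0)%E.
  move=> h2 mA0 mA1.
  apply: (@integral_bump_eq0 _ T R nu _ (fun y => y.2.1)) => //.
    by apply: (ib) => //; exact: ii.
  move=> r1 n1 h1; rewrite -[RHS](H1 r1 r2 n1 n2 A0)//; apply: eq_integral => y _.
  by congr (_%:E); ring.
have H3 A0 A1 A2 : measurable A0 -> measurable A1 -> measurable A2 ->
  (\int[nu]_y ((h y * \1_(A0 `&` `]a0, b0[) y.1 * \1_(A1 `&` `]a1, b1[) y.2.1) *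
     \1_(A2 `&` `]a2, b2[) y.2.2)%:E = 0)%E.
  move=> mA0 mA1 mA2.
  apply: (@integral_bump_eq0 _ T R nu _ (fun y => y.2.2)) => //.
    by apply: (ii) => //; exact: ii.
  move=> r2 n2 h2; rewrite -[RHS](H2 r2 n2 A0 A1)//; apply: eq_integral => y _.
  by congr (_%:E); ring.
pose k y := h y * \1_(`]a0, b0[%classic) y.1 * \1_(`]a1, b1[%classic) y.2.1 * \1_(`]a2, b2[%classic) y.2.2.
have ik : nu.-integrable setT (EFin \o k).
  by apply: (ii') => //; apply: (ii') => //; exact: ii'.
have H4 A0 A1 A2 : measurable A0 -> measurable A1 -> measurable A2 ->
  (\int[nu]_y (k y * \1_A0 y.1 * (\1_A1 y.2.1 * \1_A2 y.2.2))%:E = 0)%E.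
  move=> mA0 mA1 mA2; rewrite -[RHS](H3 A0 A1 A2)//; apply: eq_integral => y _.
  by rewrite !indicI/= /k; congr (_%:E); ring.
have m22 : measurable_fun setT (fun y : T => y.2) by exact: measurable_snd.
have mind d (X : measurableType d) (C : set X) (phi : T -> X) : measurable C ->
    measurable_fun setT phi -> measurable_fun setT (fun y => \1_C (phi y) : R).
  by move=> mC mphi; apply: measurableT_comp => //; exact: measurable_indic.
have imulI d (X : measurableType d) (C : set X) (phi : T -> X) (k' : T -> R) : measurable C ->
    measurable_fun setT phi -> nu.-integrable setT (EFin \o k') ->
    nu.-integrable setT (EFin \o (fun y => k' y * \1_C (phi y))).
  move=> mC mphi ik'.
  have mk' : measurable_fun setT k' by apply/measurable_EFinP; exact: measurable_int ik'.
  apply: le_integrable ik' => //.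
    by apply/measurable_EFinP; apply: measurable_funM => //; exact: mind.
  move=> t _ /=; rewrite lee_fin normrM ler_piMr//.
  by rewrite indicE; case: (_ \in _); rewrite /= ?normr0 ?normr1.
have H5 A0 C : measurable A0 -> measurable C ->
   (\int[nu]_y (k y * \1_A0 y.1 * \1_C y.2)%:E = 0)%E.
  move=> mA0.
  apply: (@integral_dynkin _ _ T (measurableTypeR R * measurableTypeR R)%type R nu
    (fun y => k y * \1_A0 y.1) snd _ _ _ (measurable_prod_measurableType _ _)) => //.
  - exact: imulI.
  - move=> _ _ [A mA [B mB <-]] [A' mA' [B' mB' <-]].
    exists (A `&` A'); first exact: measurableI.
    by exists (B `&` B'); [exact: measurableI|rewrite setXI].
  - rewrite -[RHS](H4 A0 setT setT)//; apply: eq_integral => y _.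
    by rewrite !indicT/= !mulr1.
  - move=> _ [A mA [B mB <-]]; rewrite -[RHS](H4 A0 A B)//; apply: eq_integral => y _.
    congr (_ * _)%:E; rewrite !indicE -natrM mulnb; congr (nat_of_bool _)%:R.
    by apply/idP/andP; rewrite !inE.
have H6 D : measurable D -> (\int[nu]_y (k y * \1_D y)%:E = 0)%E.
  apply: (@integral_dynkin _ _ T T R nu k id _ _ _ (measurable_prod_measurableType _ _)) => //.
  - move=> _ _ [A mA [B mB <-]] [A' mA' [B' mB' <-]].
    exists (A `&` A'); first exact: measurableI.
    by exists (B `&` B'); [exact: measurableI|rewrite setXI].
  - rewrite -[RHS](H5 setT setT)//; apply: eq_integral => y _.
    by rewrite !indicT/= !mulr1.
  - move=> _ [A mA [B mB <-]]; rewrite -[RHS](H5 A B)//; apply: eq_integral => y _.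
    rewrite -mulrA; congr (_ * _)%:E; rewrite !indicE -natrM mulnb; congr (nat_of_bool _)%:R.
    by apply/idP/andP; rewrite !inE.
have := ae_eq0_of_integral_indic ik H6.
apply: filterS => y; rewrite /k !indicE => + h0 h1 h2.
by rewrite !mem_set ?mulr1//= in_itv.
Qed.

(** Every point of [O] is interior to a box with rational corners inside [O], and there are only
    countably many such boxes, so their exceptional sets can be united. *)
Lemma ae_open_of_boxes nu (O : set T) (P : T -> Prop) : open (O : set (R * (R * R))) ->
  (forall a0 b0 a1 b1 a2 b2 : R, a0 < b0 -> a1 < b1 -> a2 < b2 ->
     `[a0, b0] `*` (`[a1, b1] `*` `[a2, b2]) `<=` O ->
     {ae nu, forall y, a0 < y.1 < b0 -> a1 < y.2.1 < b1 -> a2 < y.2.2 < b2 -> P y}) ->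
  {ae nu, forall y, O y -> P y}.
Proof.
move=> oO H.
pose B (q : rat * rat * (rat * rat) * (rat * rat)) : set T :=
  `[ratr q.1.1.1, ratr q.1.1.2] `*` (`[ratr q.1.2.1, ratr q.1.2.2] `*` `[ratr q.2.1, ratr q.2.2]).
have C (q : rat * rat * (rat * rat) * (rat * rat)) : {ae nu, forall y, B q `<=` O ->
   ratr q.1.1.1 < y.1 < ratr q.1.1.2 -> ratr q.1.2.1 < y.2.1 < ratr q.1.2.2 ->
   ratr q.2.1 < y.2.2 < ratr q.2.2 -> P y}.
  have [BO|] := pselect (B q `<=` O); last by move=> nBO; exact: aeW.
  have [h0|h0] := ltP (ratr q.1.1.1 : R) (ratr q.1.1.2); last first.
    apply: aeW => y _ /andP[h1 h2]; move: (lt_trans h1 h2).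
    by rewrite ltNge h0.
  have [h1|h1] := ltP (ratr q.1.2.1 : R) (ratr q.1.2.2); last first.
    apply: aeW => y _ _ /andP[h2 h3]; move: (lt_trans h2 h3).
    by rewrite ltNge h1.
  have [h2|h2] := ltP (ratr q.2.1 : R) (ratr q.2.2); last first.
    apply: aeW => y _ _ _ /andP[h3 h4]; move: (lt_trans h3 h4).
    by rewrite ltNge h2.
  by apply: (@filterS _ _ (ae_filter_ringOfSetsType nu)) (H _ _ _ _ _ _ h0 h1 h2 BO) => y Hy _.
have D : {ae nu, forall y, forall n : nat, forall q, unpickle n = Some q -> B q `<=` O ->
   ratr q.1.1.1 < y.1 < ratr q.1.1.2 -> ratr q.1.2.1 < y.2.1 < ratr q.1.2.2 ->
   ratr q.2.1 < y.2.2 < ratr q.2.2 -> P y}.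
  apply: ae_foralln => n.
  case: (unpickle n) => [q|]; last exact: aeW.
  by apply: (@filterS _ _ (ae_filter_ringOfSetsType nu)) (C q) => y Hy q' [<-].
apply: (@filterS _ _ (ae_filter_ringOfSetsType nu)) D => y Hy Oy.
have /nbhs_ballP[e /= e0 eO] := oO _ Oy.
have rq (x : R) : exists r s : rat, ratr r < x < ratr s /\ x - e < ratr r /\ ratr s < x + e.
  have /rat_in_itvoo[r] : x - e < x by rewrite ltrBlDr ltrDl.
  rewrite in_itv/= => /andP[r1 r2].
  have /rat_in_itvoo[t] : x < x + e by rewrite ltrDl.
  rewrite in_itv/= => /andP[t1 t2].
  by exists r, t; rewrite r2 t1.
have [r0 [s0 [h0 [h0' h0'']]]] := rq y.1.
have [r1 [s1 [h1 [h1' h1'']]]] := rq y.2.1.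
have [r2 [s2 [h2 [h2' h2'']]]] := rq y.2.2.
apply: (Hy (pickle ((r0, s0), (r1, s1), (r2, s2))) _ (pickleK _)) => //=.
move=> z [/= z0 [/= z1 z2]]; apply: eO.
have zb (x w r t : R) : x - e < r -> t < x + e -> w \in `[r, t] -> ball x e w.
  move=> xr tx; rewrite in_itv/= => /andP[rw wt].
  by rewrite /ball/= ltr_distlC; apply/andP; split; [exact: lt_le_trans rw|exact: le_lt_trans tx].
split => /=; first exact: zb z0.
by split => /=; [exact: zb z1|exact: zb z2].
Qed.

Lemma bump3_neq0 (a0 b0 a1 b1 a2 b2 c0 c1 c2 : R) n0 n1 n2 (y : T) :
  a0 < c0 -> a1 < c1 -> a2 < c2 -> bump3 c0 b0 c1 b1 c2 b2 n0 n1 n2 y != 0 ->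
  (`[a0, b0] `*` (`[a1, b1] `*` `[a2, b2])) y.
Proof.
move=> h0 h1 h2.
have bin (a b c x : R) n : a < c -> bump c b n x != 0 -> x \in `[a, b].
  move=> ac; apply: contraNT; rewrite in_itv/= => xab; rewrite bump_out//.
  by apply: contra xab => /andP[cx xb]; rewrite (ltW xb) (ltW (lt_trans ac cx)).
have prod3 (u v w : R) : u * (v * w) != 0 -> [/\ u != 0, v != 0 & w != 0].
  by rewrite !mulf_eq0 !negb_or => /and3P[].
rewrite /bump3 => /prod3[z0 z1 z2]; split => /=; [exact: bin h0 z0|split => /=].
- exact: bin h1 z1.
- exact: bin h2 z2.
Qed.

Lemma ae_eq0_open nu h (O : set T) : measurable_fun setT h -> open (O : set (R * (R * R))) ->
  (forall a0 b0 a1 b1 a2 b2 : R, a0 < b0 -> a1 < b1 -> a2 < b2 ->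
     `[a0, b0] `*` (`[a1, b1] `*` `[a2, b2]) `<=` O ->
     nu.-integrable (`[a0, b0] `*` (`[a1, b1] `*` `[a2, b2])) (EFin \o h) /\
     forall (r0 r1 r2 : rat) n0 n1 n2, a0 < ratr r0 < b0 -> a1 < ratr r1 < b1 ->
     a2 < ratr r2 < b2 ->
     (\int[nu]_y (h y * bump3 (ratr r0) b0 (ratr r1) b1 (ratr r2) b2 n0 n1 n2 y)%:E = 0)%E) ->
  {ae nu, forall y, O y -> h y = 0}.
Proof.
move=> mh oO H; apply: ae_open_of_boxes => // a0 b0 a1 b1 a2 b2 h0 h1 h2 BO.
have [iB HB] := H _ _ _ _ _ _ h0 h1 h2 BO.
set B := (X in nu.-integrable X _) in iB.
have mB : measurable B by apply: measurableX => //; exact: measurableX.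
(* Only integrability on the box is available. Cutting [h] off there changes no pairing, the bumps
   being supported in the box. *)
pose k : T -> R := h \_ B.
have ik : nu.-integrable setT (EFin \o k).
  have -> : EFin \o k = (EFin \o h) \_ B by rewrite restrict_EFin.
  by apply/(integrable_mkcond _ _).1.
have K0 (r0 r1 r2 : rat) n0 n1 n2 : a0 < ratr r0 < b0 -> a1 < ratr r1 < b1 -> a2 < ratr r2 < b2 ->
   (\int[nu]_y (k y * bump3 (ratr r0) b0 (ratr r1) b1 (ratr r2) b2 n0 n1 n2 y)%:E = 0)%E.
  move=> hr0 hr1 hr2; rewrite -[RHS](HB r0 r1 r2 n0 n1 n2)//; apply: eq_integral => y _.
  rewrite /k patchE; case: ifPn => //; rewrite notin_setE => nBy; rewrite mul0r.
  have [->|b0'] := eqVneq (bump3 (ratr r0) b0 (ratr r1) b1 (ratr r2) b2 n0 n1 n2 y) 0; first by rewrite mulr0.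
  case: nBy; case/andP: hr0 hr1 hr2 => ? _ /andP[? _] /andP[? _]; exact: bump3_neq0 b0'.
have := @ae_eq0_of_bump3 nu k _ _ _ _ _ _ ik h0 h1 h2 K0.
apply: (@filterS _ _ (ae_filter_ringOfSetsType nu)) => y Hy y0 y1 y2; move: (Hy y0 y1 y2).
rewrite /k patchE ifT// inE; split => /=; [|split => /=];
  rewrite in_itv/=; [move: y0|move: y1|move: y2] => /andP[/ltW -> /ltW ->]//.
Qed.

End box.

(** * The fundamental theorem of calculus and the substitution of energy for velocity *)

Lemma integral_is_derive (R : realType) (f F : R -> R) (a b : R) : a <= b ->
  (forall x, a <= x <= b -> is_derive x 1 F (f x)) ->
  (forall x, a <= x <= b -> {for x, continuous f}) ->
  (\int[leb1 R]_(x in `[a, b]) (f x)%:E = (F b - F a)%:E)%E.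
Proof.
rewrite le_eqVlt => /predU1P[<- _ _|ab dF cf].
  by rewrite set_itv1 integral_set1 subrr.
have cF x : a <= x <= b -> {for x, continuous F}.
  move=> /dF ?; apply: differentiable_continuous; apply/derivable1_diffP.
  exact: ex_derive.
rewrite (@continuous_FTC2 _ f F)//.
- apply/continuous_within_itvP => //; split.
  + by move=> x; rewrite in_itv/= => /andP[/ltW ax /ltW xb]; apply: cf; rewrite ax.
  + by apply: cvg_at_right_filter; apply: cf; rewrite lexx ltW.
  + by apply: cvg_at_left_filter; apply: cf; rewrite lexx ltW.
- split.
  + move=> x; rewrite in_itv/= => /andP[/ltW ax /ltW xb].
    by have := dF x; rewrite ax xb => /(_ isT) ?; exact: ex_derive.
  + by apply: cvg_at_right_filter; apply: cF; rewrite lexx ltW.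
  + by apply: cvg_at_left_filter; apply: cF; rewrite lexx ltW.
- move=> x; rewrite in_itv/= => /andP[/ltW ax /ltW xb].
  have := dF x; rewrite ax xb => /(_ isT) ?.
  by rewrite derive1E; exact: derive_val.
Qed.

Lemma energy_set_measure (R : realType) (p q : R) : 0 <= p -> p < q ->
  (\int[leb1 R]_(v in `]p, q]) v%:E = (q ^+ 2 / 2 - p ^+ 2 / 2)%:E)%E.
Proof.
move=> p0 pq.
rewrite integral_itv_obnd_cbnd; last by apply/measurable_EFinP.
apply: (@integral_is_derive _ id (fun v : R => v ^+ 2 / 2) _ _ (ltW pq)) => x _.
- by apply: is_derive_eq; rewrite /GRing.scale/=; lra.
- exact: cvg_id.
Qed.

Section energy_change_of_variables.
Context {R : realType}.
Implicit Types (u : R) (f : R -> R).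
Let S : set (measurableTypeR R * measurableTypeR R) :=
  [set p | 0 < p.2 /\ p.2 < p.1].

Let mS : measurable S.
Proof.
have mf : measurable_fun setT (fun p : measurableTypeR R * measurableTypeR R => p.1).
  exact: measurable_fst.
have ms : measurable_fun setT (fun p : measurableTypeR R * measurableTypeR R => p.2).
  exact: measurable_snd.
have -> : S = (fun p => 0 < p.2) @^-1` [set true] `&` (fun p => p.2 < p.1) @^-1` [set true].
  by [].
apply: measurableI; rewrite -[X in measurable X]setTI.
- by apply: measurable_fun_ltr.
- by apply: measurable_fun_ltr.
Qed.

(* The subgraph of [v] over [v > 0], so that the density [v] need not be
   handled as a measure; what lies outside is sent out of [`]u, +oo[]. *)
Let psi u (p : measurableTypeR R * measurableTypeR R) : measurableTypeR R :=
  if p \in S then p.1 ^+ 2 / 2 + u else u - 1.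

Let mpsi u : measurable_fun setT (psi u).
Proof.
apply: measurable_fun_if => //.
- by apply: (measurable_fun_bool true); rewrite setTI preimage_mem_true.
- apply: measurable_funTS; apply: measurable_funD => //; apply: measurable_funM => //.
  by apply: measurable_funX; exact: measurable_fst.
Qed.

Lemma psi_preimage u (A : set R) : A `<=` `]u, +oo[ ->
  psi u @^-1` A = [set p | S p /\ A (p.1 ^+ 2 / 2 + u)].
Proof.
move=> Au; apply/seteqP; split => p /=; rewrite /psi; case: ifPn => //.
- by rewrite inE.
- by move=> _ /Au /=; rewrite in_itv/= andbT; lra.
- by rewrite inE => ? [].
- by rewrite notin_setE => ? [].
Qed.

(** By Tonelli: the section of [S] above [v > 0] is []0, v[], and its length [v] is the Jacobian of
    [v |-> v^2/2 + u]. *)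
Lemma psi_integral u (A : set R) (f : R -> R) : measurable A -> A `<=` `]u, +oo[ ->
  measurable_fun setT f -> (forall x, 0 <= f x) ->
  (\int[leb2 R]_(p in psi u @^-1` A) (f (psi u p))%:E =
   \int[leb1 R]_(v in `]0%R, +oo[ `&` [set v : R | A (v ^+ 2 / 2 + u)%R]) (f (v ^+ 2 / 2 + u) * v)%:E)%E.
Proof.
move=> mA Au mf f0.
have mAv : measurable (`]0, +oo[ `&` [set v : R | A (v ^+ 2 / 2 + u)]).
  apply: measurableI => //; rewrite -[X in measurable X]setTI.
  have : measurable_fun setT (fun v : R => v ^+ 2 / 2 + u).
    by apply: measurable_funD => //; apply: measurable_funM => //; exact: measurable_funX.
  exact.
rewrite integral_mkcond [RHS]integral_mkcond.
rewrite (fubini_tonelli1 (m1 := leb1 R) (m2 := leb1 R))/=; last 2 first.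
- apply/(measurable_restrictT _ _).1.
    by rewrite -[X in measurable X]setTI; exact: mpsi.
  apply: measurable_funTS; apply/measurable_EFinP.
  exact: measurableT_comp.
- move=> p; rewrite patchE; case: ifPn => // _; by rewrite lee_fin.
apply: eq_integral => v _; rewrite /fubini_F patchE.
case: ifPn => [|nv].
  rewrite inE/= in_itv/= andbT => -[v0 Av].
  rewrite (_ : (fun y => _) = (fun y => (f (v ^+ 2 / 2 + u) * \1_(`]0, v[%classic) y)%:E)).
    rewrite -[LHS](_ : (\int[leb1 R]_y ((f (v ^+ 2 / 2 + u))%:E * (\1_(`]0, v[%classic) y)%:E) = _)%E)//.
    rewrite ge0_integralZl//; last 2 first.
    - by apply: measurableT_comp => //; exact: measurable_indic.
    - by rewrite lee_fin.
    rewrite integral_indic// setIT.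
    by rewrite [X in (_ * X)%E]lebesgue_measure_itv/= lte_fin v0 sube0.
  apply/funext => y; rewrite patchE indicE.
  have -> : ((v, y) \in psi u @^-1` A) = (y \in `]0, v[%classic).
    rewrite psi_preimage//; apply/idP/idP; rewrite !inE/= in_itv/=; first by case=> -[-> ->].
    by case/andP.
  case: ifPn => yv; rewrite ?mulr0 ?mulr1//=.
  by rewrite /psi ifT//; move: yv; rewrite !inE/= in_itv/= => /andP[].
rewrite integral0_eq// => y _; rewrite patchE ifF//; apply/negbTE; rewrite notin_setE.
rewrite psi_preimage// => -[[/= y0 yv] Av]; move: nv; rewrite notin_setE; apply.
by split => //=; rewrite in_itv/= andbT (lt_trans y0).
Qed.

(** The two measures agree on half-open intervals, where both sides are explicit, and uniqueness of
    measures does the rest. Both are restricted to []u, +oo[] because the complement of [S], of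
    infinite mass, is sent to the single value [u - 1]. *)
Lemma psi_measure u (A : set R) : measurable A -> A `<=` `]u, +oo[ ->
  pushforward (leb2 R) (psi u) A = leb1 R A.
Proof.
move=> mA Au.
have key (B : set R) : measurable B -> B `<=` `]u, +oo[ ->
    pushforward (leb2 R) (psi u) B =
    (\int[leb1 R]_(v in `]0%R, +oo[ `&` [set v : R | B (v ^+ 2 / 2 + u)%R]) v%:E)%E.
  move=> mB Bu; have := @psi_integral u B (cst 1) mB Bu (measurable_cst _) (fun=> ler01).
  rewrite [LHS](_ : _ = (\int[leb2 R]_(p in psi u @^-1` B) cst 1%:E p)%E)//.
  rewrite integral_cst//= ?mul1e; last by rewrite -[X in measurable X]setTI; exact: mpsi.
  by rewrite /pushforward => ->; apply: eq_integral => v _; rewrite mul1r.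
(* The velocities with energy in []a, b]] form an interval between two square roots, and the
   integral of [v] over it is exactly [b - a]. *)
have keyi a b : u <= a -> a < b -> pushforward (leb2 R) (psi u) `]a, b]%classic = leb1 R `]a, b]%classic.
  move=> ua ab; rewrite key//; last first.
    by move=> x /=; rewrite !in_itv/= andbT => /andP[ax _]; exact: le_lt_trans ax.
  rewrite (_ : _ `&` _ = `]Num.sqrt (2 * (a - u)), Num.sqrt (2 * (b - u))]%classic); last first.
    apply/seteqP; split => v /=; rewrite !in_itv/= andbT.
      move=> [v0 /andP[h1 h2]]; rewrite -[v]gtr0_norm// -sqrtr_sqr ltr_sqrt ?exprn_gt0// ler_sqrt; last by lra.
      by apply/andP; split; lra.
    move=> /andP[h1 h2]; have v0 : 0 < v by rewrite (le_lt_trans _ h1)// sqrtr_ge0.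
    have e : Num.sqrt (v ^+ 2) = v by rewrite sqrtr_sqr gtr0_norm.
    split=> //; move: h1 h2; rewrite -[in X in X -> _]e -[in X in _ -> X -> _]e.
    rewrite ltr_sqrt ?exprn_gt0// ler_sqrt; last by lra.
    by move=> h1 h2; apply/andP; split; lra.
  rewrite energy_set_measure; [|exact: sqrtr_ge0|by rewrite ltr_sqrt; lra].
  rewrite !sqr_sqrtr; [|lra|lra].
  rewrite [RHS]lebesgue_measure_itv/= lte_fin ab -EFinB; congr (_%:E); lra.
pose mp := pushforward (leb2 R) (psi u) : {measure set _ -> \bar R}.
have := @measure_unique _ R (measurableTypeR R) (@ocitv R) (fun k => `](- k%:R), k%:R]%classic) erefl _ _ _
  (mrestr (leb1 R) (measurable_itv `]u, +oo[)) (mrestr (mp (mpsi u)) (measurable_itv `]u, +oo[)).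
rewrite /mrestr => /(_ _ _ _ _ _ A mA).
move=> MU; have AE : A = A `&` `]u, +oo[ by rewrite setIidl.
rewrite [in LHS]AE [in RHS]AE; apply/esym; apply: MU.
- move=> _ _ [[a b] _ <-] [[a' b'] _ <-].
  exists (Num.max a a', Num.min b b') => //=.
  apply/seteqP; split => x /=; rewrite !in_itv/= gt_max le_min.
    by move=> /andP[/andP[-> ->] /andP[-> ->]].
  by move=> [/andP[-> ->] /andP[-> ->]].
- by move=> k; exists (- k%:R, k%:R).
- apply/seteqP; split => // x _; exists (Num.bound `|x|) => //=.
  rewrite in_itv/=; have := archi_boundP (normr_ge0 x).
  by rewrite ltr_norml => /andP[-> /ltW].
- move=> _ [[a b] _ <-].
  change (leb1 R (`]a, b] `&` `]u, +oo[) =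
          pushforward (leb2 R) (psi u) (`]a, b] `&` `]u, +oo[)).
  have -> : (`]a, b] `&` `]u, +oo[) = `]Num.max a u, b]%classic.
    apply/seteqP; split => x /=; rewrite !in_itv/= gt_max ?andbT.
      by move=> [/andP[-> ->] ->].
    by move=> /andP[/andP[-> ->] ->].
  have [ub|bu] := ltP (Num.max a u) b.
    by rewrite -keyi// le_max lexx orbT.
  by rewrite set_itv_ge ?bnd_simp -?leNgt// measure0 /pushforward preimage_set0 measure0.
- move=> k; rewrite (@le_lt_trans _ _ (leb1 R `](- k%:R), k%:R]%classic))//.
    by apply: le_measure; rewrite ?inE//; exact: measurableI.
  by rewrite lebesgue_measure_itv/=; case: ifP => // _; rewrite -EFinB ltry.
Qed.

(* [dE = v dv] along [E = v^2/2 + u] *)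
Lemma ge0_integral_energy u f : measurable_fun setT f -> (forall x, 0 <= f x) ->
  (\int[leb1 R]_(v in `]0%R, +oo[) (f v)%:E =
   \int[leb1 R]_(E in `]u, +oo[) (f (Num.sqrt (2 * (E - u))) / Num.sqrt (2 * (E - u)))%:E)%E.
Proof.
move=> mf f0.
pose h E := f (Num.sqrt (2 * (E - u))) / Num.sqrt (2 * (E - u)).
have mh : measurable_fun setT h.
  have ms : measurable_fun setT (fun E : R => Num.sqrt (2 * (E - u))).
    apply: measurableT_comp; last by apply: measurable_funM => //; exact: measurable_funB.
    by apply: continuous_measurable_fun; exact: sqrt_continuous.
  apply: measurable_funM; first exact: measurableT_comp.
  by apply: measurableT_comp => //; exact: measurable_invr.
have h0 E : 0 <= h E by rewrite divr_ge0// sqrtr_ge0.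
pose mp := pushforward (leb2 R) (psi u) : {measure set _ -> \bar R}.
transitivity (\int[mp (mpsi u)]_(E in `]u, +oo[) (h E)%:E)%E; last first.
  by apply: eq_measure_integral => A mA Au; exact: psi_measure.
rewrite (ge0_integral_pushforward (mpsi u))//=; last 2 first.
- by apply/measurable_EFinP; exact: measurable_funTS.
- by move=> E _; rewrite lee_fin.
rewrite psi_integral//.
rewrite (_ : _ `&` _ = `]0, +oo[%classic); last first.
  apply/seteqP; split => v /=; rewrite !in_itv/= !andbT; first by case.
  by move=> v0; split => //; rewrite ltrDr divr_gt0// exprn_gt0.
apply: eq_integral => v; rewrite inE/= in_itv/= andbT => v0.
rewrite /h (_ : Num.sqrt _ = v) ?divfK ?gt_eqF//.
by rewrite -[RHS]gtr0_norm// -sqrtr_sqr; congr Num.sqrt; lra.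
Qed.

End energy_change_of_variables.

Lemma ge0_integral_fold_line (R : realType) (f : R -> R) :
  measurable_fun setT f -> (forall x, 0 <= f x) ->
  (\int[leb1 R]_x (f x)%:E = \int[leb1 R]_(x in `]0%R, +oo[) (f x + f (- x))%:E)%E.
Proof.
move=> mf f0.
have mfN : measurable_fun setT (fun x : R => f (- x)) by exact: measurableT_comp.
have E : ([set: R] = `]-oo, 0] `|` `]0, +oo[)%classic.
  apply/seteqP; split => // x _ /=; rewrite !in_itv/= andbT.
  by have [|] := leP x 0; [left|right].
rewrite [in LHS]E ge0_integral_setU//=; last 3 first.
- by apply/measurable_EFinP; exact: measurable_funTS.
- by move=> x _; rewrite lee_fin.
- rewrite disj_set2E; apply/eqP/seteqP; split => // x /=; rewrite !in_itv/= andbT => -[h1 h2].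
  by move: (le_lt_trans h1 h2); rewrite ltxx.
under [in RHS]eq_integral do rewrite EFinD.
rewrite ge0_integralD//; last 4 first.
- by move=> x _; rewrite lee_fin.
- by apply/measurable_EFinP; exact: measurable_funTS.
- by move=> x _; rewrite lee_fin.
- by apply/measurable_EFinP; exact: measurable_funTS.
rewrite addeC; congr (_ + _)%E.
rewrite integral_itv_obnd_cbnd; last by apply/measurable_EFinP; exact: measurable_funTS.
rewrite (@ge0_integration_by_substitution0 R (fun x => (f (- x))%:E))//.
- by apply: eq_integral => x _; rewrite opprK.
- exact/measurable_EFinP.
- by move=> r; rewrite lee_fin.
Qed.

(** * Energy as a coordinate *)

Section product_of_sigma_finite.
Context d1 d2 (T1 : measurableType d1) (T2 : measurableType d2) (R : realType).
Context (m1 : {sigma_finite_measure set T1 -> \bar R}) (m2 : {sigma_finite_measure set T2 -> \bar R}).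

Let product_sigma_finite : sigma_finite setT (m1 \x m2)%E.
Proof.
have /sigma_finiteP[F [TF ndF Foo]] := sigma_finiteT m1.
have /sigma_finiteP[G [TG ndG Goo]] := sigma_finiteT m2.
exists (fun n => F n `*` G n).
 rewrite -setXTT TF TG predeqE => -[x y]; split.
    move=> [/= [n _ Fnx] [k _ Gky]]; exists (maxn n k) => //; split.
    - by move: x Fnx; exact/subsetPset/ndF/leq_maxl.
    - by move: y Gky; exact/subsetPset/ndG/leq_maxr.
  by move=> [n _ []/= ? ?]; split; exists n.
move=> k; have [? ?] := Foo k; have [? ?] := Goo k.
split; first exact: measurableX.
by rewrite product_measure1E// lte_mul_pinfty// ge0_fin_numE.
Qed.

(* The library does not infer that [m1 \x m2] is sigma-finite (the instance is
   shadowed by the one for subprobabilities), hence this alias. *)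
Definition prodm : set (T1 * T2)%type -> \bar R := (m1 \x m2)%E.

HB.instance Definition _ := Measure.copy prodm (m1 \x m2)%E.

HB.instance Definition _ := Measure_isSigmaFinite.Build _ _ _ prodm product_sigma_finite.

End product_of_sigma_finite.

Section orbit_coordinates.
Context d (T : measurableType d) (R : realType) (nu : {sigma_finite_measure set T -> \bar R}).
Context (U : R -> R) (mU : measurable_fun setT U).
Let X : measurableType _ := (measurableTypeR R * (measurableTypeR R * T))%type.
Let Y : measurableType _ := (measurableTypeR R * T)%type.
Local Notation lam2 := (prodm (leb1 R) nu).
Local Notation lam := (prodm (leb1 R) (prodm (leb1 R) nu)).

Definition speed (x E : R) : R := Num.sqrt (2 * (E - U x)).

Definition fold_x (F : R * (R * T) -> R) (z : R * (R * T)) : R :=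
  if 0 < z.1 then F z + F (- z.1, z.2) else 0.

Definition to_energy (F : R * (R * T) -> R) (z : R * (R * T)) : R :=
  if U z.1 < z.2.1 then
    (F (z.1, (speed z.1 z.2.1, z.2.2)) + F (z.1, (- speed z.1 z.2.1, z.2.2))) /
      speed z.1 z.2.1
  else 0.

Lemma measurable_speed : measurable_fun setT (fun z : X => speed z.1 z.2.1).
Proof.
have ms : measurable_fun setT (@Num.sqrt R).
  by apply: continuous_measurable_fun; exact: sqrt_continuous.
apply: measurableT_comp => //; apply: measurable_funM => //.
apply: measurable_funB.
  by apply: (measurableT_comp measurable_fst); exact: measurable_snd.
exact: (measurableT_comp mU).
Qed.

Lemma measurable_fold_x (F : X -> R) : measurable_fun [set: X] F -> measurable_fun [set: X] (fold_x F).
Proof.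
move=> mF; apply: measurable_fun_if => //.
- by apply: measurable_fun_ltr => //; exact: measurable_fst.
- apply: measurable_funTS; apply: measurable_funD => //.
  apply: measurableT_comp => //; apply: measurable_fun_pair.
    by apply: measurableT_comp => //; exact: measurable_fst.
  exact: measurable_snd.
Qed.

Lemma measurable_to_energy (F : X -> R) : measurable_fun [set: X] F -> measurable_fun [set: X] (to_energy F).
Proof.
move=> mF.
have m21 : measurable_fun [set: X] (fun z : X => z.2.1).
  by apply: (measurableT_comp measurable_fst); exact: measurable_snd.
have m22 : measurable_fun [set: X] (fun z : X => z.2.2).
  by apply: (measurableT_comp measurable_snd); exact: measurable_snd.
have m1 : measurable_fun [set: X] (fun z : X => z.1) by exact: measurable_fst.
have ms := measurable_speed.
apply: measurable_fun_if => //.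
- by apply: measurable_fun_ltr => //; exact: (measurableT_comp mU).
- apply: measurable_funTS; apply: measurable_funM; last first.
    by apply: measurableT_comp => //; exact: measurable_invr.
  apply: measurable_funD; apply: measurableT_comp => //; apply: measurable_fun_pair => //;
    apply: measurable_fun_pair => //.
  exact: measurableT_comp.
Qed.

Lemma fold_x_ge0 (F : X -> R) : (forall z, 0 <= F z) -> forall z, 0 <= fold_x F z.
Proof. by move=> F0 z; rewrite /fold_x; case: ifP => // _; rewrite addr_ge0. Qed.

Lemma to_energy_ge0 (F : X -> R) : (forall z, 0 <= F z) -> forall z, 0 <= to_energy F z.
Proof.
move=> F0 z; rewrite /to_energy; case: ifP => // _.
by rewrite divr_ge0 ?addr_ge0 ?sqrtr_ge0.
Qed.

Lemma ge0_integral_fold_x (F : X -> R) : measurable_fun [set: X] F -> (forall z, 0 <= F z) ->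
  (\int[lam]_z (F z)%:E = \int[lam]_z (fold_x F z)%:E)%E.
Proof.
move=> mF F0.
have ton (H : X -> R) : measurable_fun [set: X] H -> (forall z, 0 <= H z) ->
    (\int[lam]_z (H z)%:E = \int[lam2]_y \int[leb1 R]_x (H (x, y))%:E)%E.
  move=> mH H0; apply: (@fubini_tonelli2 _ _ _ Y R (leb1 R) lam2 (EFin \o H)).
    exact/measurable_EFinP.
  by move=> z; rewrite lee_fin.
rewrite ton// [RHS]ton; [|exact: measurable_fold_x|exact: fold_x_ge0].
apply: eq_integral => y _; rewrite ge0_integral_fold_line//; last first.
  by apply: (measurableT_comp mF); exact: measurable_pair2.
rewrite integral_mkcond; apply: eq_integral => x _.
rewrite patchE /fold_x/=; case: ifPn; first by rewrite inE/= in_itv/= andbT => ->.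
by rewrite notin_setE/= in_itv/= andbT => /negP/negbTE ->.
Qed.

Lemma ge0_integral_to_energy (F : X -> R) : measurable_fun [set: X] F -> (forall z, 0 <= F z) ->
  (\int[lam]_z (F z)%:E = \int[lam]_z (to_energy F z)%:E)%E.
Proof.
move=> mF F0.
have mx (H : X -> R) x : measurable_fun [set: X] H ->
    measurable_fun [set: Y] (fun y => (H (x, y))).
  by move=> mH; apply: (measurableT_comp mH); exact: measurable_pair1.
have ton (H : X -> R) : measurable_fun [set: X] H -> (forall z, 0 <= H z) ->
    (\int[lam]_z (H z)%:E = \int[leb1 R]_x \int[nu]_t \int[leb1 R]_E (H (x, (E, t)))%:E)%E.
  move=> mH H0.
  transitivity (\int[leb1 R]_x \int[lam2]_y (H (x, y))%:E)%E.
    apply: (@fubini_tonelli1 _ _ _ Y R (leb1 R) lam2 (EFin \o H)).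
      exact/measurable_EFinP.
    by move=> z; rewrite lee_fin.
  apply: eq_integral => x _.
  apply: (@fubini_tonelli2 _ _ _ T R (leb1 R) nu (fun y => (H (x, y))%:E)).
    by apply/measurable_EFinP; exact: mx.
  by move=> z; rewrite lee_fin.
rewrite ton// [RHS]ton; [|exact: measurable_to_energy|exact: to_energy_ge0].
apply: eq_integral => x _; apply: eq_integral => t _.
have mf : measurable_fun [set: R] (fun v => F (x, (v, t))).
  apply: (@measurableT_comp _ _ _ _ _ _ (fun y => F (x, y))); first exact: mx.
  exact: measurable_pair2.
rewrite ge0_integral_fold_line//.
rewrite (@ge0_integral_energy _ (U x) (fun v => F (x, (v, t)) + F (x, (- v, t))))//; last 2 first.
- by apply: measurable_funD => //; exact: (measurableT_comp mf).
- by move=> v; rewrite addr_ge0.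
rewrite integral_mkcond; apply: eq_integral => E _.
rewrite patchE /to_energy/=; case: ifPn; first by rewrite inE/= in_itv/= andbT => ->.
by rewrite notin_setE/= in_itv/= andbT => /negP/negbTE ->.
Qed.

Definition fold (F : R * (R * T) -> R) (z : R * (R * T)) : R :=
  F z + F (- z.1, z.2) + (F (z.1, (- z.2.1, z.2.2)) + F (- z.1, (- z.2.1, z.2.2))).

Definition orbit (z : R * (R * T)) : R * (R * T) := (z.1, (speed z.1 z.2.1, z.2.2)).

(** The cut-off is part of the Jacobian: [jac] vanishes for [x <= 0] and in the forbidden region, so
    that integrals in the orbit coordinates run over the whole space. *)
Definition jac (z : R * (R * T)) : R :=
  if (0 < z.1) && (U z.1 < z.2.1) then (speed z.1 z.2.1)^-1 else 0.

Lemma to_energy_fold_x F z : to_energy (fold_x F) z = jac z * fold F (orbit z).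
Proof.
rewrite /to_energy /fold_x /jac /fold /orbit/=.
case: ifP => _; last by rewrite andbF mul0r.
rewrite andbT; case: ifP => _; last by rewrite addr0 !mul0r.
by rewrite mulrC.
Qed.

Lemma ge0_integral_orbit (F : X -> R) : measurable_fun [set: X] F -> (forall z, 0 <= F z) ->
  (\int[lam]_z (F z)%:E = \int[lam]_z (jac z * fold F (orbit z))%:E)%E.
Proof.
move=> mF F0; rewrite ge0_integral_fold_x// ge0_integral_to_energy.
- by apply: eq_integral => z _; rewrite to_energy_fold_x.
- exact: measurable_fold_x.
- exact: fold_x_ge0.
Qed.

Lemma measurable_orbit_fold (F : X -> R) : measurable_fun [set: X] F ->
  measurable_fun [set: X] (fun z => jac z * fold F (orbit z)).
Proof.
move=> mF; rewrite (_ : (fun z => _) = to_energy (fold_x F)).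
  by apply: measurable_to_energy; exact: measurable_fold_x.
by apply/funext => z; rewrite to_energy_fold_x.
Qed.

Lemma orbit_fold_ge0 (F : X -> R) : (forall z, 0 <= F z) -> forall z, 0 <= jac z * fold F (orbit z).
Proof.
by move=> F0 z; rewrite -to_energy_fold_x; apply: to_energy_ge0; exact: fold_x_ge0.
Qed.

Lemma integral_orbit (F : X -> R) : lam.-integrable [set: X] (EFin \o F) ->
  lam.-integrable [set: X] (EFin \o (fun z => jac z * fold F (orbit z))) /\
  (\int[lam]_z (F z)%:E = \int[lam]_z (jac z * fold F (orbit z))%:E)%E.
Proof.
move=> iF.
have mF : measurable_fun [set: X] F by apply/measurable_EFinP; exact: measurable_int iF.
have iFp : lam.-integrable [set: X] (EFin \o F^\+) by exact: integrable_funrpos.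
have iFn : lam.-integrable [set: X] (EFin \o F^\-) by exact: integrable_funrneg.
have key (H : X -> R) : measurable_fun [set: X] H -> (forall z, 0 <= H z) ->
    lam.-integrable [set: X] (EFin \o H) ->
    lam.-integrable [set: X] (EFin \o (fun z => jac z * fold H (orbit z))).
  move=> mH H0 /integrableP[_ iH]; apply/integrableP; split.
    by apply/measurable_EFinP; exact: measurable_orbit_fold.
  under eq_integral do rewrite /= ger0_norm ?orbit_fold_ge0//.
  rewrite -ge0_integral_orbit//; apply: le_lt_trans iH.
  by under [X in (_ <= X)%E]eq_integral do rewrite /= ger0_norm//.
have mp : measurable_fun [set: X] F^\+ by exact: measurable_funrpos.
have mn : measurable_fun [set: X] F^\- by exact: measurable_funrneg.
have ip := key _ mp (fun z => funrpos_ge0 F z) iFp.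
have iN := key _ mn (fun z => funrneg_ge0 F z) iFn.
have FE z : F z = F^\+ z - F^\- z by rewrite -[in LHS](funrposBneg F).
have OE z : jac z * fold F (orbit z) =
    jac z * fold F^\+ (orbit z) - jac z * fold F^\- (orbit z).
  rewrite /fold !FE -mulrBr; congr (_ * _); ring.
split.
  have := integrableB measurableT ip iN.
  by apply: eq_integrable => // z _ /=; rewrite OE.
under eq_integral do rewrite FE EFinB.
under [RHS]eq_integral do rewrite OE EFinB.
rewrite !integralB_EFin//; congr (_ - _)%E; exact: ge0_integral_orbit.
Qed.

End orbit_coordinates.

Lemma near_continuous (R : realType) (f g : R -> R) x :
  (\forall y \near x, f y = g y) -> {for x, continuous g} -> {for x, continuous f}.
Proof.
move=> fg cg; rewrite /prop_for /continuous_at (nbhs_singleton fg).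
by apply: cvg_trans cg; apply: near_eq_cvg; near=> y; apply/esym; near: y.
Unshelve. all: by end_near. Qed.

(** * The steady state and its potential *)

Section profile.
Context {R : realType} (a : ansatz R) (ok : ansatz_ok a) (E0 : R).

Lemma alpha_ge0 E : 0 <= alpha a E0 E.
Proof.
case: a => [k|] /=; case: ifP => // h; first exact: powR_ge0.
by rewrite subr_ge0 -expR0 ler_expR subr_ge0 ltW.
Qed.

Lemma alpha_gt0 E : (0 < alpha a E0 E) = (E < E0).
Proof.
case: a => [k|] /=; case: ifP => h; rewrite ?ltxx//.
- by rewrite powR_gt0// subr_gt0.
- by rewrite subr_gt0 -expR0 ltr_expR subr_gt0.
Qed.

Lemma alpha_nonincreasing E E' : E <= E' -> alpha a E0 E' <= alpha a E0 E.
Proof.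
move=> EE'; have [E'0|] := ltP E' E0; last first.
  move=> h; have -> : alpha a E0 E' = 0.
    by case: a => [k|] /=; rewrite ltNge h.
  exact: alpha_ge0.
have E0' : E < E0 by exact: le_lt_trans E'0.
case: a ok => [k|] /= ok'; rewrite E'0 E0'.
- apply: ge0_ler_powR; rewrite ?nnegrE; [lra|lra|lra|lra].
- by rewrite lerB// ler_expR; lra.
Qed.

Lemma alpha'_lt0 E : E < E0 -> alpha' a E0 E < 0.
Proof.
case: a ok => [k|] /= ok' EE0; rewrite EE0 oppr_lt0.
- by rewrite mulr_gt0 ?powR_gt0 ?subr_gt0//; lra.
- exact: expR_gt0.
Qed.

Lemma alpha'_out E : E0 <= E -> alpha' a E0 E = 0.
Proof. by case: a => [k|] /= h; rewrite ltNge h. Qed.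

Lemma continuous_powR_pos (k : R) : 0 < k -> continuous (fun t : R => powR (Num.max 0 t) k).
Proof.
move=> k0 t; have [t0|t0|<-] := ltrgtP 0 t.
- apply: (@near_continuous _ _ (fun t => powR t k)).
    near=> s; rewrite (max_idPr _)//; apply: ltW; near: s; exact: lt_nbhsr.
  apply: differentiable_continuous; apply/derivable1_diffP.
  have ? := is_derive1_powR k t0; exact: ex_derive.
- apply: (@near_continuous _ _ (fun=> powR 0 k)); last exact: cvg_cst.
  near=> s; rewrite (max_idPl _)//; apply: ltW; near: s; exact: lt_nbhsl.
- rewrite /prop_for /continuous_at maxxx powR0 ?gt_eqF//.
  apply/cvgrPdist_le => e e0; near=> s.
  rewrite sub0r normrN ger0_norm ?powR_ge0//.
  have -> : e = powR (powR e k^-1) k by rewrite -powRrM mulVf ?gt_eqF// powRr1// ltW.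
  have m0 : 0 <= Num.max 0 s by rewrite le_max lexx.
  apply: ge0_ler_powR; [exact: ltW|by rewrite nnegrE|by rewrite nnegrE powR_ge0|].
  rewrite ge_max powR_ge0/=; apply: ltW; near: s; apply: lt_nbhsl.
  exact: powR_gt0.
Unshelve. all: by end_near. Qed.

Lemma alphaE E : alpha a E0 E = match a with
  | Polytrope k => powR (Num.max 0 (E0 - E)) k
  | King => expR (Num.max 0 (E0 - E)) - 1 end.
Proof.
case: a ok => [k|] /= ok'; have [h|h] := ltP E E0.
- by rewrite (max_idPr _)// subr_ge0 ltW.
- rewrite (max_idPl _) ?subr_le0// powR0// gt_eqF//; lra.
- by rewrite (max_idPr _)// subr_ge0 ltW.
- by rewrite (max_idPl _) ?subr_le0// expR0 subrr.
Qed.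

Lemma continuous_alpha : continuous (alpha a E0).
Proof.
have cB : continuous (fun E : R => E0 - E).
  by move=> E; apply: cvgB; [exact: cvg_cst|exact: cvg_id].
have -> : alpha a E0 = (fun E => match a with
  | Polytrope k => powR (Num.max 0 (E0 - E)) k
  | King => expR (Num.max 0 (E0 - E)) - 1 end) by apply/funext => E; rewrite alphaE.
case: a ok => [k|] /= ok' E.
- apply: (@continuous_comp _ _ _ (fun E => E0 - E) (fun t => powR (Num.max 0 t) k)).
    exact: cB.
  by apply: continuous_powR_pos; lra.
- apply: cvgB; last exact: cvg_cst.
  apply: (@continuous_comp _ _ _ (fun E => Num.max 0 (E0 - E)) expR).
    by apply: continuous_max; [exact: cvg_cst|exact: cB].
  exact: continuous_expR.
Qed.

Lemma measurable_alpha : measurable_fun setT (alpha a E0).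
Proof. by apply: continuous_measurable_fun; exact: continuous_alpha. Qed.

Lemma is_derive_alpha E : E < E0 -> is_derive E 1 (alpha a E0) (alpha' a E0 E).
Proof.
move=> EE0.
have dB : is_derive E 1 (fun E : R => E0 - E) (-1).
  have := @is_deriveB _ _ _ (cst E0) id E 1 _ _ (is_derive_cst E0 E 1) (is_derive_id E 1).
  by rewrite sub0r.
have nE : \forall x \near E, x < E0 by exact: lt_nbhsl.
case: a ok => [k|] /= ok'; rewrite EE0.
- have d := @is_derive1_powR R k (E0 - E) ltac:(by rewrite subr_gt0).
  have := @is_derive1_comp R (fun t => powR t k) (fun E => E0 - E) _ _ _ d dB; rewrite mulrN1 => d'.
  apply: (near_eq_is_derive _ d').
  by near=> x; rewrite /alpha ifT//; near: x.
- have d' : is_derive E 1 (fun E => expR (E0 - E) - 1) (- expR (E0 - E)).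
    have d := is_derive_expR (E0 - E).
    have d2 := @is_derive1_comp R expR (fun E => E0 - E) _ _ _ d dB.
    have := @is_deriveB _ _ _ _ (cst (1 : R) : R -> R) E 1 _ _ d2 (is_derive_cst (1 : R) E 1).
    by rewrite subr0 mulrN1.
  apply: (near_eq_is_derive _ d').
  by near=> x; rewrite /alpha ifT//; near: x.
Unshelve. all: by end_near. Qed.

(** Continuity stops at [E0]: there the derivative is unbounded for polytropes with [k < 1] and
    jumps for the King model. Later arguments therefore stay at energies strictly below [E0]. *)
Lemma continuous_alpha' E : E < E0 -> {for E, continuous (alpha' a E0)}.
Proof.
move=> EE0.
have nE : \forall x \near E, x < E0 by exact: lt_nbhsl.
have cB : {for E, continuous (fun E : R => E0 - E)}.
  by apply: cvgB; [exact: cvg_cst|exact: cvg_id].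
case: a ok => [k|] /= ok'.
- apply: (@near_continuous _ _ (fun x => - (k * powR (E0 - x) (k - 1)))).
    by near=> x; rewrite /alpha' ifT//; near: x.
  apply: (@continuousN _ _ _ (fun x => k * powR (E0 - x) (k - 1))).
  apply: (@continuousM _ _ (cst k) (fun x => powR (E0 - x) (k - 1))); first exact: cvg_cst.
  apply: (@continuous_comp _ _ _ (fun E => E0 - E) (fun t => powR t (k - 1))) => //.
  apply: differentiable_continuous; apply/derivable1_diffP.
  have d := @is_derive1_powR R (k - 1) (E0 - E) ltac:(by rewrite subr_gt0).
  exact: ex_derive.
- apply: (@near_continuous _ _ (fun x => - expR (E0 - x))).
    by near=> x; rewrite /alpha' ifT//; near: x.
  apply: (@continuousN _ _ _ (fun x => expR (E0 - x))).
  apply: (@continuous_comp _ _ _ (fun E => E0 - E) expR) => //.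
  exact: continuous_expR.
Unshelve. all: by end_near. Qed.

Lemma measurable_alpha' : measurable_fun setT (alpha' a E0).
Proof.
have mB : measurable_fun setT (fun E : R => E0 - E) by exact: measurable_funB.
case: a ok => [k|] /= ok'; apply: measurable_fun_if => //.
- exact: measurable_fun_ltr.
- apply: measurable_funTS; apply: measurableT_comp => //; apply: measurable_funM => //.
  exact: (measurableT_comp (measurable_powR _) mB).
- exact: measurable_fun_ltr.
- apply: measurable_funTS; apply: measurableT_comp => //.
  exact: (measurableT_comp (@measurable_expR R) mB).
Qed.

End profile.

(** * Additivity of the integral when one factor is not known to be measurable *)

Section lower_integral.
Context d (T : measurableType d) (R : realType) (mu : {measure set T -> \bar R}).
Implicit Types (p q r : T -> R).
Import HBNNSimple.

(* The integral of a nonnegative function is the supremum of the integrals of the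
   simple functions below it, so it is monotone without any measurability. *)
Lemma le_lower_integral r q : (forall x, 0 <= r x) -> (forall x, r x <= q x) ->
  (\int[mu]_x (r x)%:E <= \int[mu]_x (q x)%:E)%E.
Proof.
move=> r0 rq.
rewrite ge0_integralTE => [|x]; last by rewrite lee_fin.
rewrite ge0_integralTE => [|x]; last by rewrite lee_fin (le_trans (r0 x)).
apply: le_ereal_sup => _ [h hr <-]; exists h => //= x.
by rewrite (le_trans (hr x))// lee_fin.
Qed.

(** Used with the density as [r], before the density is known to be measurable. A simple function
    below [(p + q) r] is split in the proportions [p / (p + q)] and [q / (p + q)]; these are
    measurable because [p] and [q] are, and the two pieces lie below [p r] and [q r]. *)
Lemma lower_integralD p q r : measurable_fun setT p -> measurable_fun setT q ->
  (forall x, 0 <= p x) -> (forall x, 0 <= q x) -> (forall x, 0 <= r x) ->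
  (\int[mu]_x ((p x + q x) * r x)%:E =
   \int[mu]_x (p x * r x)%:E + \int[mu]_x (q x * r x)%:E)%E.
Proof.
move=> mp mq p0 q0 r0; apply/eqP; rewrite eq_le; apply/andP; split.
- rewrite [leLHS]ge0_integralTE => [|x]; last by rewrite lee_fin mulr_ge0// addr_ge0.
  apply: ge_ereal_sup => _ [h hpq <-].
  have mh : measurable_fun setT h by exact: measurable_funPT.
  have h0 x : 0 <= h x by exact: fun_ge0.
  have mi : measurable_fun setT (fun x => (p x + q x)^-1).
    by apply: measurableT_comp; [exact: measurable_invr|exact: measurable_funD].
  rewrite -integralT_nnsfun.
  have -> : (\int[mu]_x (h x)%:E = \int[mu]_x (h x * (p x * (p x + q x)^-1))%:E +
      \int[mu]_x (h x * (q x * (p x + q x)^-1))%:E)%E.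
    rewrite -ge0_integralD//; last 4 first.
    - by move=> x _; rewrite lee_fin !mulr_ge0// invr_ge0 addr_ge0.
    - by apply/measurable_EFinP; do 2! apply: measurable_funM => //.
    - by move=> x _; rewrite lee_fin !mulr_ge0// invr_ge0 addr_ge0.
    - by apply/measurable_EFinP; do 2! apply: measurable_funM => //.
    apply: eq_integral => x _; rewrite -EFinD -mulrDr -mulrDl.
    have [pq0|pq0] := eqVneq (p x + q x) 0; last by rewrite mulfV// mulr1.
    have := hpq x; rewrite pq0 mul0r lee_fin => hx0.
    by rewrite (_ : h x = 0) ?mul0r//; apply: le_anti; rewrite hx0 h0.
  have le1 (s t : T -> R) : (forall x, 0 <= s x) -> (forall x, 0 <= t x) ->
      (forall x, (h x)%:E <= ((s x + t x) * r x)%:E)%E ->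
      forall x, h x * (s x * (s x + t x)^-1) <= s x * r x.
    move=> s0 t0 hst x; have [st0|st0] := eqVneq (s x + t x) 0.
      by rewrite st0 invr0 !mulr0 mulr_ge0.
    have stp : 0 < s x + t x by rewrite lt0r st0 addr_ge0.
    rewrite mulrCA ler_wpM2l// ler_pdivrMr// mulrC.
    by have := hst x; rewrite lee_fin.
  apply: leeD; apply: le_lower_integral => x.
  + by rewrite !mulr_ge0// invr_ge0 addr_ge0.
  + exact: le1.
  + by rewrite !mulr_ge0// invr_ge0 addr_ge0.
  + by rewrite (addrC (p x)); apply: le1 => // y; rewrite addrC.
(* For the other inequality, simple functions below the two terms add up to one below the sum. The
   suprema are taken one after the other, which requires subtracting and hence the finiteness of
   [C]. *)
- set C := (X in (_ <= X)%E).
  have [->|Cy] := eqVneq C +oo%E; first exact: leey.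
  have C0 : (0 <= C)%E by apply: integral_ge0 => x _; rewrite lee_fin mulr_ge0// addr_ge0.
  have Cf : C \is a fin_num by rewrite ge0_fin_numE// ltey.
  have key (s t : {nnsfun T >-> R}) : (forall x, ((s x)%:E <= (p x * r x)%:E)%E) ->
      (forall x, ((t x)%:E <= (q x * r x)%:E)%E) -> (sintegral mu s + sintegral mu t <= C)%E.
    move=> sp tq; rewrite -!integralT_nnsfun -ge0_integralD//; last 4 first.
    - by move=> x _; rewrite lee_fin.
    - by apply/measurable_EFinP; exact: measurable_funPT.
    - by move=> x _; rewrite lee_fin.
    - by apply/measurable_EFinP; exact: measurable_funPT.
    apply: le_lower_integral => x; first by rewrite addr_ge0.
    by rewrite mulrDl lerD//; [have := sp x|have := tq x]; rewrite lee_fin.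
  rewrite [X in (X + _)%E]ge0_integralTE => [|x]; last by rewrite lee_fin mulr_ge0.
  rewrite [X in (_ + X)%E]ge0_integralTE => [|x]; last by rewrite lee_fin mulr_ge0.
  have fin (y x : \bar R) : (0 <= y)%E -> (0 <= x)%E -> (x + y <= C)%E -> y \is a fin_num.
    move=> y0 x0 xyC; rewrite ge0_fin_numE//.
    by rewrite (le_lt_trans _ (_ : C < +oo)%E) ?ltey// (le_trans _ xyC)// leeDr.
  set A := ereal_sup _; set B := ereal_sup _.
  have s0 (h : {nnsfun T >-> R}) : (0 <= sintegral mu h)%E by exact: sintegral_ge0.
  have AB (t : {nnsfun T >-> R}) : (forall x, ((t x)%:E <= (q x * r x)%:E)%E) ->
      (A <= C - sintegral mu t)%E.
    move=> tq; apply: ge_ereal_sup => _ [s sp <-].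
    by rewrite leeBrDr ?key// (fin _ (sintegral mu s))// key.
  pose z : {nnsfun T >-> R} := nnsfun0.
  have h0 (u : T -> R) : (forall x, 0 <= u x) ->
      forall x, ((z x)%:E <= (u x * r x)%:E)%E.
    by move=> u0 x; rewrite lee_fin mulr_ge0.
  have A0 : (0 <= A)%E.
    by apply: (le_trans (s0 z)); apply: ereal_sup_ubound; exists z => //; exact: h0.
  have Af : A \is a fin_num.
    rewrite ge0_fin_numE//; apply: (@le_lt_trans _ _ C); last by rewrite ltey.
    apply: (le_trans (AB z (h0 q q0))); rewrite -[leRHS]sube0.
    by apply: leeB.
  rewrite -leeBrDl//; apply: ge_ereal_sup => _ [t tq <-].
  have tf : sintegral mu t \is a fin_num.
    by apply: (fin _ (sintegral mu z)) => //; apply: key => //; exact: h0.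
  by rewrite leeBrDl// -leeBrDr// AB.
Qed.

End lower_integral.

Notation lam2 R := (prodm (leb1 R) (leb1 R)).

Notation lam3 R := (prodm (leb1 R) (lam2 R)).

Notation lam4 R := (prodm (leb1 R) (lam3 R)).

Lemma open_measurable_plane (R : realType) (O : set (R * R)) : open O ->
  measurable (O : set (measurableTypeR R * measurableTypeR R)).
Proof.
move=> oO.
pose B (q : rat * rat * (rat * rat)) : set (measurableTypeR R * measurableTypeR R) :=
  `]ratr q.1.1, ratr q.1.2[ `*` `]ratr q.2.1, ratr q.2.2[.
pose F n : set (measurableTypeR R * measurableTypeR R) :=
  if unpickle n is Some q then (if `[< B q `<=` O >] then B q else set0) else set0.
have -> : O = \bigcup_n F n.
  apply/seteqP; split => y; last first.
    move=> [n _]; rewrite /F; case: (unpickle n) => [q|//].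
    by case: ifPn => [/asboolP BO /BO|].
  move=> Oy; have /nbhs_ballP[e /= e0 eO] := oO _ Oy.
  have rq (x : R) : exists r s : rat, ratr r < x < ratr s /\ x - e < ratr r /\ ratr s < x + e.
    have /rat_in_itvoo[r] : x - e < x by rewrite ltrBlDr ltrDl.
    rewrite in_itv/= => /andP[r1 r2].
    have /rat_in_itvoo[t] : x < x + e by rewrite ltrDl.
    rewrite in_itv/= => /andP[t1 t2].
    by exists r, t; rewrite r2 t1.
  have [r0 [s0 [h0 [h0' h0'']]]] := rq y.1.
  have [r1 [s1 [h1 [h1' h1'']]]] := rq y.2.
  pose q := ((r0, s0), (r1, s1)).
  have Fq : F (pickle q) = B q.
    rewrite /F pickleK ifT//; apply/asboolP => z [/= z0 z1]; apply: eO.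
    have zb (x w r t : R) : x - e < r -> t < x + e -> w \in `]r, t[ -> ball x e w.
      move=> xr tx; rewrite in_itv/= => /andP[rw wt].
      by rewrite /ball/= ltr_distlC; apply/andP; split; [exact: lt_trans rw|exact: lt_trans tx].
    by split => /=; [exact: zb z0|exact: zb z1].
  exists (pickle q); first exact: I.
  rewrite Fq.
  by split => /=; rewrite in_itv.
apply: bigcup_measurable => n _; rewrite /F; case: (unpickle n) => [q|//].
by case: ifP => // _; exact: measurableX.
Qed.

Lemma continuous_measurable_plane (R : realType) (f : R * R -> R) : continuous f ->
  measurable_fun [set: measurableTypeR R * measurableTypeR R] f.
Proof.
move=> /continuousP cf mD; apply: (measurability _ (RGenOpens.measurableE R)) => //.
move=> _ [_ [a [b ->] <-]]; rewrite setTI; apply: open_measurable_plane.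
exact/cf/interval_open.
Qed.

Lemma is_derive_nondecreasing (R : realType) (f df : R -> R) (a b : R) :
  (forall x, a <= x <= b -> is_derive x 1 f (df x)) ->
  (forall x, a <= x <= b -> 0 <= df x) -> a <= b -> f a <= f b.
Proof.
move=> d d0 ab.
have h1 x : x \in `]a, b[%R -> is_derive x 1 f (df x).
  by rewrite in_itv/= => /andP[/ltW ax /ltW xb]; apply: d; rewrite ax.
have h2 : {within `[a, b], continuous f}.
  apply: continuous_in_subspaceT => x; rewrite inE/= in_itv/= => /d dx.
  by apply: differentiable_continuous; apply/derivable1_diffP; exact: ex_derive.
have [c] := MVT_segment ab h1 h2.
by rewrite in_itv/= => cab fE; rewrite -subr_ge0 fE mulr_ge0 ?d0// subr_ge0.
Qed.

(** * Monotonicity and regularity of potential, density and force *)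

Section potential.
Context {R : realType} (a : ansatz R) (beta : R * R -> R) (U0 rho0 : R -> R) (R0 : R).
Context (Ha : ansatz_ok a) (Hbeta_ge0 : forall v, 0 <= beta v)
  (Hbeta_cont : continuous beta)
  (Hbeta_int : (\int[leb2 R]_v (beta v)%:E)%E = 1%:E)
  (Hrho : forall x, (rho0 x)%:E = (\int[leb3 R]_v (f0 a (U0 R0) U0 beta (x, v))%:E)%E)
  (HU : forall x, (U0 x)%:E = ((2 * pi)%:E * \int[leb1 R]_y (`|x - y| * rho0 y)%:E)%E)
  (HU_even : forall x, U0 (- x) = U0 x)
  (Hrho_even : forall x, rho0 (- x) = rho0 x)
  (Hsupp : closure [set x | rho0 x != 0] = [set x | - R0 <= x <= R0])
  (Hrho0 : 0 < rho0 0).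
Let E0 := U0 R0.

Lemma density_ge0 x : 0 <= rho0 x.
Proof.
have := Hrho x.
have -> : (\int[leb3 R]_v (f0 a (U0 R0) U0 beta (x, v))%:E =
  \int[lam3 R]_v (f0 a (U0 R0) U0 beta (x, v))%:E)%E by [].
move=> E; rewrite -lee_fin E; apply: integral_ge0 => v _.
by rewrite lee_fin /f0; apply: mulr_ge0 => //; exact: alpha_ge0.
Qed.

(** Evenness of [U0] symmetrises the kernel, and [|x - y| + |x + y| = 2 max(|x|, |y|)] is
    nondecreasing in [|x|]. *)
Lemma potential_le x x' : `|x| <= `|x'| -> U0 x <= U0 x'.
Proof.
move=> xx'.
have E z : ((U0 z + U0 z)%:E =
    (2 * pi)%:E * \int[leb1 R]_y ((`|z - y| + `|z + y|) * rho0 y)%:E)%E.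
  rewrite EFinD -[in X in (_ + X)%E]HU_even 2!HU -muleDr//; last first.
    by apply: ge0_adde_def; rewrite inE; apply: integral_ge0 => y _; rewrite lee_fin mulr_ge0// density_ge0.
  have mB (w : R) : measurable_fun setT (fun y : R => `|w - y|).
    by apply: measurableT_comp => //; exact: measurable_funB.
  have mA (w : R) : measurable_fun setT (fun y : R => `|w + y|).
    by apply: measurableT_comp => //; exact: measurable_funD.
  congr (_ * _)%E.
  have /= -> := @lower_integralD _ _ _ (leb1 R) (fun y : R => `|z - y|) (fun y : R => `|z + y|) rho0
    (mB z) (mA z) (fun=> normr_ge0 _) (fun=> normr_ge0 _) density_ge0.
  congr (_ + _)%E.
  by apply: eq_integral => y _; rewrite -opprD normrN.
have le2 y : (`|x - y| + `|x + y|) * rho0 y <= (`|x' - y| + `|x' + y|) * rho0 y.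
  rewrite ler_wpM2r ?density_ge0//.
  have M (z : R) : `|z - y| + `|z + y| = 2 * Num.max `|z| `|y|.
    have [z0|z0] := leP 0 z; have [y0|y0] := leP 0 y; have [zy0|zy0] := leP 0 (z + y);
      have [zmy|zmy] := leP 0 (z - y); 
      rewrite ?(ger0_norm z0) ?(ltr0_norm z0) ?(ger0_norm y0) ?(ltr0_norm y0) ?(ger0_norm zy0) ?(ltr0_norm zy0) ?(ger0_norm zmy) ?(ltr0_norm zmy);
      case: leP; lra.
  by rewrite !M ler_wpM2l// ge_max !le_max xx' lexx/= orbT.
suff : U0 x + U0 x <= U0 x' + U0 x' by lra.
rewrite -lee_fin !E; apply: lee_wpmul2l; first by rewrite lee_fin mulr_ge0// pi_ge0.
apply: le_lower_integral => // y.
by rewrite mulr_ge0 ?density_ge0// addr_ge0.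
Qed.

Lemma measurable_even_monotone (f : R -> R) :
  (forall x y, `|x| <= `|y| -> f x <= f y) -> measurable_fun setT f.
Proof.
move=> mf; rewrite (_ : f = (fun t => f (Num.max 0 t)) \o (fun x => `|x|)).
  apply: measurableT_comp; last exact: measurableT_comp.
  apply: nondecreasing_measurable => // x y xy; apply: mf.
  rewrite !ger0_norm ?le_max ?lexx//.
  by rewrite !ge_max lexx xy/= andbT; case: (leP x 0) => //= x0; lra.
apply/funext => x /=; rewrite (max_idPr _)//; apply: le_anti.
by rewrite !mf ?normr_id.
Qed.

Lemma measurable_kinetic (u : R) : measurable_fun setT (fun v : R => v ^+ 2 / 2 + u).
Proof. by apply: measurable_funD => //; apply: measurable_funM => //; exact: measurable_funX. Qed.

Lemma density_energy x : (rho0 x)%:E = (\int[leb1 R]_v (alpha a E0 (v ^+ 2 / 2 + U0 x))%:E)%E.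
Proof.
have mb := continuous_measurable_plane Hbeta_cont.
have ma : measurable_fun setT (fun v : R => alpha a E0 (v ^+ 2 / 2 + U0 x)).
  by apply: measurableT_comp (measurable_kinetic _); exact: measurable_alpha.
rewrite Hrho.
transitivity (\int[leb1 R]_v \int[prodm (leb1 R) (leb1 R)]_t (alpha a E0 (v ^+ 2 / 2 + U0 x) * beta t)%:E)%E.
  pose h (p : measurableTypeR R * (measurableTypeR R * measurableTypeR R)) :=
    alpha a E0 (p.1 ^+ 2 / 2 + U0 x) * beta p.2.
  apply: (@fubini_tonelli1 _ _ (measurableTypeR R) (measurableTypeR R * measurableTypeR R)%type R
    (leb1 R) (prodm (leb1 R) (leb1 R)) (EFin \o h)).
    apply/measurable_EFinP; apply: measurable_funM.
      by apply: (measurableT_comp ma); exact: measurable_fst.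
    by apply: (measurableT_comp mb); exact: measurable_snd.
  by move=> p; rewrite lee_fin mulr_ge0// alpha_ge0.
apply: eq_integral => v _.
under eq_integral do rewrite EFinM.
rewrite ge0_integralZl//.
- by rewrite [X in (_ * X)%E]Hbeta_int mule1.
- exact/measurable_EFinP.
- by move=> t _; rewrite lee_fin.
- by rewrite lee_fin alpha_ge0.
Qed.

Lemma density_le x x' : `|x| <= `|x'| -> rho0 x' <= rho0 x.
Proof.
move=> xx'; rewrite -lee_fin !density_energy; apply: le_lower_integral => v.
  exact: alpha_ge0.
by apply: alpha_nonincreasing => //; rewrite lerD2l potential_le.
Qed.

(** Minus the density is nondecreasing in [|x|]. The monotonicity of potential and density was
    derived from integrals that ignore measurability, so there is no circle. *)
Lemma measurable_density : measurable_fun setT rho0.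
Proof.
rewrite (_ : rho0 = (fun x => - (- rho0 x))); last by apply/funext => x; rewrite opprK.
apply: measurableT_comp => //; apply: measurable_even_monotone => x y xy.
by rewrite lerN2 density_le.
Qed.

Lemma density_out x : R0 < `|x| -> rho0 x = 0.
Proof.
move=> xR; apply: contrapT => /eqP r0.
have : closure [set x | rho0 x != 0] x by apply: subset_closure.
rewrite Hsupp/= -ler_norml => h; move: (le_lt_trans h xR); by rewrite ltxx.
Qed.

Lemma integrable_density (f : R -> R) : continuous f ->
  (leb1 R).-integrable setT (fun y => (f y * rho0 y)%:E).
Proof.
move=> cf.
have -> : (fun y => (f y * rho0 y)%:E) = (EFin \o (f \* rho0)) \_ `[- R0, R0].
  apply/funext => y; rewrite patchE; case: ifPn => //.
  rewrite notin_setE/= in_itv/= => /negP; rewrite -ler_norml -ltNge => /density_out ->.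
  by rewrite mulr0.
apply/(integrable_mkcond _ _).1 => //.
apply: measurable_bounded_integrable => //.
- by rewrite [X in (X < _)%E]lebesgue_measure_itv/=; case: ifP => // _; rewrite -EFinB ltry.
- apply: measurable_funTS; apply: measurable_funM; last exact: measurable_density.
  exact: continuous_measurable_fun.
- have /compact_bounded[M [Mr HM]] : compact (f @` `[- R0, R0]).
    apply: continuous_compact; last exact: segment_compact.
    exact: continuous_subspaceT.
  exists (Num.max 0 (M + 1) * rho0 0); split; first exact: num_real.
  move=> y My x /= xR; rewrite (le_trans _ (ltW My))// normrM.
  rewrite ler_pM//.
    apply: (@le_trans _ _ (M + 1)); last by rewrite le_max lexx orbT.
    by apply: (HM (M + 1)); [rewrite ltrDl|exists x => //; move: xR; rewrite inE].
  rewrite ger0_norm ?density_ge0// density_le// normr0//.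
Qed.

Lemma potential_lipschitz x x' :
  U0 x <= U0 x' + 2 * pi * fine (\int[leb1 R]_y (rho0 y)%:E) * `|x - x'|.
Proof.
have drho : (leb1 R).-integrable setT (EFin \o rho0).
  have cc : continuous (cst 1 : R -> R) by move=> ?; exact: cvg_cst.
  have := integrable_density cc.
  by apply: eq_integrable => // y _ /=; rewrite mul1r.
have mfin : (\int[leb1 R]_y (rho0 y)%:E \is a fin_num)%E by exact: integrable_fin_num drho.
have mr := measurable_density.
have mB (w : R) : measurable_fun setT (fun y : R => `|w - y|).
  by apply: measurableT_comp => //; exact: measurable_funB.
set m := fine _; have -> : 2 * pi * m * `|x - x'| = 2 * pi * (m * `|x - x'|) by ring.
rewrite -lee_fin EFinD (HU x) (HU x') (EFinM (2 * pi)) -muleDr//; last first.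
  apply: ge0_adde_def; rewrite inE; [apply: integral_ge0 => y _|];
    rewrite lee_fin mulr_ge0// ?density_ge0// fine_ge0// integral_ge0// => y _.
  by rewrite lee_fin density_ge0.
apply: lee_wpmul2l; first by rewrite lee_fin mulr_ge0// pi_ge0.
rewrite EFinM fineK// muleC -ge0_integralZl//; last 2 first.
- exact/measurable_EFinP.
- by move=> y _; rewrite lee_fin density_ge0.
under [X in (_ + X)%E]eq_integral do rewrite -EFinM.
have /= <- := @lower_integralD _ _ _ (leb1 R) (fun y : R => `|x' - y|) (fun=> `|x - x'|) rho0
  (mB x') (measurable_cst _) (fun=> normr_ge0 _) (fun=> normr_ge0 _) density_ge0.
apply: le_lower_integral => y; first by rewrite mulr_ge0// density_ge0.
rewrite ler_wpM2r ?density_ge0//.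
have -> : x - y = (x' - y) + (x - x') by lra.
exact: ler_normD.
Qed.

Lemma continuous_potential : continuous U0.
Proof.
set C := 2 * pi * fine (\int[leb1 R]_y (rho0 y)%:E).
have C0 : 0 <= C.
  rewrite mulr_ge0 ?mulr_ge0 ?pi_ge0// fine_ge0// integral_ge0// => y _.
  by rewrite lee_fin density_ge0.
move=> x; apply/cvgrPdist_le => e e0; near=> y.
have h : `|x - y| <= e / (C + 1).
  rewrite ltW//; near: y.
  by apply: (@cvgr_dist_lt _ _ _ (nbhs x) _ id x) => //; rewrite divr_gt0// ltr_wpDl.
have h' : C * `|x - y| <= e.
  rewrite (le_trans (ler_wpM2l C0 h))// mulrCA ler_piMr//; first exact: ltW.
  by rewrite ler_pdivrMr; lra.
have h1 := potential_lipschitz x y; have h2 := potential_lipschitz y x.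
rewrite -/C in h1 h2; rewrite (distrC y x) in h2.
by rewrite ler_norml; apply/andP; split; lra.
Unshelve. all: by end_near. Qed.

(** Dominated convergence. The potential is least at the centre, so the profile at [x = 0] is a
    majorant, and it is integrable because its integral is the real number [rho0 0]. *)
Lemma continuous_density : continuous rho0.
Proof.
move=> x.
have rhoE : rho0 = (fun x => \int[leb1 R]_v alpha a E0 (v ^+ 2 / 2 + U0 x))%R.
  by apply/funext => z; rewrite /Rintegral -density_energy.
have ma z : measurable_fun setT (fun v : R => alpha a E0 (v ^+ 2 / 2 + U0 z)).
  by apply: measurableT_comp (measurable_kinetic _); exact: measurable_alpha.
have ia z : (leb1 R).-integrable setT (EFin \o (fun v : R => alpha a E0 (v ^+ 2 / 2 + U0 z))).
  apply/integrableP; split; first by apply/measurable_EFinP; exact: ma.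
  under eq_integral do rewrite /= ger0_norm ?alpha_ge0//.
  by rewrite -density_energy ltry.
rewrite rhoE; apply: (@continuity_under_integral R _ _ (leb1 R)
  (fun z v => alpha a E0 (v ^+ 2 / 2 + U0 z)) setT measurableT (x - 1) (x + 1) _ _
  (fun v => alpha a E0 (v ^+ 2 / 2 + U0 0)) (ia 0)).
- by move=> z _; exact: ia.
- apply: aeW => v _ z _.
  apply: (@continuous_comp _ _ _ (fun z => v ^+ 2 / 2 + U0 z) (alpha a E0)).
    by apply: cvgD; [exact: cvg_cst|exact: continuous_potential].
  exact: continuous_alpha.
- move=> z _; apply: aeW => v _; rewrite ger0_norm ?alpha_ge0//.
  by apply: alpha_nonincreasing => //; rewrite lerD2l potential_le// normr0.
- by rewrite inE/= in_itv/= ltrBlDr ltrDl ltr01.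
Qed.

Let F (x : R) : R := (\int[leb1 R]_(t in `]-oo, x]) rho0 t)%R.

Let H (x : R) : R := (\int[leb1 R]_(t in `]-oo, x]) (t * rho0 t))%R.

Lemma density_integrable : (leb1 R).-integrable setT (EFin \o rho0).
Proof.
have cc : continuous (cst 1 : R -> R) by move=> ?; exact: cvg_cst.
have := integrable_density cc.
by apply: eq_integrable => // y _ /=; rewrite mul1r.
Qed.

Lemma first_moment_integrable : (leb1 R).-integrable setT (EFin \o (fun t => t * rho0 t)).
Proof.
have cc : continuous (id : R -> R) by move=> ?; exact: cvg_id.
exact: integrable_density cc.
Qed.

Let Fi : R := (\int[leb1 R]_t rho0 t)%R.

Let Hi : R := (\int[leb1 R]_t (t * rho0 t))%R.

Lemma is_derive_mass (x : R) : is_derive x 1 F (rho0 x).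
Proof.
have [d e] := @continuous_FTC1 R rho0 -oo%O x (x + 1) ltac:(by rewrite ltrDl)
  ltac:(by apply: integrableS density_integrable) (ltNyr x) (@continuous_density x).
move: d e; rewrite -/F => d e; split; first exact: d.
by rewrite -derive1E.
Qed.

Lemma is_derive_first_moment (x : R) : is_derive x 1 H (x * rho0 x).
Proof.
have [d e] := @continuous_FTC1 R (fun t => t * rho0 t) -oo%O x (x + 1) ltac:(by rewrite ltrDl)
  ltac:(by apply: integrableS first_moment_integrable) (ltNyr x) ltac:(by apply: cvgM; [exact: cvg_id|exact: continuous_density]).
move: d e; rewrite -/H => d e; split; first exact: d.
by rewrite -derive1E.
Qed.

(** Splitting [|x - y|] at [y = x] leaves only the mass and the first moment to the left of [x],
    which the fundamental theorem of calculus differentiates. The kernel itself, with its corner, is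
    never differentiated. *)
Lemma potentialE (x : R) : U0 x = 2 * pi * (2 * (x * F x - H x) - (x * Fi - Hi)).
Proof.
have i1 : (leb1 R).-integrable setT (EFin \o (rho0 \_ `]-oo, x])).
  rewrite -restrict_EFin; apply/(integrable_mkcond _ _).1 => //.
  exact: integrableS density_integrable.
have i2 : (leb1 R).-integrable setT (EFin \o ((fun t => t * rho0 t) \_ `]-oo, x])).
  rewrite -restrict_EFin; apply/(integrable_mkcond _ _).1 => //.
  exact: integrableS first_moment_integrable.
have := HU x.
have -> : (\int[leb1 R]_y (`|x - y| * rho0 y)%:E =
   \int[leb1 R]_y ((2 * (x * (rho0 \_ `]-oo, x]) y - ((fun t => t * rho0 t) \_ `]-oo, x]) y)
      - (x * rho0 y - y * rho0 y))%R)%:E)%E.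
  apply: eq_integral => y _; congr (_%:E); rewrite !patchE.
  case: ifPn => [|]; rewrite ?inE ?notin_setE/= in_itv/=.
    by move=> yx; rewrite ger0_norm; lra.
  by move=> /negP; rewrite -ltNge => xy; rewrite ltr0_norm ?/point/=; [ring|lra].
move=> e.
have j1 := integrableZl measurableT x i1.
have j2 := integrableB measurableT j1 i2.
have j3 := integrableZl measurableT 2 j2.
have k1 := integrableZl measurableT x density_integrable.
have k2 := integrableB measurableT k1 first_moment_integrable.
have jk := integrableB measurableT j3 k2.
have := integrable_fin_num measurableT jk => /fineK fk.
have : U0 x = 2 * pi * (\int[leb1 R]_y (2 * (x * (rho0 \_ `]-oo, x]) y - ((fun t => t * rho0 t) \_ `]-oo, x]) y)
      - (x * rho0 y - y * rho0 y)))%R.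
  by apply: EFin_inj; rewrite e (EFinM (2 * pi)); congr (_ * _)%E; exact: esym fk.
rewrite RintegralB//.
rewrite RintegralZl//.
 rewrite !RintegralB//; try exact: first_moment_integrable; try exact: density_integrable.
 rewrite !RintegralZl//; try exact: first_moment_integrable; try exact: density_integrable.
 move => ->.
by rewrite /F /H /Fi /Hi -!Rintegral_mkcond.
Qed.

Definition force (x : R) : R := 2 * pi * (2 * F x - Fi).

Lemma is_derive_potential (x : R) : is_derive x 1 U0 (force x).
Proof.
have -> : U0 = (fun x => 2 * pi * (2 * (x * F x - H x) - (x * Fi - Hi))).
  by apply/funext => z; exact: potentialE.
have ? := is_derive_mass x; have ? := is_derive_first_moment x.
apply: is_derive_eq; rewrite /force /GRing.scale/=; lra.
Qed.

Lemma is_derive_force (x : R) : is_derive x 1 force (4 * pi * rho0 x).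
Proof.
have ? := is_derive_mass x; rewrite /force.
apply: is_derive_eq; rewrite /GRing.scale/=; lra.
Qed.

Lemma continuous_force : continuous force.
Proof.
move=> x; apply: differentiable_continuous; apply/derivable1_diffP.
have ? := is_derive_force x; exact: ex_derive.
Qed.

Lemma forceN (x : R) : force (- x) = - force x.
Proof.
have d1 := is_derive_potential (- x).
have d2 : is_derive x 1 (fun x : R => - x) (-1) by apply: is_derive_eq.
have d3 := @is_derive1_comp R U0 (fun x => - x) x _ _ d1 d2.
have -> : force (- x) = - (force (- x) * -1) by lra.
have := is_derive_potential x.
have -> : U0 = U0 \o (fun x => - x) by apply/funext => z /=; rewrite HU_even.
by move=> d4; rewrite -[in RHS](@derive_val _ _ _ _ _ _ _ d4) (@derive_val _ _ _ _ _ _ _ d3).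
Qed.

Lemma force0 : force 0 = 0.
Proof. by have := forceN 0; rewrite oppr0; lra. Qed.

Lemma density_gt0_near : exists2 d, 0 < d <= R0 & forall x, `|x| <= d -> rho0 0 / 2 <= rho0 x.
Proof.
have /cvgrPdist_lt := @continuous_density 0 => /(_ (rho0 0 / 2)).
rewrite divr_gt0// => /(_ isT) /nbhs_ballP[e /= e0 he].
have hd x : `|x| <= e / 2 -> rho0 0 / 2 <= rho0 x.
  move=> xe; have : ball 0 e x.
    by rewrite /ball/= sub0r normrN (le_lt_trans xe)//; lra.
  by move=> /he /=; rewrite ltr_norml => /andP[_]; lra.
exists (e / 2) => //; apply/andP; split; first by rewrite divr_gt0.
rewrite leNgt; apply/negP => Re.
have e2 : 0 <= e / 2 by lra.
have := hd (e / 2); rewrite ger0_norm// => /(_ (lexx _)).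
rewrite (density_out (x := e / 2)) ?ger0_norm// leNgt.
by rewrite divr_gt0.
Qed.

Lemma support_radius_gt0 : 0 < R0.
Proof. by have [d /andP[d0 dR] _] := density_gt0_near; exact: lt_le_trans dR. Qed.

Lemma force_nondecreasing x y : x <= y -> force x <= force y.
Proof.
apply: (@is_derive_nondecreasing _ force (fun x => 4 * pi * rho0 x)) => z _.
- exact: is_derive_force.
- by rewrite !mulr_ge0 ?pi_ge0// density_ge0.
Qed.

(** Near the centre the density is at least half its central value, so the force grows at least like
    [2 pi rho0(0) x] up to some [d]. From [d] to [R0] only monotonicity is left, and [x <= R0] turns
    the value at [d] into a linear bound with slope smaller by the factor [d / R0]. *)
Lemma force_lower_bound : exists2 c, 0 < c & forall x, 0 <= x <= R0 -> c * x <= force x.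
Proof.
have [d /andP[d0 dR] hd] := density_gt0_near.
pose b := 2 * pi * rho0 0.
have b0 : 0 < b by rewrite !mulr_gt0 ?pi_gt0.
have near0 x : 0 <= x <= d -> b * x <= force x.
  move=> /andP[x0 xd].
  have : force 0 - b * 0 <= force x - b * x.
    apply: (is_derive_nondecreasing (f := fun x => force x - b * x)
      (df := fun x => 4 * pi * rho0 x - b) _ _ x0) => z /andP[z0 zx].
      have ? := is_derive_force z; apply: is_derive_eq; rewrite /GRing.scale/=; lra.
    have h := hd z ltac:(by rewrite ger0_norm// (le_trans zx)).
    have : 0 <= (4 * pi) * (rho0 z - rho0 0 / 2) by rewrite !mulr_ge0 ?pi_ge0// subr_ge0.
    rewrite /b; lra.
  by rewrite force0; lra.
have R0p := support_radius_gt0.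
exists (b * d / R0); first by apply: divr_gt0 => //; exact: mulr_gt0.
move=> x /andP[x0 xR].
have [xd|dx] := leP x d.
  apply: le_trans (near0 x _); last by rewrite x0.
  by rewrite ler_wpM2r// ler_pdivrMr// ler_wpM2l// ltW.
apply: le_trans (force_nondecreasing (ltW dx)).
apply: le_trans (near0 d _); last by rewrite lexx ltW.
by rewrite mulrAC ler_pdivrMr// ler_wpM2l// mulr_ge0 ?ltW.
Qed.

Lemma force_gt0 (x : R) : 0 < x -> 0 < force x.
Proof.
have [c c0 hc] := force_lower_bound; have R0p := support_radius_gt0 => x0.
have [xR|Rx] := leP x R0.
  by apply: lt_le_trans (hc x _); [rewrite mulr_gt0|rewrite xR ltW].
apply: lt_le_trans (force_nondecreasing (ltW Rx)).
by apply: lt_le_trans (hc R0 _); [rewrite mulr_gt0|rewrite lexx ltW].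
Qed.

End potential.

(** * Integration up to a singular endpoint, and a weighted Schur test *)

Lemma ge0_integral_le_segments (R : realType) (f : R -> \bar R) (x r : R) (C : \bar R) :
  measurable_fun setT f -> (forall y, 0 <= f y)%E -> x < r ->
  (forall s, x <= s < r -> (\int[leb1 R]_(y in `[x, s]) f y <= C)%E) ->
  (\int[leb1 R]_(y in `[x, r[) f y <= C)%E.
Proof.
move=> mf f0 xr fC.
pose s n := r - (r - x) / n.+1%:R.
have s_itv n : x <= s n < r.
  rewrite /s; apply/andP; split; last by rewrite ltrBlDr ltrDl divr_gt0// subr_gt0.
  rewrite lerBrDr -lerBrDl ler_pdivrMr// ler_peMr ?ler1n//.
  by rewrite subr_ge0 ltW.
have <- : \bigcup_n `[x, s n]%classic = `[x, r[%classic.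
  apply/seteqP; split => y /=.
    move=> [n _] /=; rewrite !in_itv/= => /andP[-> ys].
    by have /andP[_] := s_itv n; exact: le_lt_trans.
  rewrite in_itv/= => /andP[xy yr].
  have ry : 0 < (r - y) / (r - x) by rewrite divr_gt0// subr_gt0.
  have [n hn] : exists n : nat, n.+1%:R^-1 < (r - y) / (r - x).
    by exists (Num.trunc ((r - y) / (r - x))^-1); rewrite invf_plt ?posrE// truncnS_gt.
  exists n => //=; rewrite in_itv/= xy/= /s lerBrDr -lerBrDl.
  move: hn; rewrite ltr_pdivlMr ?subr_gt0// => /ltW; rewrite mulrC; exact.
have nd : {homo (fun n => `[x, s n]%classic) : n m / (n <= m)%N >-> (n <= m)%O}.
  move=> n m nm; apply/subsetPset => y /=; rewrite !in_itv/= => /andP[-> ys]/=.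
  apply: le_trans ys _; rewrite /s lerD2l lerN2 ler_wpM2l//; first by rewrite subr_ge0 ltW.
  by rewrite lef_pV2 ?posrE// ler_nat.
have h := @ge0_nondecreasing_set_cvg_integral _ (measurableTypeR R) R (fun n => `[x, s n]%classic) f (leb1 R)
  nd (fun=> measurable_itv _) (fun=> measurable_funTS mf) (fun _ y _ => f0 y).
rewrite -(cvg_lim _ h)//; apply: lime_le; first by apply/cvg_ex; eexists; exact: h.
by apply: nearW => n; exact: fC.
Qed.

(** Cauchy-Schwarz for [K N = (K sqrt p) (K N / sqrt p)] gives [G^2 <= P * int K N^2 / p]; multiply
    by [W] and exchange the integrals. As [K] takes only the values 0 and 1, it equals its square.
    The bound on [G] is asked only where [W] is nonzero, that is, inside the orbit. *)
Lemma schur_test d (T : measurableType d) (R : realType)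
    (mu : {sigma_finite_measure set T -> \bar R})
    (K : T * T -> R) (p P W Q G N : T -> R) :
  measurable_fun setT K -> (forall z, K z = 0 \/ K z = 1) ->
  measurable_fun setT p -> measurable_fun setT P -> measurable_fun setT W ->
  measurable_fun setT Q -> measurable_fun setT G -> measurable_fun setT N ->
  (forall x, 0 <= p x) -> (forall x, 0 <= P x) -> (forall x, 0 <= W x) ->
  (forall x, 0 <= Q x) -> (forall x, 0 <= G x) -> (forall x, 0 <= N x) ->
  (forall x y, K (x, y) != 0 -> 0 < p y) ->
  (forall x, (\int[mu]_y (K (x, y) * p y)%:E <= (P x)%:E)%E) ->
  (forall y, (\int[mu]_x (K (x, y) * (W x * P x))%:E <= (Q y)%:E)%E) ->
  {ae mu, forall x, W x != 0 -> ((G x)%:E <= \int[mu]_y (K (x, y) * N y)%:E)%E} ->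
  (\int[mu]_x (W x * G x ^+ 2)%:E <= \int[mu]_y (Q y * (N y ^+ 2 / p y))%:E)%E.
Proof.
move=> mK K01 mp mP mW mQ mG mN p0 P0 W0 Q0 G0 N0 Kp KP KQ GK.
have K0 z : 0 <= K z by case: (K01 z) => ->.
have KK z : K z ^+ 2 = K z by case: (K01 z) => ->; rewrite ?expr0n ?expr1n.
have mNp : measurable_fun setT (fun y => N y ^+ 2 / p y).
  apply: measurable_funM; first exact: measurable_funX.
  by apply: measurableT_comp => //; exact: measurable_invr.
have Np0 y : 0 <= N y ^+ 2 / p y by rewrite divr_ge0// sqr_ge0.
have msp : measurable_fun setT (fun y => Num.sqrt (p y)).
  by apply: measurableT_comp => //; apply: continuous_measurable_fun; exact: sqrt_continuous.
have m2 (h : T -> R) : measurable_fun setT h -> measurable_fun [set: T * T] (fun z => h z.2).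
  by move=> mh; apply: (measurableT_comp mh); exact: measurable_snd.
have m1 (h : T -> R) : measurable_fun setT h -> measurable_fun [set: T * T] (fun z => h z.1).
  by move=> mh; apply: (measurableT_comp mh); exact: measurable_fst.
have mKx x : measurable_fun setT (fun y => K (x, y)).
  by apply: (measurableT_comp mK); exact: measurable_pair1.
have mKy y : measurable_fun setT (fun x => K (x, y)).
  by apply: (measurableT_comp mK); exact: measurable_pair2.
have pointwise x : W x != 0 -> ((G x)%:E <= \int[mu]_y (K (x, y) * N y)%:E)%E ->
    ((W x * G x ^+ 2)%:E <=
      \int[mu]_y (K (x, y) * (W x * P x) * (N y ^+ 2 / p y))%:E)%E.
  move=> Wx Gx.
  have := @ge0_integral_cauchy_schwarz _ T R mu (fun y => K (x, y) * Num.sqrt (p y))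
    (fun y => K (x, y) * (N y / Num.sqrt (p y))).
  have -> : (\int[mu]_y (K (x, y) * Num.sqrt (p y) * (K (x, y) * (N y / Num.sqrt (p y))))%:E
      = \int[mu]_y (K (x, y) * N y)%:E)%E.
    apply: eq_integral => y _; congr (_%:E).
    (* Where the kernel is 1, [Kp] makes [p] positive and the square roots cancel; where it is 0,
       both sides vanish. *)
    case: (K01 (x, y)) => Kxy; rewrite Kxy ?mul0r// !mul1r.
    rewrite mulrCA divff ?mulr1// gt_eqF// sqrtr_gt0 (Kp x)// Kxy oner_eq0//.
  have -> : (\int[mu]_y ((K (x, y) * Num.sqrt (p y)) ^+ 2)%:E = \int[mu]_y (K (x, y) * p y)%:E)%E.
    by apply: eq_integral => y _; rewrite exprMn KK sqr_sqrtr.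
  have -> : (\int[mu]_y ((K (x, y) * (N y / Num.sqrt (p y))) ^+ 2)%:E =
      \int[mu]_y (K (x, y) * (N y ^+ 2 / p y))%:E)%E.
    by apply: eq_integral => y _; rewrite exprMn KK expr_div_n sqr_sqrtr.
  move=> cs.
  have I0 : (0 <= \int[mu]_y (K (x, y) * (N y ^+ 2 / p y))%:E)%E.
    by apply: integral_ge0 => y _; rewrite lee_fin mulr_ge0.
  have G2 : ((G x ^+ 2)%:E <= (P x)%:E * \int[mu]_y (K (x, y) * (N y ^+ 2 / p y))%:E)%E.
    apply: le_trans (lee_wpmul2r I0 (KP x)).
    apply: le_trans (cs _ _ _ _); last 4 first.
    - by apply: measurable_funM.
    - apply: measurable_funM => //; apply: measurable_funM => //.
      by apply: measurableT_comp => //; exact: measurable_invr.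
    - by move=> y; rewrite mulr_ge0// sqrtr_ge0.
    - by move=> y; rewrite mulr_ge0// divr_ge0// sqrtr_ge0.
    by rewrite expr2 EFinM; apply: lee_pmul => //; rewrite lee_fin.
  apply: (@le_trans _ _ ((W x)%:E * ((P x)%:E * \int[mu]_y (K (x, y) * (N y ^+ 2 / p y))%:E))%E).
    by rewrite EFinM; apply: lee_wpmul2l => //; rewrite lee_fin.
  rewrite muleA -EFinM -ge0_integralZl//; last 3 first.
  - by apply/measurable_EFinP; apply: measurable_funM.
  - by move=> y _; rewrite lee_fin mulr_ge0.
  - by rewrite lee_fin mulr_ge0.
  by under eq_integral do rewrite -EFinM mulrCA mulrA.
pose H (z : T * T) := K z * (W z.1 * P z.1) * (N z.2 ^+ 2 / p z.2).
have mH : measurable_fun setT H.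
  apply: measurable_funM; last exact: (m2 _ mNp).
  apply: measurable_funM => //; apply: (m1 (fun x => W x * P x)).
  exact: measurable_funM.
have H0 z : 0 <= H z by rewrite /H; apply: mulr_ge0 => //; apply: mulr_ge0 => //; exact: mulr_ge0.
apply: (@le_trans _ _ (\int[mu]_x \int[mu]_y (H (x, y))%:E)%E).
  apply: ae_ge0_le_integral => //.
  - by move=> x _; rewrite lee_fin mulr_ge0// sqr_ge0.
  - by apply/measurable_EFinP; apply: measurable_funM => //; exact: measurable_funX.
  - by move=> x _; apply: integral_ge0 => y _; rewrite lee_fin.
  - apply: (@measurable_fun_fubini_tonelli_F _ _ T T R mu (EFin \o H)) => //.
    exact/measurable_EFinP.
  - apply: filterS GK => x GK _; have [W00|Wx] := eqVneq (W x) 0; last exact: pointwise (GK Wx).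
    by rewrite W00 mul0r; apply: integral_ge0 => y _; rewrite lee_fin.
have /= -> := @fubini_tonelli _ _ T T R mu mu (EFin \o H) _ _; last 2 first.
- exact/measurable_EFinP.
- by move=> z; rewrite lee_fin.
apply: ge0_le_integral => //.
- by move=> y _; apply: integral_ge0 => x _; rewrite lee_fin.
- apply: (@measurable_fun_fubini_tonelli_G _ _ T T R mu (EFin \o H)) => //.
  exact/measurable_EFinP.
- by apply/measurable_EFinP; apply: measurable_funM.
move=> y _; rewrite /H/=.
under eq_integral do rewrite mulrC EFinM.
rewrite ge0_integralZl//; last 3 first.
- by apply/measurable_EFinP; apply: measurable_funM => //; exact: measurable_funM.
- by move=> x _; rewrite lee_fin mulr_ge0// mulr_ge0.
- by rewrite lee_fin.
by rewrite (mulrC (Q y)) (EFinM (N y ^+ 2 / p y)); apply: lee_wpmul2l; rewrite ?lee_fin.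
Qed.

Lemma ae_neq (R : realType) (x0 : R) : {ae leb1 R, forall x, x != x0}.
Proof.
exists [set x0]; split => //; first exact: lebesgue_measure_set1.
by move=> x /= /negP; rewrite negbK => /eqP.
Qed.

Lemma ge0_integral_le_segment (R : realType) (f h : R -> R) (a b : R) :
  measurable_fun setT f -> measurable_fun setT h -> (forall x, 0 <= f x) ->
  (forall x, f x != 0 -> a <= x <= b) -> (forall x, a <= x <= b -> f x <= h x) ->
  (\int[leb1 R]_x (f x)%:E <= \int[leb1 R]_(x in `[a, b]) (h x)%:E)%E.
Proof.
move=> mf mh f0 fab fh.
have -> : (\int[leb1 R]_x (f x)%:E = \int[leb1 R]_(x in `[a, b]) (f x)%:E)%E.
  rewrite [RHS]integral_mkcond; apply: eq_integral => x _; rewrite patchE.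
  case: ifPn => //; rewrite notin_setE/= in_itv/= => /negP xab.
  by congr (_%:E); apply/eqP; apply: contraNT xab => /fab.
apply: ge0_le_integral => //.
- by move=> x _; rewrite lee_fin.
- by apply: measurable_funTS; exact/measurable_EFinP.
- by apply: measurable_funTS; exact/measurable_EFinP.
Qed.

(** * A Hardy inequality along an orbit *)

Section orbit_hardy.
Context {R : realType} (U F rho : R -> R) (E r : R).
Context (dU : forall x : R, is_derive x 1 U (F x)) (dF : forall x : R, is_derive x 1 F (rho x))
  (crho : continuous rho) (rho0 : forall x, 0 <= rho x) (F0 : forall x, 0 < x -> 0 < F x)
  (r0 : 0 < r) (Ur : U r = E).

(* With [rho = U''] and [F = U'] the function [q = v^2 - x U'] of the Schur test
   below satisfies [(x v)' = q / v] and [q' = - x * orbit_weight x]. *)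
Definition orbit_weight x := rho x + 3 * F x / x.

Let v (x : R) := Num.sqrt (2 * (E - U x)).

Let q (x : R) := 2 * (E - U x) - x * F x.

Let xV (x : R) := x * rho x + 3 * F x.

Lemma derive_continuous (f : R -> R) (df : R -> R) : (forall x : R, is_derive x 1 f (df x)) -> continuous f.
Proof.
move=> d x; apply: differentiable_continuous; apply/derivable1_diffP.
have ? := d x; exact: ex_derive.
Qed.

Lemma orbit_potential_lt x : 0 <= x < r -> U x < E.
Proof.
move=> /andP[x0 xr]; rewrite -Ur.
have h1 z : z \in `]x, r[%R -> is_derive z 1 U (F z) by move=> _; exact: dU.
have h2 : {within `[x, r], continuous U}.
  by apply: continuous_subspaceT; exact: derive_continuous dU.
have [c] := MVT xr h1 h2.
rewrite in_itv/= => /andP[xc _] e; rewrite -subr_gt0 e mulr_gt0 ?subr_gt0//.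
by apply: F0; exact: le_lt_trans xc.
Qed.

Lemma is_derive_q (x : R) : is_derive x 1 q (- xV x).
Proof.
have ? := dU x; have ? := dF x.
by apply: is_derive_eq; rewrite /GRing.scale/= /xV; lra.
Qed.

Lemma is_derive_u (x : R) : 0 <= x < r -> is_derive x 1 (fun x => x * v x) (q x / v x).
Proof.
move=> /orbit_potential_lt xr.
have p0 : 0 < 2 * (E - U x) by rewrite mulr_gt0// subr_gt0.
have ? := dU x.
have d1 : is_derive x 1 (fun x => 2 * (E - U x)) (- (2 * F x)).
  by apply: is_derive_eq; rewrite /GRing.scale/=; lra.
have d2 := is_derive1_sqrt p0.
have d3 : is_derive x 1 v ((2 * v x)^-1 * - (2 * F x)).
  exact: (@is_derive1_comp R Num.sqrt (fun x => 2 * (E - U x)) x _ _ d2 d1).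
have v0 : 0 < v x by rewrite sqrtr_gt0.
apply: is_derive_eq; rewrite /GRing.scale/= /q -(sqr_sqrtr (ltW p0)) -/(v x).
by field; rewrite gt_eqF.
Qed.

(** At the centre [q] is twice the kinetic energy, at the turning point it is [- r * F r < 0]. The
    zero [x0] is where [x v] stops increasing, and it decides from which end of the orbit [G] is to
    be estimated. *)
Lemma exists_crossing : exists2 x0, 0 < x0 < r & q x0 = 0.
Proof.
have cq : {within `[0, r], continuous q}.
  by apply: continuous_subspaceT; exact: derive_continuous is_derive_q.
have q0 : 0 < q 0.
  by rewrite /q mul0r subr0 mulr_gt0// subr_gt0 orbit_potential_lt// lexx.
have qr : q r < 0 by rewrite /q Ur subrr mulr0 sub0r oppr_lt0 mulr_gt0// F0.
have [|x0] := IVT (ltW r0) cq (v := 0).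
  by rewrite ge_min le_max (ltW q0) (ltW qr) orbT.
rewrite in_itv/= => /andP[x00 x0r] e; exists x0 => //; apply/andP; split.
  by rewrite lt_neqAle x00 andbT; apply/eqP => h; move: q0; rewrite [in q _]h e ltxx.
by rewrite lt_neqAle x0r andbT; apply: contraTneq qr => <-; rewrite e ltxx.
Qed.

Lemma integral_xV a b : a <= b -> (\int[leb1 R]_(x in `[a, b]) (xV x)%:E = (q a - q b)%:E)%E.
Proof.
move=> ab.
have d (x : R) : is_derive x 1 (fun x => - q x) (xV x).
  by have ? := is_derive_q x; apply: is_derive_eq; rewrite /GRing.scale/= opprK.
have c : continuous xV.
  by move=> x; apply: cvgD; apply: cvgM; [exact: cvg_id|exact: crho|exact: cvg_cst|exact: (@derive_continuous F rho dF x)].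
rewrite (@integral_is_derive R xV (fun x => - q x) a b ab (fun x _ => d x) (fun x _ => c x)).
by congr (_%:E); lra.
Qed.

Lemma xV_ge0 x : 0 <= x -> 0 <= xV x.
Proof.
rewrite le_eqVlt => /predU1P[<-|x0].
  (* The sign of [F] is assumed only for positive arguments; a negative value at 0 would persist
     there by continuity. *)
  rewrite /xV mul0r add0r mulr_ge0// leNgt; apply/negP => F00.
  have [e e0] : exists2 e, 0 < e & forall x, `|x| < e -> F x < 0.
    have /cvgrPdist_lt := @derive_continuous F _ dF 0 => /(_ (- F 0)).
    rewrite oppr_gt0 => /(_ F00) /nbhs_ballP[e /= e0 he]; exists e => // z ze.
    have : ball 0 e z by rewrite /ball/= sub0r normrN.
    by move=> /he /=; rewrite ltr_norml => /andP[]; lra.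
  move=> /(_ (e / 2)); rewrite ger0_norm ?divr_ge0 ?(ltW e0)// => h.
  have := h ltac:(lra); have := F0 (x := e / 2) ltac:(lra); lra.
by rewrite addr_ge0// mulr_ge0 ?(ltW x0)// ltW// F0.
Qed.

Lemma q_nonincreasing x y : 0 <= x -> x <= y -> q y <= q x.
Proof.
move=> x0 xy; rewrite -subr_ge0 -lee_fin -integral_xV//.
apply: integral_ge0 => z /=; rewrite in_itv/= => /andP[xz _].
by rewrite lee_fin xV_ge0// (le_trans x0).
Qed.

Lemma q_decreasing x y : 0 < x -> x < y -> q y < q x.
Proof.
move=> x0 xy.
have h1 z : z \in `]x, y[%R -> is_derive z 1 q (- xV z) by move=> _; exact: is_derive_q.
have h2 : {within `[x, y], continuous q}.
  by apply: continuous_subspaceT; exact: derive_continuous is_derive_q.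
have [c] := MVT xy h1 h2.
rewrite in_itv/= => /andP[xc _] e; rewrite -subr_lt0 e mulNr oppr_lt0 mulr_gt0 ?subr_gt0//.
have c0 := lt_trans x0 xc.
by rewrite /xV ltr_wpDl// ?mulr_ge0 ?(ltW c0)// mulr_gt0// F0.
Qed.

(** Schur test with [P = x v], [p = |P'| = |q| / v], [W = orbit_weight / v] and [Q = |q|]. On each
    side of the crossing, [p] integrates to at most [P], because [x v] vanishes at both ends of the
    orbit; and [W P = x * orbit_weight = - q'] integrates from the crossing to exactly [|q|]. The
    surviving quotient [Q / p] is [v]. *)
Lemma orbit_hardy (G M : R -> R) : measurable_fun setT G -> measurable_fun setT M ->
  {ae leb1 R, forall x, 0 < x < r ->
    ((`|G x|)%:E <= \int[leb1 R]_(y in `]0%R, x[) (`|M y|)%:E)%E /\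
    ((`|G x|)%:E <= \int[leb1 R]_(y in `]x, r[) (`|M y|)%:E)%E} ->
  (\int[leb1 R]_(x in `]0%R, r[) (orbit_weight x * G x ^+ 2 / v x)%:E <=
   \int[leb1 R]_(x in `]0%R, r[) (v x * M x ^+ 2)%:E)%E.
Proof.
move=> mG mM GM.
have [x0 /andP[x00 x0r] qx0] := exists_crossing.
pose D (x : R) : R := if 0 < x < r then 1 else 0.
(* Below the crossing [x] looks left, to the centre, and above it right, to the turning point: each
   time towards an end where [x v] vanishes, over a stretch where [q] keeps its sign. *)
pose K (z : R * R) : R :=
  if (0 < z.2 < z.1) && (z.1 < x0) || (x0 < z.1) && (z.1 < z.2 < r) then 1 else 0.
pose p x := D x * (`|q x| / v x).
pose P x := D x * (x * v x).
pose W x := D x * (orbit_weight x / v x).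
pose Q x := D x * `|q x|.
have cU := derive_continuous dU; have cF := derive_continuous dF.
have cq := derive_continuous is_derive_q.
have mU := continuous_measurable_fun cU; have mF := continuous_measurable_fun cF.
have mq := continuous_measurable_fun cq; have mrho := continuous_measurable_fun crho.
have mid : measurable_fun setT (id : R -> R) by exact: measurable_id.
have minv (f : R -> R) : measurable_fun setT f -> measurable_fun setT (fun x => (f x)^-1).
  by move=> mf; apply: measurableT_comp => //; exact: measurable_invr.
have mv : measurable_fun setT v.
  apply: measurableT_comp; first by apply: continuous_measurable_fun; exact: sqrt_continuous.
  by apply: measurable_funM => //; exact: measurable_funB.
have mD : measurable_fun setT D.
  apply: measurable_fun_if => //; apply: measurable_and; exact: measurable_fun_ltr.
have mp : measurable_fun setT p.
  apply: measurable_funM => //; apply: measurable_funM; last exact: minv.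
  exact: measurableT_comp.
have mP : measurable_fun setT P by apply: measurable_funM => //; exact: measurable_funM.
have mow : measurable_fun setT orbit_weight.
  apply: measurable_funD => //; apply: measurable_funM; last exact: minv.
  exact: measurable_funM.
have mW : measurable_fun setT W.
  by apply: measurable_funM => //; apply: measurable_funM => //; exact: minv.
have mQ : measurable_fun setT Q by apply: measurable_funM => //; exact: measurableT_comp.
have mK : measurable_fun [set: measurableTypeR R * measurableTypeR R] K.
  apply: measurable_fun_if => //.
  have ? := @measurable_fst _ _ (measurableTypeR R) (measurableTypeR R).
  have ? := @measurable_snd _ _ (measurableTypeR R) (measurableTypeR R).
  by apply: measurable_or; repeat apply: measurable_and; apply: measurable_fun_ltr.
have D0 x : 0 <= D x by rewrite /D; case: ifP.
have DE x : 0 < x < r -> D x = 1 by rewrite /D => ->.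
have Dout x : ~~ (0 < x < r) -> D x = 0 by rewrite /D => /negbTE ->.
have v0 x : 0 < x < r -> 0 < v x.
  by move=> /andP[x_0 xr]; rewrite sqrtr_gt0 mulr_gt0// subr_gt0 orbit_potential_lt// (ltW x_0).
have ow0 x : 0 < x -> 0 <= orbit_weight x.
  by move=> x_0; rewrite addr_ge0// divr_ge0 ?mulr_ge0 ?(ltW x_0)// ltW// F0.
have K0 z : 0 <= K z by rewrite /K; case: ifP.
have Kn0 x y : K (x, y) != 0 -> (0 < y < x /\ x < x0) \/ (x0 < x /\ x < y < r).
  by rewrite /K/=; case: ifPn => [/orP[/andP[? ?]|/andP[? ?]] _|]; [left|right|rewrite eqxx].
have Kl x y : 0 < y < x -> x < x0 -> K (x, y) = 1 by rewrite /K/= => -> ->.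
have Kr x y : x0 < x -> x < y < r -> K (x, y) = 1 by rewrite /K/= => -> ->; rewrite orbT.
have K_0 x y : K (x, y) = 0 \/ K (x, y) != 0 by have [->|] := eqVneq (K (x, y)) 0; [left|right].
have mKx x : measurable_fun setT (fun y => K (x, y)).
  apply: (measurableT_comp mK).
  exact: (@measurable_pair1 _ _ (measurableTypeR R) (measurableTypeR R)).
have mKy y : measurable_fun setT (fun x => K (x, y)).
  apply: (measurableT_comp mK).
  exact: (@measurable_pair2 _ _ (measurableTypeR R) (measurableTypeR R)).
have p0 x : 0 <= p x by rewrite /p mulr_ge0// divr_ge0// sqrtr_ge0.
have qpos y : 0 <= y -> y <= x0 -> 0 <= q y by move=> y0 yx; rewrite -qx0; exact: q_nonincreasing.
have qneg y : x0 <= y -> q y <= 0 by move=> yx; rewrite -qx0; apply: q_nonincreasing => //; exact: ltW.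
have mqv : measurable_fun setT (fun x => q x / v x) by apply: measurable_funM => //; exact: minv.
have cqv x : 0 <= x < r -> {for x, continuous (fun x => q x / v x)}.
  move=> xr; apply: cvgM; first exact: cq.
  apply: cvgV; first by rewrite gt_eqF// sqrtr_gt0 mulr_gt0// subr_gt0 orbit_potential_lt.
  apply: (@continuous_comp _ _ _ (fun x => 2 * (E - U x)) Num.sqrt); last exact: sqrt_continuous.
  by apply: cvgM; [exact: cvg_cst|apply: cvgB; [exact: cvg_cst|exact: cU]].
have P0 x : 0 <= P x.
  have [h|/Dout] := boolP (0 < x < r); last by rewrite /P => ->; rewrite mul0r.
  by rewrite /P mulr_ge0// mulr_ge0 ?sqrtr_ge0//; case/andP: h => /ltW.
have KP x : (\int[leb1 R]_y (K (x, y) * p y)%:E <= (P x)%:E)%E.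
  have mKp : measurable_fun setT (fun y => K (x, y) * p y) by exact: measurable_funM.
  have Kp0 y : 0 <= K (x, y) * p y by exact: mulr_ge0.
  have [/andP[x_0 xx0]|h1] := boolP (0 < x < x0).
    apply: (@le_trans _ _ (\int[leb1 R]_(y in `[0%R, x]) (q y / v y)%:E)%E).
      apply: ge0_integral_le_segment => // y.
        move=> Ky; have /Kn0 [] : K (x, y) != 0 by apply: contraNneq Ky => ->; rewrite mul0r.
          by move=> [/andP[/ltW -> /ltW ->]].
        by move=> [x0x]; move: (lt_trans x0x xx0); rewrite ltxx.
      move=> /andP[y0 yx]; have qy : 0 <= q y by apply: qpos => //; rewrite (le_trans yx)// ltW.
      case: (K_0 x y) => [->|/Kn0[]].
      - by rewrite mul0r divr_ge0// sqrtr_ge0.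
      - move=> [/andP[y_0 y_x] _]; rewrite Kl ?y_0// mul1r /p DE ?mul1r ?ger0_norm//.
        by rewrite y_0 (le_lt_trans yx)// (lt_trans xx0).
      - by move=> [x0x]; move: (lt_trans x0x xx0); rewrite ltxx.
    have zr z : 0 <= z <= x -> 0 <= z < r.
      by move=> /andP[-> zx]; rewrite (le_lt_trans zx)// (lt_trans xx0).
    rewrite (@integral_is_derive R (fun y => q y / v y) (fun y => y * v y) 0 x (ltW x_0)
      (fun z zx => is_derive_u (zr z zx)) (fun z zx => cqv z (zr z zx))).
    by rewrite lee_fin mul0r subr0 /P DE ?mul1r// x_0 (lt_trans xx0).
  have [/andP[x0x xr]|h2] := boolP (x0 < x < r); last first.
    rewrite (_ : (\int[leb1 R]_y (K (x, y) * p y)%:E)%E = 0%E) ?lee_fin//.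
    apply: integral0_eq => y _; case: (K_0 x y) => [->|/Kn0[]]; first by rewrite mul0r.
    - by move=> [/andP[y0 yx] xx0]; move: h1; rewrite (lt_trans y0 yx) xx0.
    - by move=> [x0x /andP[xy yr]]; move: h2; rewrite x0x (lt_trans xy yr).
  have -> : (\int[leb1 R]_y (K (x, y) * p y)%:E = \int[leb1 R]_(y in `[x, r[) (K (x, y) * p y)%:E)%E.
    rewrite [RHS]integral_mkcond; apply: eq_integral => y _; rewrite patchE.
    case: ifPn => //; rewrite notin_setE/= in_itv/= => xy.
    case: (K_0 x y) => [->|/Kn0[]]; first by rewrite mul0r.
    - by move=> [_ xx0]; move: (lt_trans x0x xx0); rewrite ltxx.
    - by move=> [_ /andP[xy' yr]]; case: xy; rewrite (ltW xy') yr.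
  have x_0 := lt_trans x00 x0x.
  (* [q / v] is singular at the turning point. On [[x, s]] the integral of [- q / v] is
     [x v(x) - s v(s)], and the second term is dropped by its sign. *)
  apply: ge0_integral_le_segments => //.
  - exact/measurable_EFinP.
  - move=> s /andP[xs sr].
    apply: (@le_trans _ _ (\int[leb1 R]_(y in `[x, s]) (- (q y / v y))%:E)%E).
      apply: ge0_le_integral => //.
      + by move=> y _; rewrite lee_fin.
      + by apply: measurable_funTS; exact/measurable_EFinP.
      + by apply: measurable_funTS; apply/measurable_EFinP; exact: measurableT_comp.
      + move=> y /=; rewrite in_itv/= lee_fin => /andP[xy ys].
        have qy : q y <= 0 by apply: qneg; rewrite ltW// (lt_le_trans x0x).
        have y0 := lt_le_trans x_0 xy; have yr := le_lt_trans ys sr.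
        have vy : 0 < v y by apply: v0; rewrite y0.
        case: (K_0 x y) => [->|/Kn0[]].
        * by rewrite mul0r -mulNr divr_ge0 ?(ltW vy)// oppr_ge0.
        * by move=> [_ xx0]; move: (lt_trans x0x xx0); rewrite ltxx.
        * move=> [_ xyr]; rewrite Kr// mul1r /p DE; last by rewrite y0.
          by rewrite mul1r ler0_norm// mulNr.
    have zr z : x <= z <= s -> 0 <= z < r.
      by move=> /andP[xz zs]; rewrite (le_lt_trans zs)// andbT ltW// (lt_le_trans x_0).
    rewrite (@integral_is_derive R (fun y => - (q y / v y)) (fun y => - (y * v y)) x s xs
      (fun z zx => is_deriveN (is_derive_u (zr z zx))) (fun z zx => cvgN (cqv z (zr z zx)))).
    rewrite lee_fin /P DE ?mul1r; last by rewrite x_0.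
    by rewrite opprK addrC gerDl oppr_le0 mulr_ge0 ?sqrtr_ge0// ltW// (lt_le_trans x_0).
have KQ y : (\int[leb1 R]_x (K (x, y) * (W x * P x))%:E <= (Q y)%:E)%E.
  have WP x : W x * P x <= `|xV x|.
    have [xr|/Dout h] := boolP (0 < x < r); last by rewrite /W h !mul0r.
    rewrite /W /P DE// !mul1r (_ : _ * _ = xV x) ?ler_norm//.
    rewrite /orbit_weight /xV; field; rewrite gt_eqF ?v0//=.
    by case/andP: xr => x_0 _; rewrite gt_eqF.
  have WP0 x : 0 <= W x * P x.
    apply: mulr_ge0 => //; have [h|/Dout] := boolP (0 < x < r); last by rewrite /W => ->; rewrite mul0r.
    by rewrite /W mulr_ge0// divr_ge0 ?sqrtr_ge0// ow0//; case/andP: h.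
  have mxV : measurable_fun setT xV.
    by apply: measurable_funD; apply: measurable_funM.
  have mKW : measurable_fun setT (fun x => K (x, y) * (W x * P x)).
    by apply: measurable_funM => //; exact: measurable_funM.
  have KW0 x : 0 <= K (x, y) * (W x * P x) by apply: mulr_ge0.
  have KWle x : 0 <= x -> K (x, y) * (W x * P x) <= xV x.
    move=> x_0; rewrite -[leRHS]ger0_norm ?xV_ge0//; apply: le_trans (WP x).
    by rewrite ler_piMl//; rewrite /K; case: ifP.
  have [/andP[y0 yx0]|h1] := boolP (0 < y < x0).
    apply: (@le_trans _ _ (\int[leb1 R]_(x in `[y, x0]) (xV x)%:E)%E).
      apply: ge0_integral_le_segment => // x.
        move=> Ky; have /Kn0 [] : K (x, y) != 0 by apply: contraNneq Ky => ->; rewrite mul0r.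
          by move=> [/andP[_ /ltW ->] /ltW ->].
        by move=> [x0x /andP[xy _]]; move: (lt_trans x0x (lt_trans xy yx0)); rewrite ltxx.
      by move=> /andP[yx _]; apply: KWle; rewrite ltW// (lt_le_trans y0).
    rewrite integral_xV ?(ltW yx0)// qx0 subr0 lee_fin /Q DE ?mul1r ?ler_norm//.
    by rewrite y0 (lt_trans yx0).
  have [/andP[x0y yr]|h2] := boolP (x0 < y < r).
    apply: (@le_trans _ _ (\int[leb1 R]_(x in `[x0, y]) (xV x)%:E)%E).
      apply: ge0_integral_le_segment => // x.
        move=> Ky; have /Kn0 [] : K (x, y) != 0 by apply: contraNneq Ky => ->; rewrite mul0r.
          by move=> [/andP[_ yx] xx0]; move: (lt_trans x0y (lt_trans yx xx0)); rewrite ltxx.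
        by move=> [/ltW -> /andP[/ltW -> _]].
      by move=> /andP[yx _]; apply: KWle; rewrite ltW// (lt_le_trans x00).
    rewrite integral_xV ?(ltW x0y)// qx0 sub0r lee_fin /Q DE; last first.
      by rewrite yr andbT (lt_trans x00).
    by rewrite mul1r -(normrN (q y)) ler_norm.
  rewrite (_ : (\int[leb1 R]_x (K (x, y) * (W x * P x))%:E)%E = 0%E) ?lee_fin ?mulr_ge0//.
  apply: integral0_eq => x _; case: (K_0 x y) => [->|/Kn0[]]; first by rewrite mul0r.
  - by move=> [/andP[y0 yx] xx0]; move: h1; rewrite y0 (lt_trans yx xx0).
  - by move=> [x0x /andP[xy yr]]; move: h2; rewrite (lt_trans x0x xy) yr.
have := @schur_test _ (measurableTypeR R) R (leb1 R) K p P W Q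
   (fun x => `|G x|) (fun x => D x * `|M x|) mK.
have -> : (\int[leb1 R]_x (W x * `|G x| ^+ 2)%:E =
   \int[leb1 R]_(x in `]0%R, r[) (orbit_weight x * G x ^+ 2 / v x)%:E)%E.
  rewrite [RHS]integral_mkcond; apply: eq_integral => x _; rewrite patchE /W /D.
  case: ifPn => xr; last first.
    by rewrite !mul0r ifF//; apply/negbTE; rewrite notin_setE/= in_itv/=; exact/negP.
  rewrite ifT; last by rewrite inE/= in_itv/=.
  by rewrite mul1r -normrX ger0_norm ?sqr_ge0// mulrAC.
move=> schur.
apply: le_trans (schur _ mp mP mW mQ _ _ _ _ _ _ _ _ _ _ _ _) _ => //.
- by move=> z; rewrite /K; case: ifP; [right|left].
- exact: measurableT_comp.
- by apply: measurable_funM => //; exact: measurableT_comp.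
- move=> x; have [h|/Dout] := boolP (0 < x < r); last by rewrite /W => ->; rewrite mul0r.
  by rewrite /W mulr_ge0// divr_ge0 ?sqrtr_ge0// ow0//; case/andP: h.
- by move=> x; rewrite mulr_ge0.
- by move=> x; rewrite mulr_ge0.
- move=> x y; rewrite /K/=; case: ifPn => [|_]; last by rewrite eqxx.
  have pp z : 0 < z < r -> q z != 0 -> 0 < p z.
    by move=> zr qz; rewrite /p DE// mul1r divr_gt0 ?v0// normr_gt0.
  move=> /orP[/andP[/andP[y0 yx] xx0]|/andP[xx0 /andP[xy yr]]] _; apply: pp.
  + by rewrite y0 (lt_trans yx)// (lt_trans xx0).
  + by rewrite gt_eqF// -qx0 q_decreasing// (lt_trans yx).
  + by rewrite yr andbT (lt_trans x00)// (lt_trans xx0).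
  + by rewrite lt_eqF// -qx0 q_decreasing// (lt_trans xx0).
(* At the crossing itself the kernel vanishes identically in [y], so this single point is discarded
   as a null set. *)
- have FF := ae_filter_ringOfSetsType (leb1 R).
  apply: (@filterS _ _ FF _ _ _ (@filterI _ _ FF _ _ (ae_neq x0) GM)) => x [xx0 GMx]; rewrite /W.
  have [xr|/Dout ->] := boolP (0 < x < r); last by rewrite mul0r eqxx.
  move=> _; have [GM1 GM2] := GMx xr; have /andP[x_0 x_r] := xr.
  have mR : measurable_fun setT (EFin \o (fun y => K (x, y) * (D y * `|M y|))).
    apply/measurable_EFinP; apply: measurable_funM => //; apply: measurable_funM => //.
    exact: measurableT_comp.
  have mL (i : interval R) : measurable_fun setT ((EFin \o (fun y => `|M y|)) \_ [set` i]).
    apply/(measurable_restrictT _ _).1 => //; apply: measurable_funTS; apply/measurable_EFinP.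
    exact: measurableT_comp.
  move: xx0; rewrite neq_lt => /orP[xx0|xx0].
    apply: le_trans GM1 _; rewrite integral_mkcond; apply: ge0_le_integral => //.
    + by move=> y _; rewrite patchE; case: ifP => // _; rewrite lee_fin.
    + exact: mL.
    + move=> y _; rewrite patchE; case: ifPn; rewrite ?inE ?notin_setE/= in_itv/= => yx; last first.
        by rewrite lee_fin mulr_ge0// mulr_ge0.
      case/andP: yx => y0 yx; rewrite Kl ?y0// DE ?mul1r// y0/=.
      exact: lt_trans yx x_r.
  apply: le_trans GM2 _; rewrite integral_mkcond; apply: ge0_le_integral => //.
  + by move=> y _; rewrite patchE; case: ifP => // _; rewrite lee_fin.
  + exact: mL.
  + move=> y _; rewrite patchE; case: ifPn; rewrite ?inE ?notin_setE/= in_itv/= => yx; last first.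
      by rewrite lee_fin mulr_ge0// mulr_ge0.
    case/andP: yx => xy yr; rewrite Kr ?xy// DE ?mul1r// yr andbT.
    exact: lt_trans x_0 xy.
- rewrite [leRHS]integral_mkcond; apply: ge0_le_integral => //.
  + by move=> x _; rewrite lee_fin; apply: mulr_ge0; [exact: mulr_ge0|apply: divr_ge0 => //; exact: sqr_ge0].
  + apply/measurable_EFinP; apply: measurable_funM => //; apply: measurable_funM; last exact: minv.
    by apply: measurable_funX; apply: measurable_funM => //; exact: measurableT_comp.
  + apply/(measurable_restrictT _ _).1 => //; apply: measurable_funTS; apply/measurable_EFinP.
    by apply: measurable_funM => //; exact: measurable_funX.
  + move=> x _; rewrite patchE; case: ifPn; rewrite ?inE ?notin_setE/= in_itv/= => xr; last first.
      by rewrite lee_fin /Q Dout ?mul0r//; exact/negP.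
    rewrite lee_fin /Q /p DE// !mul1r.
    have [->|q0] := eqVneq (q x) 0; first by rewrite normr0 mul0r mulr_ge0 ?sqr_ge0// ltW// v0.
    rewrite -normrX (ger0_norm (sqr_ge0 (M x))) le_eqVlt; apply/orP; left; apply/eqP.
    by field; rewrite normr_eq0 q0 gt_eqF// v0.
Qed.

End orbit_hardy.

(** * The stress bound and the test functions *)

Section kinetic_stress.
Context {R : realType} (a : ansatz R) (E0 : R) (Ha : ansatz_ok a).

(** Integration by parts: [v^2 |alpha'|] is minus [v] times the v-derivative of [alpha(v^2/2 + u)],
    and the boundary term has the favourable sign. Stopping at [s < b], short of the edge of the
    support, avoids the point where [alpha'] may be unbounded. *)
Lemma stress_le (u : R) :
  (\int[leb1 R]_v (v ^+ 2 * `|alpha' a E0 (v ^+ 2 / 2 + u)|)%:E <=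
   \int[leb1 R]_v (alpha a E0 (v ^+ 2 / 2 + u))%:E)%E.
Proof.
have mk := @measurable_kinetic R u.
have ma' : measurable_fun setT (fun v : R => v ^+ 2 * `|alpha' a E0 (v ^+ 2 / 2 + u)|).
  apply: measurable_funM; first exact: measurable_funX.
  apply: measurableT_comp => //; apply: (measurableT_comp _ mk).
  exact: measurable_alpha'.
have ma : measurable_fun setT (fun v : R => alpha a E0 (v ^+ 2 / 2 + u)).
  by apply: (measurableT_comp _ mk); exact: measurable_alpha.
rewrite !ge0_integral_fold_line//; last 2 first.
- by move=> v; rewrite mulr_ge0// sqr_ge0.
- by move=> v; exact: alpha_ge0.
have [uE|Eu] := ltP u E0; last first.
  rewrite (_ : (\int[leb1 R]_(x in _) _)%E = 0%E).
    by apply: integral_ge0 => v _; rewrite lee_fin addr_ge0 ?alpha_ge0.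
  apply: integral0_eq => v _; rewrite sqrrN alpha'_out ?normr0 ?mulr0 ?addr0//.
  by rewrite (le_trans Eu)// lerDr divr_ge0// sqr_ge0.
pose b := Num.sqrt (2 * (E0 - u)).
have b2 : b ^+ 2 = 2 * (E0 - u) by rewrite sqr_sqrtr// mulr_ge0// subr_ge0 ltW.
have b0 : 0 < b by rewrite sqrtr_gt0 mulr_gt0// subr_gt0.
have inb v : 0 <= v < b -> v ^+ 2 / 2 + u < E0.
  move=> /andP[v0 vb]; have : v ^+ 2 < b ^+ 2 by rewrite ltr_pXn2r// nnegrE ltW.
  by rewrite b2; lra.
set C := (X in (_ <= X)%E).
pose f (v : R) := v ^+ 2 * `|alpha' a E0 (v ^+ 2 / 2 + u)| +
   (- v) ^+ 2 * `|alpha' a E0 ((- v) ^+ 2 / 2 + u)|.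
have f0 v : 0 <= f v by apply: addr_ge0; apply: mulr_ge0 => //; exact: sqr_ge0.
have mf : measurable_fun setT f.
  by apply: measurable_funD => //; apply: (measurableT_comp ma').
apply: (@le_trans _ _ (\int[leb1 R]_(v in `[0%R, b[) (f v)%:E)%E).
  rewrite integral_mkcond [leRHS]integral_mkcond.
  apply: ge0_le_integral => //.
  - by move=> v _; rewrite patchE; case: ifP => // _; rewrite lee_fin; exact: f0.
  - by apply/(measurable_restrictT _ _).1 => //; apply: measurable_funTS; exact/measurable_EFinP.
  - by apply/(measurable_restrictT _ _).1 => //; apply: measurable_funTS; exact/measurable_EFinP.
  - move=> v _; rewrite !patchE; case: ifPn; last first.
      by move=> _; case: ifP => // _; rewrite lee_fin; exact: f0.
    rewrite inE/= in_itv/= andbT => v0; case: ifPn => //.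
    rewrite notin_setE/= in_itv/= (ltW v0)/= => /negP; rewrite -leNgt => bv.
    have : b ^+ 2 <= v ^+ 2 by rewrite ler_pXn2r// nnegrE ltW.
    rewrite b2 => h; rewrite sqrrN alpha'_out ?normr0 ?mulr0 ?addr0//; lra.
apply: ge0_integral_le_segments => //.
- exact/measurable_EFinP.
move=> s /andP[s0 sb].
have sin v : 0 <= v <= s -> v ^+ 2 / 2 + u < E0.
  by move=> /andP[v0 vs]; rewrite inb// v0 (le_lt_trans vs).
(* The derivative of [2 v alpha]; its integral over [[0, s]] is the boundary term, which is
   nonnegative. *)
pose h v := 2 * alpha a E0 (v ^+ 2 / 2 + u) - f v.
have dh v : 0 <= v <= s -> is_derive v 1 (fun v => 2 * (v * alpha a E0 (v ^+ 2 / 2 + u))) (h v).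
  move=> /sin vs.
  have d1 : is_derive v 1 (fun v : R => v ^+ 2 / 2 + u) v.
    by apply: is_derive_eq; rewrite /GRing.scale/=; lra.
  have d2 := is_derive_alpha Ha vs.
  have d3 := @is_derive1_comp R (alpha a E0) (fun v : R => v ^+ 2 / 2 + u) v _ _ d2 d1.
  have d3' : is_derive v 1 (fun v : R => alpha a E0 (v ^+ 2 / 2 + u))
    (alpha' a E0 (v ^+ 2 / 2 + u) * v) by exact: d3.
  apply: is_derive_eq; rewrite /h /f sqrrN ltr0_norm ?(alpha'_lt0 Ha)//.
  by rewrite /GRing.scale/=; ring.
have ck v : {for v, continuous (fun v : R => v ^+ 2 / 2 + u)}.
  by apply: cvgD; [apply: cvgM; [exact: exprn_continuous|exact: cvg_cst]|exact: cvg_cst].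
have ca (v : R) : {for v, continuous (fun v : R => 2 * alpha a E0 (v ^+ 2 / 2 + u))}.
  apply: cvgM; first exact: cvg_cst.
  by apply: (continuous_comp (ck v)); exact: continuous_alpha.
have cf v : 0 <= v <= s -> {for v, continuous f}.
  move=> /sin vs; have fE : f = (fun v => 2 * (v ^+ 2 * `|alpha' a E0 (v ^+ 2 / 2 + u)|)).
    by apply/funext => z; rewrite /f sqrrN; ring.
  rewrite fE; apply: cvgM; first exact: cvg_cst.
  apply: cvgM; first exact: exprn_continuous.
  apply: cvg_norm; apply: (continuous_comp (ck v)); exact: continuous_alpha'.
have ia : (leb1 R).-integrable `[0, s]%classic (EFin \o (fun v => 2 * alpha a E0 (v ^+ 2 / 2 + u))).
  apply: continuous_compact_integrable; first exact: segment_compact.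
  by apply: continuous_subspaceT => v; exact: ca.
have jf : (leb1 R).-integrable `[0, s]%classic (EFin \o f).
  apply: continuous_compact_integrable; first exact: segment_compact.
  by apply: continuous_in_subspaceT => v; rewrite inE/= in_itv/=; exact: cf.
have ch v : 0 <= v <= s -> {for v, continuous h} by move=> vs; apply: cvgB; [exact: ca|exact: cf].
have := @integral_is_derive R h _ 0 s s0 dh ch.
rewrite (_ : (\int[leb1 R]_(x in _) _)%E = (\int[leb1 R]_(v in `[0%R, s]) (2 * alpha a E0 (v ^+ 2 / 2 + u))%:E
  - \int[leb1 R]_(v in `[0%R, s]) (f v)%:E)%E); last first.
  by rewrite -integralB.
move=> e; apply: (@le_trans _ _ (\int[leb1 R]_(v in `[0%R, s]) (2 * alpha a E0 (v ^+ 2 / 2 + u))%:E)%E).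
  rewrite -sube_ge0; last by rewrite (integrable_fin_num _ jf) ?orbT.
  by rewrite e lee_fin mul0r mulr0 subr0 !mulr_ge0// alpha_ge0.
have m2 : measurable_fun setT (EFin \o (fun v => alpha a E0 (v ^+ 2 / 2 + u) + alpha a E0 ((- v) ^+ 2 / 2 + u))).
  by apply/measurable_EFinP; apply: measurable_funD => //; apply: (measurableT_comp ma).
rewrite -integral_itv_obnd_cbnd; last first.
  by apply: measurable_funTS; apply/measurable_EFinP; exact: measurable_funM.
rewrite (_ : (\int[leb1 R]_(x in _) _)%E = (\int[leb1 R]_(v in `]0%R, s])
    (alpha a E0 (v ^+ 2 / 2 + u) + alpha a E0 ((- v) ^+ 2 / 2 + u))%:E)%E).
  apply: ge0_subset_integral => //.
  - exact: measurable_funTS.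
  - by move=> v _; rewrite lee_fin addr_ge0 ?alpha_ge0.
  - by move=> v /=; rewrite !in_itv/= andbT => /andP[].
by apply: eq_integral => v _; rewrite sqrrN; congr (_%:E); ring.
Qed.

End kinetic_stress.

(** * Test functions of class C^1 in product form *)

Lemma is_derive_quadratic_error (R : realType) (f : R -> R) (x d C : R) :
  (forall h, `|f (x + h) - f x - d * h| <= C * h ^+ 2) -> is_derive x 1 f d.
Proof.
move=> H.
have C0 : 0 <= C by have := le_trans (normr_ge0 _) (H 1); rewrite expr1n mulr1.
have cv : h^-1 *: (f (h *: 1 + x) - f x) @[h --> 0^'] --> d.
  apply/cvgrPdist_le => e e0.
  exists (e / (C + 1)); first by rewrite /= divr_gt0// ltr_wpDl.
  move=> h /=; rewrite sub0r normrN => he h0.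
  have -> : d - h^-1 *: (f (h *: 1 + x) - f x) = - (h^-1 * (f (x + h) - f x - d * h)).
    by rewrite /GRing.scale/= mulr1 (addrC h); field.
  rewrite normrN normrM normfV ler_pdivrMl ?normr_gt0//.
  apply: le_trans (H h) _; rewrite -real_normK ?num_real// expr2 mulrCA.
  rewrite ler_wpM2l//; move: he; rewrite ltr_pdivlMr ?ltr_wpDl// => /ltW.
  by apply: le_trans; rewrite mulrC ler_wpM2l// lerDl.
split; first by apply/cvg_ex; exists d; exact: cv.
exact: cvg_lim cv.
Qed.

Lemma is_derive_maxsq (R : realType) (x : R) :
  is_derive x 1 (fun x : R => Num.max 0 x ^+ 2) (2 * Num.max 0 x).
Proof.
(* The error bound with constant 1 holds at all points alike, the junction at 0 included. *)
apply: (@is_derive_quadratic_error _ _ _ _ 1) => h; rewrite mul1r ler_norml.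
have [x0|x0] := leP 0 x; have [h0|h0] := leP 0 (x + h);
  apply/andP; split; nra.
Qed.

Definition dbump {R : realType} (a b : R) n (x : R) : R :=
  let s := (Num.max 0 (x - a) * Num.max 0 (b - x)) ^+ 2 in
  let ds := 2 * Num.max 0 (x - a) * Num.max 0 (b - x) ^+ 2 -
            2 * Num.max 0 (b - x) * Num.max 0 (x - a) ^+ 2 in
  n%:R * ds / (1 + n%:R * s) ^+ 2.

Lemma is_derive_bump (R : realType) (a b : R) n (x : R) :
  is_derive x 1 (bump a b n) (dbump a b n x).
Proof.
have d1 : is_derive x 1 (fun x => x - a) 1 by apply: is_derive_eq; rewrite subr0.
have d2 : is_derive x 1 (fun x : R => b - x) (-1).
  by apply: is_derive_eq; rewrite /GRing.scale/=; lra.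
have d3 := @is_derive1_comp R (fun y => Num.max 0 y ^+ 2) (fun x => x - a) x _ _ (is_derive_maxsq (x - a)) d1.
have d4 := @is_derive1_comp R (fun y => Num.max 0 y ^+ 2) (fun x => b - x) x _ _ (is_derive_maxsq (b - x)) d2.
pose s (x : R) := (Num.max 0 (x - a) * Num.max 0 (b - x)) ^+ 2.
have sE : s = (fun x => Num.max 0 (x - a) ^+ 2 * Num.max 0 (b - x) ^+ 2).
  by apply/funext => z; rewrite /s exprMn.
have ds : is_derive x 1 s (2 * Num.max 0 (x - a) * Num.max 0 (b - x) ^+ 2 -
            2 * Num.max 0 (b - x) * Num.max 0 (x - a) ^+ 2).
  rewrite sE; move: d3 d4; rewrite /comp/= => d3 d4.
  by apply: is_derive_eq; rewrite /GRing.scale/=; ring.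
have s0 z : 0 < 1 + n%:R * s z by rewrite ltr_pwDl// mulr_ge0// sqr_ge0.
have dd : is_derive x 1 (fun z => 1 + n%:R * s z) (n%:R * (2 * Num.max 0 (x - a) * Num.max 0 (b - x) ^+ 2 -
            2 * Num.max 0 (b - x) * Num.max 0 (x - a) ^+ 2)).
  by apply: is_derive_eq; rewrite /GRing.scale/=; ring.
have dv := @is_deriveV R (fun z => 1 + n%:R * s z) x _ 1 (lt0r_neq0 (s0 x)) dd.
have -> : bump a b n = (fun z => n%:R * s z * (1 + n%:R * s z)^-1) by [].
apply: is_derive_eq; rewrite /GRing.scale/= /dbump -/(s x).
by field; exact: lt0r_neq0.
Qed.

Lemma continuous_dbump (R : realType) (a b : R) n : continuous (dbump a b n).
Proof.
move=> x.
have c1 : {for x, continuous (fun z : R => Num.max 0 (z - a))}.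
  apply: (@continuous_max _ _ (cst 0) (fun z : R => z - a) x); first exact: cvg_cst.
  by apply: cvgB; [exact: cvg_id|exact: cvg_cst].
have c2 : {for x, continuous (fun z : R => Num.max 0 (b - z))}.
  apply: (@continuous_max _ _ (cst 0) (fun z : R => b - z) x); first exact: cvg_cst.
  by apply: cvgB; [exact: cvg_cst|exact: cvg_id].
have s0 : 0 < 1 + n%:R * (Num.max 0 (x - a) * Num.max 0 (b - x)) ^+ 2.
  by rewrite ltr_pwDl// mulr_ge0// sqr_ge0.
apply: cvgM.
  apply: cvgM; first exact: cvg_cst.
  apply: cvgB; apply: cvgM; try (apply: cvgM; [exact: cvg_cst|]); try exact: c1; try exact: c2.
    exact: (cvgM c2 c2).
  exact: (cvgM c1 c1).
apply: cvgV; first by rewrite expf_eq0/= gt_eqF.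
have c : {for x, continuous (fun x => 1 + n%:R * (Num.max 0 (x - a) * Num.max 0 (b - x)) ^+ 2)}.
  apply: cvgD; first exact: cvg_cst.
  apply: cvgM; first exact: cvg_cst.
  exact: (cvgM (cvgM c1 c2) (cvgM c1 c2)).
exact: (cvgM c c).
Qed.

Lemma continuous_bump (R : realType) (a b : R) n : continuous (bump a b n).
Proof. exact: derive_continuous (is_derive_bump a b n). Qed.

Section test_functions.
Context {R : realType} (U F : R -> R).
Context (dU : forall x : R, is_derive x 1 U (F x)) (cF : continuous F).

(** The energy is a separate factor although [x] and [v1] determine it: the transport operator
    annihilates the factors in the energy and in vbar and acts on [f0] and [f1] only. *)
Definition tens (f0 f1 f2 f3 f4 : R -> R) (z : phase R) : R :=
  f0 z.1 * f1 z.2.1 * f2 (energy U z) * (f3 z.2.2.1 * f4 z.2.2.2).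

Lemma continuous_energy : continuous (energy U).
Proof.
move=> z; have cU := derive_continuous dU.
have c1 : {for z, continuous (fun z : phase R => z.2.1)}.
  by apply: (continuous_comp (f := snd) (g := fst)); [exact: cvg_snd|exact: cvg_fst].
apply: cvgD.
  apply: cvgM; last exact: cvg_cst.
  exact: (continuous_comp c1 (@exprn_continuous R 2 _)).
by apply: (continuous_comp (f := fst)); [exact: cvg_fst|exact: cU].
Qed.

Lemma continuous_tens f0 f1 f2 f3 f4 : continuous f0 -> continuous f1 -> continuous f2 ->
  continuous f3 -> continuous f4 -> continuous (tens f0 f1 f2 f3 f4).
Proof.
move=> c0 c1 c2 c3 c4 z.
have k0 : {for z, continuous (fun z : phase R => z.1)} by exact: cvg_fst.
have ks : {for z, continuous (fun z : phase R => z.2)} by exact: cvg_snd.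
have k1 : {for z, continuous (fun z : phase R => z.2.1)}.
  by apply: (continuous_comp ks); exact: cvg_fst.
have kt : {for z, continuous (fun z : phase R => z.2.2)}.
  by apply: (continuous_comp ks); exact: cvg_snd.
have k3 : {for z, continuous (fun z : phase R => z.2.2.1)}.
  by apply: (continuous_comp kt); exact: cvg_fst.
have k4 : {for z, continuous (fun z : phase R => z.2.2.2)}.
  by apply: (continuous_comp kt); exact: cvg_snd.
have ke := @continuous_energy z.
apply: cvgM; first apply: cvgM; first apply: cvgM.
- exact: (continuous_comp k0 (c0 _)).
- exact: (continuous_comp k1 (c1 _)).
- exact: (continuous_comp ke (c2 _)).
- by apply: cvgM; [exact: (continuous_comp k3 (c3 _))|exact: (continuous_comp k4 (c4 _))].
Qed.

Lemma is_derive_line (f : phase R -> R) (z e : phase R) (d : R) :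
  is_derive (0 : R) 1 (fun t : R => f (t *: e + z)) d -> is_derive z e f d.
Proof.
have E : (fun h : R => h^-1 *: (f (h *: e + z) - f z)) =
  (fun h : R => h^-1 *: ((fun t : R => f (t *: e + z)) (h *: 1 + 0) - (fun t : R => f (t *: e + z)) 0)).
  by apply/funext => h; rewrite scale0r add0r addr0 /GRing.scale/= mulr1.
move=> [d1 d2]; split; first by rewrite /derivable E.
by rewrite /derive E.
Qed.

Context (f0 f1 f2 f3 f4 g0 g1 g2 g3 g4 : R -> R).
Context (d0 : forall x : R, is_derive x 1 f0 (g0 x)) (d1 : forall x : R, is_derive x 1 f1 (g1 x))
  (d2 : forall x : R, is_derive x 1 f2 (g2 x)) (d3 : forall x : R, is_derive x 1 f3 (g3 x))
  (d4 : forall x : R, is_derive x 1 f4 (g4 x)).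

Lemma is_derive_tens (z e : phase R) : is_derive z e (tens f0 f1 f2 f3 f4)
  (e.1 * (tens g0 f1 f2 f3 f4 z + F z.1 * tens f0 f1 g2 f3 f4 z) +
   e.2.1 * (tens f0 g1 f2 f3 f4 z + z.2.1 * tens f0 f1 g2 f3 f4 z) +
   e.2.2.1 * tens f0 f1 f2 g3 f4 z + e.2.2.2 * tens f0 f1 f2 f3 g4 z).
Proof.
apply: is_derive_line; case: z e => [x [v [s t]]] [ex [ev [es et]]] /=.
rewrite /tens /energy/=.
have aff (c y : R) : is_derive (0 : R) 1 (fun t : R => t * c + y) c.
  by apply: is_derive_eq; rewrite /GRing.scale/=; ring.
have comp (f g : R -> R) (c y : R) : (forall x : R, is_derive x 1 f (g x)) ->
    is_derive (0 : R) 1 (fun t : R => f (t * c + y)) (g y * c).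
  move=> df; have := @is_derive1_comp R f (fun t => t * c + y) 0 _ _ (df _) (aff c y).
  by rewrite mul0r add0r.
have k0 := comp f0 g0 ex x d0; have k1 := comp f1 g1 ev v d1.
have k3 := comp f3 g3 es s d3; have k4 := comp f4 g4 et t d4.
have kU := comp U F ex x dU; have kv := aff ev v.
have kE : is_derive (0 : R) 1 (fun t : R => (t * ev + v) ^+ 2 / 2 + U (t * ex + x)) (v * ev + F x * ex).
  by apply: is_derive_eq; rewrite /GRing.scale/=; field.
have k2 : is_derive (0 : R) 1 (fun t : R => f2 ((t * ev + v) ^+ 2 / 2 + U (t * ex + x)))
    (g2 (v ^+ 2 / 2 + U x) * (v * ev + F x * ex)).
  have := @is_derive1_comp R f2 (fun t : R => (t * ev + v) ^+ 2 / 2 + U (t * ex + x)) 0 _ _ (d2 _) kE.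
  by rewrite !mul0r !add0r.
rewrite /GRing.scale/=.
apply: is_derive_eq; rewrite !mul0r !add0r /GRing.scale/=; ring.
Qed.

Context (cg0 : continuous g0) (cg1 : continuous g1) (cg2 : continuous g2)
  (cg3 : continuous g3) (cg4 : continuous g4).

Lemma Dop_tens (z : phase R) : Dop U (tens f0 f1 f2 f3 f4) z =
  z.2.1 * tens g0 f1 f2 f3 f4 z - F z.1 * tens f0 g1 f2 f3 f4 z.
Proof.
rewrite /Dop derive1E.
have /@derive_val -> := is_derive_tens z (ex R).
have /@derive_val -> := is_derive_tens z (ev1 R).
have /@derive_val -> := dU z.1.
by rewrite /ex /ev1/=; ring.
Qed.

Lemma C1c_tens (Om K : set (phase R)) : compact K -> K `<=` Om ->
  (forall z, tens f0 f1 f2 f3 f4 z != 0 -> K z) -> C1c Om (tens f0 f1 f2 f3 f4).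
Proof.
move=> cK KOm tK.
have [c0 c1 c2 c3 c4] : [/\ continuous f0, continuous f1, continuous f2, continuous f3 & continuous f4].
  by split; [exact: derive_continuous d0|exact: derive_continuous d1|exact: derive_continuous d2|
    exact: derive_continuous d3|exact: derive_continuous d4].
have clK : closed K by apply: compact_closed => //; exact: norm_hausdorff.
have sub : closure [set z | tens f0 f1 f2 f3 f4 z != 0] `<=` K.
  have e := (closure_id K).1 clK; rewrite [X in _ `<=` X]e.
  by apply: closure_subset => z /=; exact: tK.
split; first by move=> z e; have ? := is_derive_tens z e; exact: ex_derive.
split; last split.
- move=> e.
  have -> : 'D_e (tens f0 f1 f2 f3 f4) = (fun z => e.1 * (tens g0 f1 f2 f3 f4 z + F z.1 * tens f0 f1 g2 f3 f4 z) +
   e.2.1 * (tens f0 g1 f2 f3 f4 z + z.2.1 * tens f0 f1 g2 f3 f4 z) +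
   e.2.2.1 * tens f0 f1 f2 g3 f4 z + e.2.2.2 * tens f0 f1 f2 f3 g4 z).
    by apply/funext => z; have /@derive_val -> := is_derive_tens z e.
  have cc c : continuous (cst c : phase R -> R) by move=> ?; exact: cvg_cst.
  have ks : continuous (snd : phase R -> _) by move=> ?; exact: cvg_snd.
  move=> z; apply: cvgD; first apply: cvgD; first apply: cvgD.
  + apply: cvgM; first exact: cvg_cst.
    apply: cvgD; first exact: continuous_tens.
    apply: cvgM; last exact: continuous_tens.
    by apply: (continuous_comp (f := fst)); [exact: cvg_fst|exact: cF].
  + apply: cvgM; first exact: cvg_cst.
    apply: cvgD; first exact: continuous_tens.
    apply: cvgM; last exact: continuous_tens.
    by apply: (continuous_comp (f := snd) (g := fst)); [exact: cvg_snd|exact: cvg_fst].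
  + by apply: cvgM; [exact: cvg_cst|exact: continuous_tens].
  + by apply: cvgM; [exact: cvg_cst|exact: continuous_tens].
- exact: (subclosed_compact (@closed_closure _ _) cK sub).
- exact: subset_trans sub KOm.
Qed.

End test_functions.

Lemma integrable_ae_eq d (T : measurableType d) (R : realType)
    (mu : {measure set T -> \bar R}) (f g : T -> \bar R) :
  mu.-integrable setT f -> measurable_fun setT g -> {ae mu, forall x, f x = g x} ->
  mu.-integrable setT g.
Proof.
move=> /integrableP[mf foo] mg fg; apply/integrableP; split => //.
rewrite (_ : (\int[mu]_x `|g x|)%E = (\int[mu]_x `|f x|)%E)//.
apply: ae_eq_integral => //; try exact: measurableT_comp.
by apply: (@filterS _ _ (ae_filter_ringOfSetsType mu)) fg => x /= ->.
Qed.

(** * Almost every section of an integrable function *)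

Section sections.
Context d1 d2 (T1 : measurableType d1) (T2 : measurableType d2) (R : realType).
Context (m1 : {sigma_finite_measure set T1 -> \bar R}) (m2 : {sigma_finite_measure set T2 -> \bar R}).
Implicit Type k : T1 * T2 -> R.

Lemma measurable_section_integral k : measurable_fun setT k ->
  measurable_fun setT (fun y => \int[m1]_x (k (x, y))%:E)%E.
Proof.
move=> mk; pose f := EFin \o k.
have mf : measurable_fun setT f by exact/measurable_EFinP.
have mp := @measurable_fun_fubini_tonelli_G _ _ T1 T2 R m1 (f^\+)%E (measurable_funepos mf) (funepos_ge0 f).
have mn := @measurable_fun_fubini_tonelli_G _ _ T1 T2 R m1 (f^\-)%E (measurable_funeneg mf) (funeneg_ge0 f).
have -> : (fun y => \int[m1]_x (k (x, y))%:E)%E =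
    (fun y => \int[m1]_x (f^\+)%E (x, y) - \int[m1]_x (f^\-)%E (x, y))%E.
  apply/funext => y; rewrite integralE; congr (_ - _)%E.
    by apply: eq_integral => x _; rewrite !funeposE.
  by apply: eq_integral => x _; rewrite !funenegE.
exact: emeasurable_funB.
Qed.

(** A section may fail to be integrable on a null set of [y]. Applying [fine] everywhere gives a
    real function of [y], to which the tests with bumps apply. *)
Lemma integrable_sections k : (m1 \x m2)%E.-integrable setT (EFin \o k) ->
  [/\ {ae m2, forall y, m1.-integrable setT (fun x => (k (x, y))%:E)},
      m2.-integrable setT (fun y => (fine (\int[m1]_x (k (x, y))%:E))%:E)%E &
      (\int[m2]_y (fine (\int[m1]_x (k (x, y))%:E))%:E = \int[m1 \x m2]_z (k z)%:E)%E].
Proof.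
move=> ik.
have mk : measurable_fun setT k by apply/measurable_EFinP; exact: measurable_int ik.
have aek := ae_integrable2 ik.
have mG := measurable_section_integral mk.
have G := integral21_prod_meas1 ik.
have E : ae_eq m2 setT (fun y => (fine (\int[m1]_x (k (x, y))%:E))%:E)%E (fun y => \int[m1]_x (k (x, y))%:E)%E.
  apply: (@filterS _ _ (ae_filter_ringOfSetsType m2)) aek => y iy _.
  by rewrite fineK//; exact: integrable_fin_num iy.
have mfG : measurable_fun setT (fun y => (fine (\int[m1]_x (k (x, y))%:E))%:E)%E.
  by apply/measurable_EFinP; apply: measurableT_comp.
have iG : m2.-integrable setT (fun y => \int[m1]_x (k (x, y))%:E)%E.
  apply/integrableP; split => //.
  have := (@integrable21ltyP _ _ T1 T2 R m1 m2 _ (measurable_int _ ik)).1 ik.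
  apply: le_lt_trans; apply: ge0_le_integral => //.
  - exact: measurableT_comp.
  - apply: (@measurable_fun_fubini_tonelli_G _ _ T1 T2 R m1 (abse \o (EFin \o k)) _ (fun=> abse_ge0 _)).
    by apply: measurableT_comp => //; exact/measurable_EFinP.
  - move=> y _; apply: le_abse_integral => //.
    by apply/measurable_EFinP; apply: (measurableT_comp mk); exact: measurable_pair2.
split.
- exact: aek.
- apply: (integrable_ae_eq iG) => //.
  by apply: (@filterS _ _ (ae_filter_ringOfSetsType m2)) E => y h; rewrite h.
- rewrite -[RHS]G; apply: ae_eq_integral => //.
Qed.

End sections.

Section box_sections.
Context {R : realType}.
Let Y : measurableType _ := (measurableTypeR R * (measurableTypeR R * measurableTypeR R))%type.
Context (O : set Y) (oO : open (O : set (R * (R * R)))) (A : Y -> R) (mA : measurable_fun setT A)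
  (AO : forall y, O y -> A y != 0).
Context (k : measurableTypeR R * Y -> R) (mk : measurable_fun setT k).
Context (ik : forall a0 b0 a1 b1 a2 b2 : R, a0 < b0 -> a1 < b1 -> a2 < b2 ->
  `[a0, b0] `*` (`[a1, b1] `*` `[a2, b2]) `<=` O ->
  (lam4 R).-integrable setT
    (EFin \o (fun z => \1_(`[a0, b0] `*` (`[a1, b1] `*` `[a2, b2])) z.2 * (A z.2 * k z)))).

Lemma ae_integrable_section : {ae lam3 R, forall y, O y -> (leb1 R).-integrable setT (fun x => (k (x, y))%:E)}.
Proof.
apply: ae_open_of_boxes => // a0 b0 a1 b1 a2 b2 h0 h1 h2 BO.
have [+ _ _] := integrable_sections (ik h0 h1 h2 BO).
apply: (@filterS _ _ (ae_filter_ringOfSetsType (lam3 R))) => y iy y0 y1 y2.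
have By : (`[a0, b0] `*` (`[a1, b1] `*` `[a2, b2])) y.
  by split => /=; [|split => /=]; rewrite in_itv/=; [move: y0|move: y1|move: y2] => /andP[/ltW -> /ltW ->].
have := integrableZl measurableT (A y)^-1 iy.
apply: eq_integrable => // x _ /=.
by rewrite indicE mem_set// mul1r -EFinM mulKf// AO//; exact: BO.
Qed.

(** Passage from a weak equation in four variables to one equation per orbit. By Fubini the orbit
    integral, weighted by [A], is tested against bumps in the invariants [y]; the weight, which the
    weak formulation carries, is divided out at the end because it does not vanish on [O]. *)
Lemma ae_section_eq0 :
  (forall a0 b0 a1 b1 a2 b2 : R, a0 < b0 -> a1 < b1 -> a2 < b2 ->
   `[a0, b0] `*` (`[a1, b1] `*` `[a2, b2]) `<=` O ->
   forall (r0 r1 r2 : rat) n0 n1 n2, a0 < ratr r0 < b0 -> a1 < ratr r1 < b1 -> a2 < ratr r2 < b2 ->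
   (\int[lam4 R]_z (bump3 (ratr r0) b0 (ratr r1) b1 (ratr r2) b2 n0 n1 n2 z.2 * (A z.2 * k z))%:E = 0)%E) ->
  {ae lam3 R, forall y, O y -> fine (\int[leb1 R]_x (k (x, y))%:E)%E = 0}.
Proof.
move=> k0; have aei := ae_integrable_section.
pose h y := A y * fine (\int[leb1 R]_x (k (x, y))%:E)%E.
have mh : measurable_fun setT h.
  apply: measurable_funM => //; apply: measurableT_comp => //.
  exact: (@measurable_section_integral _ _ (measurableTypeR R) Y R (leb1 R) k mk).
have FF := ae_filter_ringOfSetsType (lam3 R).
have h_eq (c : Y -> R) : measurable_fun setT c -> (forall y, c y != 0 -> O y) ->
   ae_eq (lam3 R) setT (fun y => (c y * h y)%:E)
    (fun y => (fine (\int[leb1 R]_x (c y * (A y * k (x, y)))%:E))%:E)%E.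
  move=> mc cO; apply: (@filterS _ _ FF) aei => y iy _.
  have [c0|/cO /iy i] := eqVneq (c y) 0.
    by rewrite c0 mul0r; under eq_integral do rewrite mul0r; rewrite integral0.
  congr (_%:E); rewrite /h mulrA.
  rewrite [in RHS](eq_integral (fun x => (c y * A y)%:E * (k (x, y))%:E)%E); last by move=> x _; rewrite mulrA.
  by rewrite integralZl// fineM//; exact: integrable_fin_num i.
suff : {ae lam3 R, forall y, O y -> h y = 0}.
  apply: (@filterS _ _ FF) => y hy Oy; move: (hy Oy) => /eqP.
  by rewrite /h mulf_eq0 (negbTE (AO Oy)) => /eqP.
apply: ae_eq0_open => // a0 b0 a1 b1 a2 b2 h0 h1 h2 BO.
pose B : set Y := `[a0, b0] `*` (`[a1, b1] `*` `[a2, b2]).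
have mB : measurable (B : set Y) by apply: measurableX => //; exact: measurableX.
have [_ iB _] := integrable_sections (ik h0 h1 h2 BO).
split.
  have mB1 : measurable_fun setT (\1_B : Y -> R) by exact: measurable_indic.
  have BO' y : (\1_B y : R) != 0 -> O y.
    rewrite indicE; have [yB _|] := boolP (y \in B); last by rewrite eqxx.
    by apply: BO; rewrite -inE.
  have mBh : measurable_fun setT (fun y => (\1_B y * h y)%:E).
    by apply/measurable_EFinP; exact: measurable_funM.
  have := h_eq _ mB1 BO'.
  move=> e; have : (lam3 R).-integrable setT (fun y => (\1_B y * h y)%:E).
    apply: (integrable_ae_eq iB) => //.
    by apply: (@filterS _ _ FF) e => y /(_ I) ->.
  move=> iBh; have := integrableS measurableT mB (@subsetT _ _) iBh; apply: eq_integrable => // y yB /=.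
  by rewrite indicE yB mul1r.
move=> r0 r1 r2 n0 n1 n2 hr0 hr1 hr2.
pose c (y : Y) : R := bump3 (ratr r0) b0 (ratr r1) b1 (ratr r2) b2 n0 n1 n2 y.
have mc : measurable_fun setT c.
  apply: measurable_funM.
    by apply: (measurableT_comp (measurable_bump _ _ _)); exact: measurable_fst.
  apply: measurable_funM.
    apply: (measurableT_comp (measurable_bump _ _ _)).
    by apply: (measurableT_comp measurable_fst); exact: measurable_snd.
  apply: (measurableT_comp (measurable_bump _ _ _)).
  by apply: (measurableT_comp measurable_snd); exact: measurable_snd.
have cB y : c y != 0 -> B y.
  by case/andP: hr0 hr1 hr2 => ? _ /andP[? _] /andP[? _]; exact: bump3_neq0.
have c1 y : `|c y| <= 1.
  have b1' (a b x : R) n : `|bump a b n x| <= 1 by rewrite ger0_norm ?bump_ge0// bump_le1.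
  have p3 (u v w : R) : `|u| <= 1 -> `|v| <= 1 -> `|w| <= 1 -> `|u * (v * w)| <= 1.
    by move=> u1 v1 w1; rewrite !normrM mulr_ile1 ?mulr_ge0// mulr_ile1.
  by apply: p3; exact: b1'.
have ic : (lam4 R).-integrable setT (EFin \o (fun z => c z.2 * (A z.2 * k z))).
  have mc2 : measurable_fun [set: measurableTypeR R * Y] (fun z => c z.2).
    by apply: (measurableT_comp mc); exact: measurable_snd.
  have bc : [bounded (fun z : measurableTypeR R * Y => c z.2) x | x in setT].
    by exists 1; split => // M M1 z _ /=; rewrite (le_trans (c1 _))// ltW.
  have := integrableMr measurableT mc2 bc (ik h0 h1 h2 BO).
  apply: eq_integrable => // z _ /=; rewrite -EFinM; congr (_%:E).
  rewrite indicE -/B; have [zB|zB] := boolP (z.2 \in B); first by rewrite mul1r.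
  have -> : c z.2 = 0 by apply: contraTeq zB => /cB; rewrite negbK inE.
  by rewrite !mul0r.
have [_ _ e] := integrable_sections ic.
transitivity (\int[lam3 R]_y (fine (\int[leb1 R]_x (c y * (A y * k (x, y)))%:E))%:E)%E.
  apply: ae_eq_integral => //.
  - by apply/measurable_EFinP; exact: measurable_funM.
  - have [_ ie _] := integrable_sections ic; exact: measurable_int ie.
  - have := h_eq c mc (fun y cy => BO _ (cB y cy)).
    by apply: (@filterS _ _ FF) => y /(_ I) e' _; rewrite -e' mulrC.
rewrite e; exact: (k0 _ _ _ _ _ _ h0 h1 h2 BO r0 r1 r2 n0 n1 n2 hr0 hr1 hr2).
Qed.

End box_sections.

Lemma integrable_bounded_mul d (T : measurableType d) (R : realType)
    (mu : {measure set T -> \bar R}) (f h : T -> R) (C : R) :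
  measurable_fun setT f -> (forall t, `|f t| <= C) -> mu.-integrable setT (EFin \o h) ->
  mu.-integrable setT (fun t => (f t * h t)%:E).
Proof.
move=> mf fC ih; have bf : [bounded f t | t in setT].
  by exists C; split; [exact: num_real|move=> N CN t _ /=; rewrite (le_trans (fC t))// ltW].
by have := integrableMr measurableT mf bf ih; apply: eq_integrable.
Qed.

(** * Primitives, tails and a smooth sign *)

Section primitives.
Context {R : realType}.
Implicit Types m M G : R -> R.

Definition primitive m (x : R) : R := (\int[leb1 R]_(t in `]-oo, x]) m t)%R.

Definition tail M (t : R) : R := (\int[leb1 R]_(x in `[t, +oo[) M x)%R.

Lemma is_derive_primitive m (x : R) : (leb1 R).-integrable setT (EFin \o m) -> continuous m ->
  is_derive x 1 (primitive m) (m x).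
Proof.
move=> im cm.
have [d e] := @continuous_FTC1 R m -oo%O x (x + 1) ltac:(by rewrite ltrDl)
  ltac:(by apply: integrableS im) (ltNyr x) (cm x).
split; first exact: d.
by rewrite -derive1E.
Qed.

Lemma Rintegral_le_norm m (D : set (measurableTypeR R)) : measurable D -> (leb1 R).-integrable setT (EFin \o m) ->
  `|(\int[leb1 R]_(t in D) m t)%R| <= fine (\int[leb1 R]_t (`|m t|)%:E)%E.
Proof.
move=> mD im; have imD := integrableS measurableT mD (@subsetT _ _) im.
have im' : (leb1 R).-integrable setT (EFin \o (fun t => `|m t|)) by exact: integrable_norm im.
apply: le_trans (le_normr_Rintegral mD imD) _.
rewrite fine_le//; [| |].
- exact: integrable_fin_num (integrableS measurableT mD (@subsetT _ _) im').
- exact: integrable_fin_num im'.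
- apply: ge0_subset_integral => //.
  exact: measurable_int im'.
Qed.

(** Fubini on the triangle [t <= x]: an integration by parts that asks for integrability alone and
    has no boundary terms. *)
Lemma primitive_tail m M : (leb1 R).-integrable setT (EFin \o m) ->
  (leb1 R).-integrable setT (EFin \o M) ->
  [/\ measurable_fun setT (primitive m), measurable_fun setT (tail M) &
   (\int[leb1 R]_x (primitive m x * M x)%:E = \int[leb1 R]_t (m t * tail M t)%:E)%E].
Proof.
move=> im iM.
pose D := measurableTypeR R.
have mm : measurable_fun setT m by apply/measurable_EFinP; exact: measurable_int im.
have mM : measurable_fun setT M by apply/measurable_EFinP; exact: measurable_int iM.
pose e (z : D * D) : R := if z.1 <= z.2 then 1 else 0.
have me : measurable_fun [set: D * D] e.
  by apply: measurable_fun_if => //; apply: measurable_fun_ler; [exact: measurable_fst|exact: measurable_snd].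
have m1 : measurable_fun [set: D * D] (fun z => m z.1) by apply: (measurableT_comp mm); exact: measurable_fst.
have m2 : measurable_fun [set: D * D] (fun z => M z.2) by apply: (measurableT_comp mM); exact: measurable_snd.
have prim x : (primitive m x)%:E = (\int[leb1 R]_t (e (t, x) * m t)%:E)%E.
  rewrite /primitive /Rintegral fineK; last first.
    by apply: integrable_fin_num => //; exact: integrableS im.
  rewrite integral_mkcond; apply: eq_integral => t _; rewrite patchE /e/=.
  have -> : (t \in `]-oo, x]%classic) = (t <= x) by rewrite mem_setE in_itv.
  by case: ifP => _; rewrite ?mul1r ?mul0r.
have tl t : (tail M t)%:E = (\int[leb1 R]_x (e (t, x) * M x)%:E)%E.
  rewrite /tail /Rintegral fineK; last first.
    by apply: integrable_fin_num => //; exact: integrableS iM.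
  rewrite integral_mkcond; apply: eq_integral => x _; rewrite patchE /e/=.
  have -> : (x \in `[t, +oo[%classic) = (t <= x) by rewrite mem_setE in_itv/= andbT.
  by case: ifP => _; rewrite ?mul1r ?mul0r.
have e01 z : `|e z| <= 1 by rewrite /e; case: ifP; rewrite ?normr1 ?normr0.
pose K (z : D * D) := e z * (m z.1 * M z.2).
have mK : measurable_fun setT K by apply: measurable_funM => //; exact: measurable_funM.
have iK : (leb1 R \x leb1 R)%E.-integrable setT (EFin \o K).
  apply/(@integrable12ltyP _ _ D D R (leb1 R) (leb1 R)); first exact/measurable_EFinP.
  apply: (@le_lt_trans _ _ (\int[leb1 R]_t ((`|m t|)%:E * \int[leb1 R]_x (`|M x|)%:E))%E).
    apply: ge0_le_integral => //.
    - by move=> t _; apply: integral_ge0 => x _.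
    - apply: (@measurable_fun_fubini_tonelli_F _ _ D D R (leb1 R) (fun z => (`|K z|)%:E)) => //.
      by apply/measurable_EFinP; exact: measurableT_comp.
    - apply: emeasurable_funM => //; apply/measurable_EFinP; exact: measurableT_comp.
    - move=> t _; rewrite -ge0_integralZl//; last first.
        by apply/measurable_EFinP; exact: measurableT_comp.
      apply: ge0_le_integral => //.
      + apply/measurable_EFinP; apply: measurableT_comp => //.
        by apply: (measurableT_comp mK); exact: measurable_pair1.
      + by apply: emeasurable_funM => //; apply/measurable_EFinP; exact: measurableT_comp.
      + by move=> x _; rewrite lee_fin /K !normrM ler_piMl// mulr_ge0.
  rewrite ge0_integralZr//; last 2 first.
  - by apply/measurable_EFinP; exact: measurableT_comp.
  - by apply: integral_ge0.
  have im' : (leb1 R).-integrable setT (EFin \o (fun t => `|m t|)) by exact: integrable_norm im.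
  have iM' : (leb1 R).-integrable setT (EFin \o (fun t => `|M t|)) by exact: integrable_norm iM.
  rewrite -(fineK (integrable_fin_num measurableT im')) -(fineK (integrable_fin_num measurableT iM')).
  by rewrite -EFinM ltry.
split.
- apply/measurable_EFinP; rewrite (_ : EFin \o _ = (fun x => \int[leb1 R]_t (e (t, x) * m t)%:E)%E).
    apply: (@measurable_section_integral _ _ D D R (leb1 R) (fun z => e z * m z.1)).
    exact: measurable_funM.
  by apply/funext => x /=; rewrite prim.
- apply/measurable_EFinP; rewrite (_ : EFin \o _ = (fun t => \int[leb1 R]_x (e (t, x) * M x)%:E)%E).
    apply: (@measurable_section_integral _ _ D D R (leb1 R) (fun z => e (z.2, z.1) * M z.1)).
    apply: measurable_funM.
      by apply: (measurableT_comp me); apply: measurable_fun_pair; [exact: measurable_snd|exact: measurable_fst].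
    by apply: (measurableT_comp mM); exact: measurable_fst.
  by apply/funext => x /=; rewrite tl.
- transitivity (\int[leb1 R]_x \int[leb1 R]_t (K (t, x))%:E)%E.
    apply: eq_integral => x _; rewrite EFinM prim -integralZr//.
      by apply: eq_integral => t _; rewrite /K -EFinM mulrA.
    apply: (@integrable_bounded_mul _ D R (leb1 R) (fun t => e (t, x)) _ 1) => //.
    by apply: (measurableT_comp me); exact: measurable_pair2.
  rewrite -(@Fubini _ _ D D R (leb1 R) (leb1 R) (EFin \o K) iK).
  apply: eq_integral => t _; rewrite EFinM tl -integralZl//.
    by apply: eq_integral => x _; rewrite /K -EFinM/= mulrCA.
  apply: (@integrable_bounded_mul _ D R (leb1 R) (fun x => e (t, x)) _ 1) => //.
  by apply: (measurableT_comp me); exact: measurable_pair1.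
Qed.

(** Once the primitive has been moved onto [M] by [primitive_tail], the hypothesis says that
    [G + tail M] is orthogonal to all bumps ending at [b]. *)
Lemma ae_eq_tail G M (b : R) : 0 < b ->
  (leb1 R).-integrable setT (EFin \o G) -> (leb1 R).-integrable setT (EFin \o M) ->
  (forall (r : rat) n, 0 < (ratr r : R) < b ->
    (\int[leb1 R]_x (bump (ratr r) b n x * G x + primitive (bump (ratr r) b n) x * M x)%:E = 0)%E) ->
  {ae leb1 R, forall x, 0 < x < b -> G x = - tail M x}.
Proof.
move=> b0 iG iM H.
have mG : measurable_fun setT G by apply/measurable_EFinP; exact: measurable_int iG.
have ib (r : R) n : (leb1 R).-integrable setT (EFin \o bump r b n).
  have ic : (leb1 R).-integrable `[r, b]%classic (EFin \o bump r b n).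
    apply: continuous_compact_integrable; first exact: segment_compact.
    by apply: continuous_subspaceT; exact: continuous_bump.
  have -> : EFin \o bump r b n = (EFin \o bump r b n) \_ `[r, b].
    apply/funext => x; rewrite patchE; case: ifPn => //; rewrite mem_setE in_itv/= => xrb.
    by rewrite /= bump_out//; apply: contra xrb => /andP[/ltW -> /ltW ->].
  by apply/(integrable_mkcond _ _).1.
have [_ mt _] := primitive_tail (ib 0 0%N) iM.
have tb x : `|tail M x| <= fine (\int[leb1 R]_t (`|M t|)%:E)%E by exact: Rintegral_le_norm.
pose h x := G x + tail M x.
have mh : measurable_fun setT h by exact: measurable_funD.
have ih : (leb1 R).-integrable `]0, b[%classic (EFin \o h).
  have i1 : (leb1 R).-integrable `]0, b[%classic (EFin \o G) by exact: integrableS iG.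
  have i2 : (leb1 R).-integrable `]0, b[%classic (EFin \o tail M).
    apply: measurable_bounded_integrable => //.
    - by rewrite [X in (X < _)%E]lebesgue_measure_itv/=; case: ifP => // _; rewrite -EFinB ltry.
    - exact: measurable_funTS.
    - by exists (fine (\int[leb1 R]_t (`|M t|)%:E)%E); split; [exact: num_real|move=> N CN x _ /=; rewrite (le_trans (tb x))// ltW].
  rewrite (_ : EFin \o h = ((EFin \o G) \+ (EFin \o tail M))%E); last by apply/funext => x.
  exact: integrableD.
have h0 (r : rat) n : 0 < (ratr r : R) < b -> (\int[leb1 R]_t (h t * bump (ratr r) b n t)%:E = 0)%E.
  move=> rb; rewrite -[RHS](H r n rb).
  have [mp _ pt] := primitive_tail (ib (ratr r) n) iM.
  have j1 : (leb1 R).-integrable setT (fun x => (bump (ratr r) b n x * G x)%:E).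
    apply: (@integrable_bounded_mul _ (measurableTypeR R) R (leb1 R) _ _ 1) => //.
      exact: measurable_bump.
    by move=> x; rewrite ger0_norm ?bump_ge0// bump_le1.
  have j2 : (leb1 R).-integrable setT (fun x => (primitive (bump (ratr r) b n) x * M x)%:E).
    apply: (@integrable_bounded_mul _ (measurableTypeR R) R (leb1 R) _ _
      (fine (\int[leb1 R]_t (`|bump (ratr r) b n t|)%:E)%E)) => // x.
    exact: Rintegral_le_norm.
  have j3 : (leb1 R).-integrable setT (fun x => (bump (ratr r) b n x * tail M x)%:E).
    have -> : (fun x => (bump (ratr r) b n x * tail M x)%:E) = (fun x => (tail M x * bump (ratr r) b n x)%:E).
      by apply/funext => x; rewrite mulrC.
    exact: (@integrable_bounded_mul _ (measurableTypeR R) R (leb1 R) _ _ _ mt tb).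
  transitivity (\int[leb1 R]_x (bump (ratr r) b n x * G x)%:E + \int[leb1 R]_x (bump (ratr r) b n x * tail M x)%:E)%E.
    rewrite -integralD//; apply: eq_integral => x _; rewrite -EFinD /h; congr (_%:E); ring.
  by rewrite -pt -integralD.
have := ae_eq0_of_bump mh ih b0 h0.
apply: (@filterS _ _ (ae_filter_ringOfSetsType (leb1 R))) => x hx xb.
by apply/eqP; rewrite -addr_eq0; apply/eqP; exact: hx.
Qed.

End primitives.

Section bump_primitives.
Context {R : realType}.

Lemma bump_integrable (r b : R) n : (leb1 R).-integrable setT (EFin \o bump r b n).
Proof.
have ic : (leb1 R).-integrable `[r, b]%classic (EFin \o bump r b n).
  apply: continuous_compact_integrable; first exact: segment_compact.
  by apply: continuous_subspaceT; exact: continuous_bump.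
have -> : EFin \o bump r b n = (EFin \o bump r b n) \_ `[r, b].
  apply/funext => x; rewrite patchE; case: ifPn => //; rewrite mem_setE in_itv/= => xrb.
  by rewrite /= bump_out//; apply: contra xrb => /andP[/ltW -> /ltW ->].
by apply/(integrable_mkcond _ _).1.
Qed.

Lemma primitive_eq0 (m : R -> R) x : (forall t, t <= x -> m t = 0) -> primitive m x = 0.
Proof.
move=> m0; rewrite /primitive /Rintegral integral0_eq// => t /=.
by rewrite in_itv/= => /m0 ->.
Qed.

Lemma measurable_sgr : measurable_fun setT (@Num.sg R).
Proof.
rewrite (_ : @Num.sg R = (fun x => (if 0 < x then 1 else 0) - (if x < 0 then 1 else 0))).
  by apply: measurable_funB; apply: measurable_fun_if => //; exact: measurable_fun_ltr.
apply/funext => x; case: (ltrgtP 0 x) => [x0|x0|<-].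
- by rewrite gtr0_sg// subr0.
- by rewrite ltr0_sg// sub0r.
- by rewrite sgr0 subr0.
Qed.

End bump_primitives.

(** Witness: the second difference of [P(t) = max(0, t)^2] at [t = v / d], minus 1. For [t >= 1] all
    three squares are active and their second difference is 2; for [t <= -1] none is. *)
Lemma smooth_sign (R : realType) (d : R) : 0 < d -> exists s s' : R -> R,
  [/\ forall v : R, is_derive v 1 s (s' v), continuous s' &
      forall v, d <= `|v| -> s v = Num.sg v /\ s' v = 0].
Proof.
move=> d0; pose P (x : R) := Num.max 0 x ^+ 2.
pose s (v : R) := P (v / d + 1) - 2 * P (v / d) + P (v / d - 1) - 1.
pose s' (v : R) := 2 / d * (Num.max 0 (v / d + 1) - 2 * Num.max 0 (v / d) + Num.max 0 (v / d - 1)).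
have dn0 : d != 0 by rewrite gt_eqF.
exists s, s'; split.
- move=> v.
  have dl (k : R) : is_derive v 1 (fun v : R => v / d + k) d^-1.
    apply: is_derive_eq; rewrite /GRing.scale/=; field; exact: dn0.
  have dP (k : R) : is_derive v 1 (fun v : R => P (v / d + k)) (2 * Num.max 0 (v / d + k) * d^-1).
    exact: (@is_derive1_comp R P (fun v => v / d + k) v _ _ (is_derive_maxsq (v / d + k)) (dl k)).
  have d1 := dP 1; have d2 := dP (- 1); have d3 := dP 0.
  have E : s = (fun v => P (v / d + 1) - 2 * P (v / d + 0) + P (v / d - 1) - 1).
    by apply/funext => x; rewrite /s addr0.
  rewrite E; apply: is_derive_eq; rewrite /GRing.scale/= /s' !addr0.
    by field; exact: dn0.
- move=> v.
  have cl (k : R) : {for v, continuous (fun v : R => Num.max 0 (v / d + k))}.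
    apply: (@continuous_max _ _ (cst 0) (fun v : R => v / d + k) v); first exact: cvg_cst.
    by apply: cvgD; [apply: cvgM; [exact: cvg_id|exact: cvg_cst]|exact: cvg_cst].
  have c0 : {for v, continuous (fun v : R => Num.max 0 (v / d))}.
    apply: (@continuous_max _ _ (cst 0) (fun v : R => v / d) v); first exact: cvg_cst.
    by apply: cvgM; [exact: cvg_id|exact: cvg_cst].
  apply: cvgM; first exact: cvg_cst.
  apply: cvgD; last exact: (cl (- 1)).
  by apply: cvgB; [exact: (cl 1)|apply: cvgM; [exact: cvg_cst|exact: c0]].
- move=> v dv; have [v0|v0] := leP 0 v.
    have h : 1 <= v / d by move: dv; rewrite ger0_norm// ler_pdivlMr// mul1r.
    have vp : 0 < v by rewrite lt_neqAle v0 andbT; apply: contraTneq dv => <-; rewrite normr0 -ltNge.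
    rewrite /s /s' /P gtr0_sg// !(@max_idPr _ _ 0 _ _); [|lra|lra|lra].
    split; [ring|ring].
  have h : v / d <= -1.
    by move: dv; rewrite ltr0_norm// => h; rewrite ler_pdivrMr// mulN1r; lra.
  rewrite /s /s' /P ltr0_sg// !(@max_idPl _ _ 0 _ _); [|lra|lra|lra].
  by rewrite expr0n/=; split; ring.
Qed.

(** * The du Bois-Reymond lemma with countably many test functions *)

Section dubois_reymond.
Context {R : realType}.
Implicit Types h : R -> R.

Lemma integral_bump_gt0 (q : R) : 0 < q -> 0 < fine (\int[leb1 R]_t (bump 0 q 1 t)%:E)%E.
Proof.
move=> q0.
have ib : (leb1 R).-integrable setT (EFin \o bump (0 : R) q 1) by exact: bump_integrable.
have fin := integrable_fin_num measurableT ib.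
rewrite lt_neqAle fine_ge0 ?andbT; last first.
  by apply: integral_ge0 => t _; rewrite lee_fin bump_ge0.
apply/eqP => e.
have i0 : (\int[leb1 R]_t `|(bump 0 q 1 t)%:E|)%E = 0%E.
  transitivity (\int[leb1 R]_t (bump 0 q 1 t)%:E)%E.
    by apply: eq_integral => t _; rewrite /= ger0_norm// bump_ge0.
  by rewrite -(fineK fin) -e.
have := (ae_eq_integral_abs _ measurableT _).1 i0 => /(_ (measurable_int _ ib)).
move=> [N [mN N0 sub]].
have : (leb1 R `]0%R, q[%classic <= leb1 R N)%E.
  apply: le_measure; rewrite ?inE//= => t /=; rewrite in_itv/= => tq.
  apply: sub => /= /(_ I) [] /eqP; rewrite gt_eqF//; exact: bump_gt0.
rewrite N0 [X in (X <= _)%E]lebesgue_measure_itv/= lte_fin q0 -EFinB lee_fin subr0.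
by rewrite leNgt q0.
Qed.

(** A bump corrected by a multiple of a second one, both multiplied by the other's integral so that
    no division occurs. *)
Definition mean_zero_bump (q s r1 : R) n (x : R) : R :=
  fine (\int[leb1 R]_t (bump 0 q 1 t)%:E)%E * bump r1 s n x -
  fine (\int[leb1 R]_t (bump r1 s n t)%:E)%E * bump 0 q 1 x.

(** The constant is the average of [h] against one fixed bump. For every other bump, the mean-zero
    combination with the fixed one shows that [h - k] is orthogonal to it. *)
Lemma ae_constant_of_mean_zero h (r : R) : 0 < r -> (leb1 R).-integrable setT (EFin \o h) ->
  (forall (q s r1 : rat) n, 0 < (ratr q : R) < r -> 0 < (ratr r1 : R) < ratr s -> (ratr s : R) < r ->
    (\int[leb1 R]_x (h x * mean_zero_bump (ratr q) (ratr s) (ratr r1) n x)%:E = 0)%E) ->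
  exists k, {ae leb1 R, forall x, 0 < x < r -> h x = k}.
Proof.
move=> r0 ih H.
have /rat_in_itvoo[q] := r0; rewrite in_itv/= => /andP[q0 qr].
pose m2 := bump (0 : R) (ratr q) 1; pose c2 := fine (\int[leb1 R]_t (m2 t)%:E)%E.
have c20 : 0 < c2 by exact: integral_bump_gt0.
pose k := fine (\int[leb1 R]_x (h x * m2 x)%:E)%E / c2.
exists k.
have hm a b n : (leb1 R).-integrable setT (fun x => (h x * bump a b n x)%:E).
  have -> : (fun x => (h x * bump a b n x)%:E) = (fun x => (bump a b n x * h x)%:E).
    by apply/funext => x; rewrite mulrC.
  apply: (@integrable_bounded_mul _ (measurableTypeR R) R (leb1 R) _ _ 1) => //.
    exact: measurable_bump.
  by move=> x; rewrite ger0_norm ?bump_ge0// bump_le1.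
(* The end [r] will be a turning point, a real number depending on the orbit, while the tests must
   be countable in number and independent of it. Hence bumps ending at rationals [s < r], and a
   union over [s] at the end. *)
have key (s : rat) : 0 < (ratr s : R) < r -> {ae leb1 R, forall x, 0 < x < ratr s -> h x - k = 0}.
  move=> /andP[s0 sr]; apply: ae_eq0_of_bump => //.
  - by apply: measurable_funB => //; apply/measurable_EFinP; exact: measurable_int ih.
  - have ik : (leb1 R).-integrable `]0, (ratr s : R)[%classic (EFin \o cst k).
      apply: measurable_bounded_integrable => //.
      + by rewrite [X in (X < _)%E]lebesgue_measure_itv/=; case: ifP => // _; rewrite -EFinB ltry.
      + by exists `|k|; split => // M kM x _ /=; exact: ltW.
    have ihs : (leb1 R).-integrable `]0, (ratr s : R)[%classic (EFin \o h) by exact: integrableS ih.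
    rewrite (_ : EFin \o (fun x => h x - k) = ((EFin \o h) \- (EFin \o cst k))%E); last by apply/funext => x.
    exact: integrableB.
  - move=> r1 n r1s; have qr' : 0 < (ratr q : R) < r by rewrite q0.
    have := H q s r1 n qr' r1s sr; rewrite /mean_zero_bump.
    pose m1 := bump (ratr r1 : R) (ratr s) n; pose c1 := fine (\int[leb1 R]_t (m1 t)%:E)%E.
    rewrite -/m1 -/m2 -/c1 -/c2 => e.
    have i1 := hm (ratr r1) (ratr s) n; have i2 := hm 0 (ratr q) 1%N.
    have f1 := integrable_fin_num measurableT i1; have f2 := integrable_fin_num measurableT i2.
    have ib1 : (leb1 R).-integrable setT (EFin \o m1) by exact: bump_integrable.
    have fb1 := integrable_fin_num measurableT ib1.
    have Z1 := integrableZl measurableT c2 i1; have Z2 := integrableZl measurableT c1 i2.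
    have Zk := integrableZl measurableT k ib1.
    have e' : c2 * fine (\int[leb1 R]_x (h x * m1 x)%:E)%E - c1 * fine (\int[leb1 R]_x (h x * m2 x)%:E)%E = 0.
      apply: EFin_inj; rewrite -[RHS]e EFinB EFinM [X in (_ - X)%E]EFinM (fineK f1) (fineK f2).
      rewrite -(integralZl measurableT i1) -(integralZl measurableT i2).
      rewrite -(integralB measurableT Z1 Z2); apply: eq_integral => x _.
      by rewrite -!EFinM -EFinB -/m1 -/m2; congr (_%:E); ring.
    transitivity (\int[leb1 R]_x (h x * m1 x)%:E - \int[leb1 R]_x (k%:E * (m1 x)%:E))%E.
      rewrite -integralB//; apply: eq_integral => x _; rewrite -EFinM -EFinB -/m1; congr (_%:E); ring.
    rewrite integralZl// -(fineK f1) -(fineK fb1) -EFinM -EFinB; congr (_%:E).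
    rewrite -/c1 /k; apply/eqP; rewrite subr_eq0; apply/eqP.
    have c2n : c2 != 0 by rewrite gt_eqF.
    move/eqP: e'; rewrite subr_eq0 => /eqP e'.
    apply: (mulfI c2n); rewrite e'; by field; exact: c2n.
have all : {ae leb1 R, forall x, forall n : nat, forall s : rat, unpickle n = Some s ->
    0 < (ratr s : R) < r -> 0 < x < ratr s -> h x - k = 0}.
  apply: ae_foralln => n; case: (unpickle n) => [s|]; last exact: aeW.
  have [sr|nsr] := boolP (0 < (ratr s : R) < r); last by apply: aeW => x _ [<-]; rewrite (negbTE nsr).
  by apply: (@filterS _ _ (ae_filter_ringOfSetsType (leb1 R))) (key s sr) => x Hx _ [<-] _.
apply: (@filterS _ _ (ae_filter_ringOfSetsType (leb1 R))) all => x Hx /andP[x0 xr].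
have /rat_in_itvoo[s] := xr; rewrite in_itv/= => /andP[xs sr].
apply/eqP; rewrite -subr_eq0; apply/eqP.
apply: (Hx (pickle s) s (pickleK _)); first by rewrite (lt_trans x0 xs).
by rewrite x0.
Qed.

Lemma mean_zero_bumpP (q s r1 : R) n : 0 <= r1 ->
  [/\ continuous (mean_zero_bump q s r1 n),
      (leb1 R).-integrable setT (EFin \o mean_zero_bump q s r1 n),
      exists C, forall x, `|mean_zero_bump q s r1 n x| <= C,
      forall x, ~~ (0 < x < Num.max q s) -> mean_zero_bump q s r1 n x = 0 &
      (\int[leb1 R]_x (mean_zero_bump q s r1 n x)%:E = 0)%E].
Proof.
move=> r10; rewrite /mean_zero_bump.
pose m1 := bump r1 s n; pose m2 := bump (0 : R) q 1.
have ib1 : (leb1 R).-integrable setT (EFin \o m1) by exact: bump_integrable.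
have ib2 : (leb1 R).-integrable setT (EFin \o m2) by exact: bump_integrable.
have f1 := integrable_fin_num measurableT ib1; have f2 := integrable_fin_num measurableT ib2.
set c2 := fine (\int[leb1 R]_t (m2 t)%:E)%E; set c1 := fine (\int[leb1 R]_t (m1 t)%:E)%E.
have Z1 := integrableZl measurableT c2 ib1; have Z2 := integrableZl measurableT c1 ib2.
split.
- move=> x; apply: cvgB.
    by apply: cvgM; [exact: cvg_cst|exact: continuous_bump].
  by apply: cvgM; [exact: cvg_cst|exact: continuous_bump].
- rewrite (_ : EFin \o _ = ((fun x => c2%:E * (m1 x)%:E) \- (fun x => c1%:E * (m2 x)%:E))%E); last by apply/funext => x.
  exact: integrableB.
- exists (`|c2| + `|c1|) => x; apply: (le_trans (ler_normB _ _)).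
  by apply: lerD; rewrite normrM -[leRHS]mulr1 ler_wpM2l// ger0_norm ?bump_ge0// bump_le1.
- move=> x; rewrite negb_and -!leNgt => /orP h; rewrite !bump_out ?mulr0 ?subr0//; rewrite negb_and -!leNgt.
    by case: h => [->//|]; rewrite ge_max => /andP[-> _]; rewrite orbT.
  by case: h => [x0|]; [rewrite (le_trans x0)|rewrite ge_max => /andP[_ ->]; rewrite orbT].
transitivity (\int[leb1 R]_x (c2%:E * (m1 x)%:E) - \int[leb1 R]_x (c1%:E * (m2 x)%:E))%E.
  by rewrite -(integralB measurableT Z1 Z2); apply: eq_integral => x _.
rewrite (integralZl measurableT ib1) (integralZl measurableT ib2) -(fineK f1) -(fineK f2).
by rewrite -!EFinM -EFinB mulrC subrr.
Qed.

(** By [primitive_tail] the hypothesis makes [f - tail j] orthogonal to mean-zero tests, hence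
    constant on []0, r[]. The constant disappears against [M], which has mean zero; so does the
    total integral of [j] when [tail j] is rewritten as that total minus [primitive j], and
    [primitive_tail] applies once more. *)
Lemma integral_mean_zero_dual (f M j : R -> R) (r : R) : 0 < r ->
  (leb1 R).-integrable setT (EFin \o f) -> (leb1 R).-integrable setT (EFin \o M) ->
  (leb1 R).-integrable setT (EFin \o j) ->
  (forall x, ~~ (0 < x < r) -> M x = 0) -> (\int[leb1 R]_x (M x)%:E = 0)%E ->
  (forall (q s r1 : rat) n, 0 < (ratr q : R) < r -> 0 < (ratr r1 : R) < ratr s -> (ratr s : R) < r ->
    (\int[leb1 R]_x (mean_zero_bump (ratr q) (ratr s) (ratr r1) n x * f x)%:E =
     \int[leb1 R]_x (primitive (mean_zero_bump (ratr q) (ratr s) (ratr r1) n) x * j x)%:E)%E) ->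
  (\int[leb1 R]_x (f x * M x)%:E = - \int[leb1 R]_x (j x * tail M x)%:E)%E.
Proof.
move=> r0 iF iM ij Mout M0 H.
pose D := fine (\int[leb1 R]_t (`|j t|)%:E)%E.
have [mpj mtj ejM] := primitive_tail ij iM.
have mtail : measurable_fun setT (tail j) by have [_ ? _] := primitive_tail ij ij.
have tb x : `|tail j x| <= D by exact: Rintegral_le_norm.
have pb x : `|primitive j x| <= D by exact: Rintegral_le_norm.
pose I (x : R) : R := if 0 < x < r then 1 else 0.
have IE x : I x = if 0 < x < r then 1 else 0 by [].
have iI : (leb1 R).-integrable setT (EFin \o I).
  have ic : (leb1 R).-integrable `]0, r[%classic (EFin \o cst (1 : R)).
    apply: measurable_bounded_integrable => //.
    + by rewrite [X in (X < _)%E]lebesgue_measure_itv/=; case: ifP => // _; rewrite -EFinB ltry.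
    + by exists 1; split => // B kB x _ /=; rewrite normr1; exact: ltW.
  rewrite (_ : EFin \o I = (EFin \o cst (1 : R)) \_ `]0, r[); first exact/(integrable_mkcond _ _).1.
  by apply/funext => x; rewrite patchE mem_setE in_itv/= /I; case: ifP.
have itI : (leb1 R).-integrable setT (fun x => (tail j x * I x)%:E).
  exact: (@integrable_bounded_mul _ (measurableTypeR R) R (leb1 R) _ _ D mtail tb iI).
pose h x := f x - tail j x * I x.
have ih : (leb1 R).-integrable setT (EFin \o h).
  rewrite (_ : EFin \o h = ((EFin \o f) \- (fun x => (tail j x * I x)%:E))%E); last by apply/funext => x.
  exact: integrableB.
have [k hk] : exists k, {ae leb1 R, forall x, 0 < x < r -> h x = k}.
  apply: (ae_constant_of_mean_zero r0 ih) => q s r1 n qr r1s sr.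
  have r10 : 0 <= (ratr r1 : R) by case/andP: r1s => /ltW.
  have [cp ip [C pC] pout p0] := @mean_zero_bumpP (ratr q) (ratr s) (ratr r1) n r10.
  have := H q s r1 n qr r1s sr.
  set p := mean_zero_bump _ _ _ _ in cp ip pC pout p0 *.
  have [_ _ ->] := primitive_tail ip ij => e.
  have mp : measurable_fun setT p by exact: continuous_measurable_fun.
  have i1 := @integrable_bounded_mul _ (measurableTypeR R) R (leb1 R) _ _ C mp pC iF.
  have i2 := @integrable_bounded_mul _ (measurableTypeR R) R (leb1 R) _ _ C mp pC itI.
  transitivity (\int[leb1 R]_x (p x * f x)%:E - \int[leb1 R]_x (p x * (tail j x * I x))%:E)%E.
    by rewrite -(integralB measurableT i1 i2); apply: eq_integral => x _; rewrite -EFinB; congr (_%:E); transitivity (h x * p x); [by []|rewrite /h; ring].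
  have -> : (\int[leb1 R]_x (p x * (tail j x * I x))%:E = \int[leb1 R]_x (p x * f x)%:E)%E.
    rewrite e; apply: eq_integral => x _; congr (_%:E); rewrite IE; case: ifPn => xr; first by rewrite mulr1.
    rewrite pout ?mul0r//; apply: contra xr => /andP[-> /=]; rewrite lt_max.
    by case/andP: qr => _ qr /orP[h'|h']; apply: lt_trans h' _.
  by rewrite subee//; exact: integrable_fin_num i1.
have iMb (u : R -> R) B : measurable_fun setT u -> (forall x, `|u x| <= B) ->
    (leb1 R).-integrable setT (fun x => (u x * M x)%:E).
  by move=> mu uB; exact: (@integrable_bounded_mul _ (measurableTypeR R) R (leb1 R) _ _ B mu uB iM).
have itp x : tail j x = fine (\int[leb1 R]_t (j t)%:E)%E - primitive j x.
  have iD (i : interval R) : (leb1 R).-integrable [set` i] (EFin \o j) by exact: integrableS ij.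
  have e : (\int[leb1 R]_t (j t)%:E = \int[leb1 R]_(t in `]-oo, x]) (j t)%:E + \int[leb1 R]_(t in `]x, +oo[) (j t)%:E)%E.
    rewrite -integral_setU//=.
    - by congr integral; rewrite -itv_bndbnd_setU// set_itvE.
    - rewrite -itv_bndbnd_setU// set_itvE; exact: measurable_int ij.
    - by apply/disj_setPS => t [] /=; rewrite !in_itv/= andbT => h1 h2; move: (le_lt_trans h1 h2); rewrite ltxx.
  rewrite integral_itv_obnd_cbnd in e; last exact: measurable_int (iD _).
  rewrite e fineD; [|exact: integrable_fin_num (iD _)|exact: integrable_fin_num (iD _)].
  by rewrite /tail /primitive /Rintegral; ring.
pose c := fine (\int[leb1 R]_t (j t)%:E)%E + k.
have i1 := integrableZl measurableT c iM; have i2 := iMb _ _ mpj pb.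
transitivity (\int[leb1 R]_x (c%:E * (M x)%:E - (primitive j x * M x)%:E))%E.
  have FF := ae_filter_ringOfSetsType (leb1 R).
  have mf : measurable_fun setT f by apply/measurable_EFinP; exact: measurable_int iF.
  have mM : measurable_fun setT M by apply/measurable_EFinP; exact: measurable_int iM.
  apply: (@ae_eq_integral _ (measurableTypeR R) R (leb1 R)).
  - exact: measurableT.
  - by apply/measurable_EFinP; exact: measurable_funM.
  - exact: (measurable_int _ (integrableB measurableT i1 i2)).
  apply: (@filterS _ _ FF _ _ _ hk) => x hx _ /=.
  rewrite -EFinM -EFinB; congr (_%:E); have [xr|/Mout->] := boolP (0 < x < r); last by rewrite !mulr0 subr0.
  have := hx xr; rewrite /h IE xr mulr1 itp /c => e.
  by rewrite (_ : f x = fine (\int[leb1 R]_t (j t)%:E) - primitive j x + k); [ring|rewrite -e; ring].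
rewrite (integralB measurableT i1 i2) (integralZl measurableT iM) M0 mule0 sub0e ejM.
by [].
Qed.

End dubois_reymond.

Lemma norm_sub_le_squares (R : realType) (b d : R) : `|2 * (b - d)| <= 4 + 2 * (b ^+ 2 + d ^+ 2).
Proof.
have := sqr_ge0 (b - 1); have := sqr_ge0 (b + 1); have := sqr_ge0 (d - 1); have := sqr_ge0 (d + 1).
by rewrite ler_norml => *; apply/andP; split; nra.
Qed.

(** * The linearized operator *)

Section linearized.
Context {R : realType} (a : ansatz R) (beta : R * R -> R) (U0 F : R -> R) (R0 : R).
Context (R0_ge0 : 0 <= R0) (Ha : ansatz_ok a) (Hbeta_ge0 : forall v, 0 <= beta v) (Hbeta_cont : continuous beta)
  (dU : forall x : R, is_derive x 1 U0 (F x)) (cF : continuous F)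
  (U_le : forall x x', `|x| <= `|x'| -> U0 x <= U0 x').
Let E0 := U0 R0.
Let Om := Omega0 a E0 U0 beta.
Let w := phi' a E0 U0 beta.
Let T : measurableType _ := (measurableTypeR R * measurableTypeR R)%type.
Let Y : measurableType _ := (measurableTypeR R * T)%type.
Let X : measurableType _ := (measurableTypeR R * Y)%type.

Definition invariants (z : phase R) : R * (R * R) := (energy U0 z, z.2.2).

(** Since [0^-1 = 0], this function vanishes off [invariant_range], so weighted integrands are zero
    outside the support by themselves. *)
Definition inv_weight (y : R * (R * R)) : R := `|alpha' a E0 y.1 * beta y.2|^-1.

(** Energies below the minimum [U0 0] belong to it although no point of phase space has them; lifted
    functions vanish there. *)
Definition invariant_range : set (R * (R * R)) := [set y | y.1 < E0 /\ 0 < beta y.2].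

Let A := inv_weight.
Let O := invariant_range.

Lemma potential_even x : U0 (- x) = U0 x.
Proof. by apply: le_anti; rewrite !U_le ?normrN. Qed.

Lemma continuous_U : continuous U0.
Proof. exact: derive_continuous dU. Qed.

Lemma measurable_U : measurable_fun setT U0.
Proof. by apply: continuous_measurable_fun; exact: continuous_U. Qed.

Lemma Omega0P z : Om z <-> O (invariants z).
Proof.
rewrite /Om /Omega0 /f0 /O /invariant_range /=; split.
  move=> h; have b0 : 0 < beta z.2.2.
    by rewrite lt_neqAle Hbeta_ge0 andbT; apply: contraTneq h => <-; rewrite mulr0 ltxx.
  by split => //; rewrite -(alpha_gt0 a) -(pmulr_lgt0 _ b0).
by move=> [h1 h2]; rewrite mulr_gt0// alpha_gt0.
Qed.

Lemma phi'_invariants z : `|w z|^-1 = A (invariants z).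
Proof. by []. Qed.

Lemma inv_weight_ge0 y : 0 <= A y.
Proof. by rewrite invr_ge0. Qed.

Lemma inv_weight_out y : ~ O y -> A y = 0.
Proof.
move=> nO; rewrite /A /inv_weight.
have [h|h] := ltP y.1 E0; last by rewrite alpha'_out// mul0r normr0 invr0.
have [b0|b0] := ltP 0 (beta y.2); first by case: nO.
have -> : beta y.2 = 0 by apply: le_anti; rewrite b0 Hbeta_ge0.
by rewrite mulr0 normr0 invr0.
Qed.

Lemma inv_weight_gt0 y : O y -> 0 < A y.
Proof.
move=> [h1 h2]; rewrite invr_gt0 normr_gt0; apply: mulf_neq0; last by rewrite gt_eqF.
by rewrite lt_eqF// (alpha'_lt0 Ha).
Qed.

Lemma open_invariant_range : open O.
Proof.
have -> : O = [set y | y.1 < E0] `&` [set y | 0 < beta y.2] by [].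
apply: openI.
  apply: (@open_comp _ _ (fun y : R * (R * R) => y.1) [set t | t < E0]).
    by move=> y _; exact: cvg_fst.
  exact: open_lt.
apply: (@open_comp _ _ (fun y : R * (R * R) => beta y.2) [set t | 0 < t]).
  move=> y _; apply: (continuous_comp (f := snd)); first exact: cvg_snd.
  exact: Hbeta_cont.
exact: open_gt.
Qed.

Lemma measurable_inv_weight : measurable_fun setT (A : Y -> R).
Proof.
apply: measurableT_comp; first exact: measurable_invr.
apply: measurableT_comp => //; apply: measurable_funM.
  by apply: measurableT_comp; [exact: measurable_alpha'|exact: measurable_fst].
apply: measurableT_comp; last exact: measurable_snd.
exact: continuous_measurable_plane.
Qed.

Lemma measurable_energy : measurable_fun setT (energy U0 : X -> R).
Proof.
have m1 : measurable_fun [set: X] (fun z : X => z.2.1).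
  by apply: (measurableT_comp measurable_fst); exact: measurable_snd.
apply: measurable_funD.
  by apply: measurable_funM => //; exact: measurable_funX.
by apply: (measurableT_comp measurable_U); exact: measurable_fst.
Qed.

Lemma measurable_invariants : measurable_fun setT (invariants : X -> Y).
Proof.
apply: measurable_fun_pair; first exact: measurable_energy.
by apply: (measurableT_comp measurable_snd); exact: measurable_snd.
Qed.

Lemma measurable_weight : measurable_fun setT (fun z : X => A (invariants z)).
Proof. exact: (measurableT_comp measurable_inv_weight measurable_invariants). Qed.

Lemma measurable_invariant_range : measurable (O : set Y).
Proof.
have -> : O = (fun y : Y => y.1) @^-1` [set` `]-oo, E0[] `&` (fun y : Y => beta y.2) @^-1` [set` `]0, +oo[].
  by apply/seteqP; split => y /=; rewrite !in_itv/= andbT.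
apply: measurableI; rewrite -[X in measurable X]setTI.
  exact: (@measurable_fst _ _ (measurableTypeR R) T).
have mb : measurable_fun setT (fun y : Y => beta y.2).
  by apply: measurableT_comp; [exact: continuous_measurable_plane|exact: measurable_snd].
exact: mb.
Qed.

Lemma measurable_Omega0 : measurable (Om : set X).
Proof.
have -> : Om = (invariants : X -> Y) @^-1` O by apply/seteqP; split => z /Omega0P.
rewrite -[X in measurable X]setTI.
exact: (measurable_invariants measurableT measurable_invariant_range).
Qed.

Lemma continuous_invariants : continuous invariants.
Proof.
move=> z; have h1 := @continuous_energy _ _ _ dU z.
have h2 : {for z, continuous (fun z : phase R => z.2.2)}.
  by apply: (continuous_comp (f := snd) (g := snd)); exact: cvg_snd.
exact: (cvg_pair h1 h2).
Qed.

Let box (a0 b0 a1 b1 a2 b2 : R) : set (R * (R * R)) :=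
  `[a0, b0] `*` (`[a1, b1] `*` `[a2, b2]).

Lemma compact_box a0 b0 a1 b1 a2 b2 : compact (box a0 b0 a1 b1 a2 b2).
Proof. by apply: compact_setX; [|apply: compact_setX]; exact: segment_compact. Qed.

(** An energy at most [b0 < E0] confines the position to the support and bounds the velocity. The
    preimage consists of entire orbits, turning points included, so bumps in the invariants are
    compactly supported although they are constant along orbits. *)
Lemma compact_invariant_box a0 b0 a1 b1 a2 b2 : b0 < E0 ->
  compact (invariants @^-1` box a0 b0 a1 b1 a2 b2).
Proof.
move=> bE.
(* Chosen so that [V^2 > 2 (b0 - U0 0)], which bounds [v1^2] on these orbits. *)
pose V := 1 + 2 * `|b0 - U0 0|.
pose K : set (phase R) := `[- R0, R0] `*` (`[- V, V] `*` (`[a1, b1] `*` `[a2, b2])).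
have cK : compact K.
  apply: compact_setX; first exact: segment_compact.
  apply: compact_setX; first exact: segment_compact.
  by apply: compact_setX; exact: segment_compact.
apply: (subclosed_compact _ cK).
  apply: closed_comp; first by move=> z _; exact: continuous_invariants.
  by apply: compact_closed; [exact: norm_hausdorff|exact: compact_box].
move=> [x [v [s t]]] [/= hE [hs ht]]; move: hE; rewrite in_itv/= /energy/= => /andP[_ hE].
have v2 : 0 <= v ^+ 2 by exact: sqr_ge0.
split => /=; [|split => //=]; rewrite in_itv/= -ler_norml.
  rewrite leNgt; apply/negP => Rx.
  have : U0 R0 <= U0 x.
    by apply: U_le; rewrite (ger0_norm R0_ge0) ltW.
  by rewrite -/E0; lra.
rewrite leNgt; apply/negP => Vv.
have U0x : U0 0 <= U0 x by apply: U_le; rewrite normr0.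
have b0' : b0 - U0 0 <= `|b0 - U0 0| by exact: ler_norm.
have : V ^+ 2 < `|v| ^+ 2 by rewrite ltr_pXn2r// nnegrE addr_ge0// mulr_ge0.
rewrite real_normK ?num_real// /V.
have : 0 <= `|b0 - U0 0| by [].
nra.
Qed.

Lemma continuous_inv_weight y : O y -> {for y, continuous A}.
Proof.
move=> Oy; have := inv_weight_gt0 Oy; case: Oy => h1 h2.
rewrite invr_gt0 => A0.
apply: cvgV; first exact: lt0r_neq0.
apply: cvg_norm; apply: cvgM.
  apply: (continuous_comp (f := fst)); first exact: cvg_fst.
  exact: continuous_alpha'.
apply: (continuous_comp (f := snd)); first exact: cvg_snd.
exact: Hbeta_cont.
Qed.

Lemma compact_bound (T' : topologicalType) (K : set T') (f : T' -> R) : compact K ->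
  (forall z, K z -> {for z, continuous f}) -> exists2 C, 0 < C & forall z, K z -> `|f z| <= C.
Proof.
move=> cK cf; have /compact_bounded[M [Mr HM]] : compact (f @` K).
  apply: continuous_compact => //; apply: continuous_in_subspaceT => z.
  by rewrite inE; exact: cf.
exists (Num.max 1 (M + 1)); first by rewrite lt_max ltr01.
move=> z Kz; apply: (@le_trans _ _ (M + 1)); last by rewrite le_max lexx orbT.
by apply: (HM (M + 1)); [rewrite ltrDl|exists z].
Qed.

(* Density, with respect to [dx dE dvbar] on [x > 0], of the image of [f dx dv]
   under [(x, v) |-> (|x|, E, vbar)]: the sum of [f] over the four points above
   [(x, E, vbar)], times [dv1 / dE = 1 / |v1|]. *)
Definition lift := fun (f : phase R -> R) (z : R * (R * (R * R))) =>
  jac U0 z * fold f (orbit U0 z).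

Lemma lift_invariants (p : R * (R * R) -> R) f z :
  lift (fun z => p (invariants z) * f z) z = p z.2 * lift f z.
Proof.
rewrite /lift /jac; case: ifPn => [/andP[x0 xE]|_]; last by rewrite !mul0r mulr0.
rewrite mulrCA; congr (_ * _); rewrite /fold /orbit /invariants /energy/= sqrrN potential_even.
rewrite sqr_sqrtr; last by rewrite mulr_ge0// subr_ge0 ltW.
have -> : (2 * (z.2.1 - U0 z.1) / 2 + U0 z.1) = z.2.1 by field.
by case: z x0 xE => x [E t] _ _ /=; ring.
Qed.

(** [eps] is the parity of [c]: constantly 1 for an even factor, the sign for an odd one. It remains
    under the lift because the fold mixes [x] and [-x]. *)
Lemma lift_parity (c eps : R -> R) f z : (forall x, 0 < x -> eps x = 1) ->
  (forall x, 0 < x -> c (- x) = eps (- x) * c x) ->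
  lift (fun z => c z.1 * f z) z = c z.1 * lift (fun z => eps z.1 * f z) z.
Proof.
move=> e1 e2; rewrite /lift /jac; case: ifPn => [/andP[x0 _]|_]; last by rewrite !mul0r mulr0.
by rewrite [RHS]mulrCA; congr (_ * _); rewrite /fold /orbit/= (e2 _ x0) (e1 _ x0); ring.
Qed.

Lemma liftD f g z : lift (fun z => f z + g z) z = lift f z + lift g z.
Proof. by rewrite /lift -mulrDr /fold; congr (_ * _); ring. Qed.

Lemma lift_out f z : ~~ ((0 < z.1) && (U0 z.1 < z.2.1)) -> lift f z = 0.
Proof. by rewrite /lift /jac => /negbTE ->; rewrite mul0r. Qed.

Lemma measurable_lift (f : X -> R) : measurable_fun setT f -> measurable_fun setT (lift f : X -> R).
Proof. exact: (measurable_orbit_fold measurable_U). Qed.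

Lemma integral_lift (f : X -> R) : (lam4 R).-integrable setT (EFin \o f) ->
  (lam4 R).-integrable setT (EFin \o lift f) /\
  (\int[lam4 R]_z (f z)%:E = \int[lam4 R]_z (lift f z)%:E)%E.
Proof. exact: (integral_orbit measurable_U). Qed.

Lemma ge0_integral_lift (f : X -> R) : measurable_fun setT f -> (forall z, 0 <= f z) ->
  (\int[lam4 R]_z (f z)%:E = \int[lam4 R]_z (lift f z)%:E)%E.
Proof. exact: (ge0_integral_orbit (lam2 R) measurable_U). Qed.

Definition ext (g : phase R -> R) : phase R -> R := g \_ Om.

Lemma measurable_ext (g : X -> R) : measurable_fun Om g -> measurable_fun setT (ext g : X -> R).
Proof. by move=> mg; apply/(measurable_restrictT _ _).1 => //; exact: measurable_Omega0. Qed.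

Lemma box_bound a0 b0 a1 b1 a2 b2 : box a0 b0 a1 b1 a2 b2 `<=` O ->
  exists2 C, 0 < C & forall y, box a0 b0 a1 b1 a2 b2 y -> A y <= C.
Proof.
move=> BO; have [C C0 H] := compact_bound (compact_box (a0 := a0) (b0 := b0) (a1 := a1) (b1 := b1)
  (a2 := a2) (b2 := b2)) (fun y By => continuous_inv_weight (BO y By)).
by exists C => // y By; rewrite -[A y]ger0_norm ?inv_weight_ge0// H.
Qed.

Lemma box_lt a0 b0 a1 b1 a2 b2 : a0 < b0 -> a1 < b1 -> a2 < b2 ->
  box a0 b0 a1 b1 a2 b2 `<=` O -> b0 < E0.
Proof.
move=> h0 h1 h2 /(_ (b0, (a1, a2))) [] //.
by split => /=; [|split => /=]; rewrite in_itv/= lexx ?ltW.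
Qed.

Lemma box_Omega0 a0 b0 a1 b1 a2 b2 : box a0 b0 a1 b1 a2 b2 `<=` O ->
  invariants @^-1` box a0 b0 a1 b1 a2 b2 `<=` Om.
Proof. by move=> BO z /BO Oz; apply/Omega0P. Qed.

Lemma locint_integrable (g h : X -> R) C a0 b0 a1 b1 a2 b2 :
  a0 < b0 -> a1 < b1 -> a2 < b2 -> box a0 b0 a1 b1 a2 b2 `<=` O ->
  locint Om g -> measurable_fun setT h -> (forall z, `|h z| <= C) ->
  (forall z, h z != 0 -> box a0 b0 a1 b1 a2 b2 (invariants z)) ->
  (lam4 R).-integrable setT (EFin \o (fun z => h z * ext g z)).
Proof.
move=> h0 h1 h2 BO lg mh hC hB.
pose K : set X := invariants @^-1` box a0 b0 a1 b1 a2 b2.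
have cK : compact (K : set (phase R)).
  by apply: compact_invariant_box; exact: (box_lt h0 h1 h2 BO).
have mK : measurable (K : set X).
  rewrite -[X in measurable X]setTI; apply: (measurable_invariants measurableT).
  by apply: measurableX => //; exact: measurableX.
have iK : (lam4 R).-integrable (K : set X) (EFin \o g) := lg K cK (box_Omega0 BO).
have iK' := (integrable_mkcond (EFin \o g) mK).1 iK.
have bh : [bounded h z | z in setT].
  by exists C; split; [exact: num_real|move=> M CM z _ /=; rewrite (le_trans (hC z))// ltW].
have := integrableMr measurableT mh bh iK'.
apply: eq_integrable => // z _ /=; rewrite restrict_EFin/= -EFinM; congr (_%:E).
have [->|/hB Kz] := eqVneq (h z) 0; first by rewrite !mul0r.
have Oz : Om z by exact: box_Omega0 BO _ Kz.
by rewrite /ext !patchE !mem_set.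
Qed.

Lemma velocity_bound a0 b0 a1 b1 a2 b2 : b0 < E0 ->
  exists2 C, 0 < C & forall z, box a0 b0 a1 b1 a2 b2 (invariants z) -> `|z.2.1| <= C.
Proof.
move=> bE; apply: (@compact_bound _ _ (fun z : phase R => z.2.1) (compact_invariant_box bE)) => z _.
by apply: (continuous_comp (f := snd) (g := fst)); [exact: cvg_snd|exact: cvg_fst].
Qed.

Lemma box_lift_integrable (g s : X -> R) a0 b0 a1 b1 a2 b2 :
  a0 < b0 -> a1 < b1 -> a2 < b2 -> box a0 b0 a1 b1 a2 b2 `<=` O ->
  locint Om g -> measurable_fun setT s -> (forall z, `|s z| <= Num.max 1 `|z.2.1|) ->
  (lam4 R).-integrable setT
    (EFin \o (fun z => \1_(box a0 b0 a1 b1 a2 b2) z.2 * (A z.2 * lift (fun z => s z * ext g z) z))).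
Proof.
move=> h0 h1 h2 BO lg ms s1.
have [C C0 HC] := box_bound BO.
have [V V0 HV] := velocity_bound a0 a1 b1 a2 b2 (box_lt h0 h1 h2 BO).
pose p (y : Y) : R := \1_(box a0 b0 a1 b1 a2 b2 : set Y) y * A y.
have mp : measurable_fun setT p.
  apply: measurable_funM; last exact: measurable_inv_weight.
  by apply: measurable_indic; apply: measurableX => //; exact: measurableX.
have p0 y : ~ box a0 b0 a1 b1 a2 b2 y -> p y = 0.
  by move=> nB; rewrite /p indicE memNset// mul0r.
have mh : measurable_fun setT (fun z : X => p (invariants z) * s z).
  by apply: measurable_funM => //; apply: (measurableT_comp mp); exact: measurable_invariants.
have := locint_integrable (h := fun z => p (invariants z) * s z) (C := C * Num.max 1 V) h0 h1 h2 BO lg mh _ _.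
move=> /(_ _ _)/integral_lift [].
- move=> z; have [Bz|/p0 ->] := pselect (box a0 b0 a1 b1 a2 b2 (invariants z)); last first.
    by rewrite mul0r normr0 mulr_ge0 ?(ltW C0)// le_max ler01.
  rewrite normrM ler_pM//.
    rewrite /p indicE mem_set// mul1r ger0_norm ?inv_weight_ge0//; exact: HC.
  by rewrite (le_trans (s1 z))// ge_max !le_max lexx/= HV ?orbT.
- by move=> z; apply: contraNP => /p0 ->; rewrite mul0r.
move=> + _; apply: eq_integrable => // z _ /=.
congr (_%:E); rewrite [RHS]mulrA -[RHS](lift_invariants p (fun z => s z * ext g z)).
by congr (lift _ _); apply/funext => z'; rewrite mulrA.
Qed.

(* [s] is a C^1 substitute for the sign-like function [tau], with which it agrees
   wherever the test function does not vanish; [e1] and [e2] record the parities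
   of [th] and [th']. *)
Lemma weak_orbit (g mu : phase R -> R) (th th' s s' tau e1 e2 : R -> R) (C : R)
    a0 b0 a1 b1 a2 b2 (c0 c1 c2 : R) n0 n1 n2 :
  measurable_fun (Om : set X) g -> measurable_fun (Om : set X) mu -> weakD Om w U0 g mu ->
  (forall x : R, is_derive x 1 th (th' x)) -> (forall x : R, is_derive x 1 s (s' x)) ->
  continuous th' -> continuous s' ->
  measurable_fun setT tau -> measurable_fun setT e1 -> measurable_fun setT e2 ->
  (forall v, `|tau v| <= 1) ->
  (forall x, 0 < x -> e1 x = 1) -> (forall x, 0 < x -> e2 x = 1) ->
  (forall x, 0 < x -> th (- x) = e1 (- x) * th x) ->
  (forall x, 0 < x -> th' (- x) = e2 (- x) * th' x) ->
  (forall x, `|th x| <= C) -> (forall x, `|th' x| <= C) ->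
  a0 < b0 -> a1 < b1 -> a2 < b2 -> box a0 b0 a1 b1 a2 b2 `<=` O ->
  a0 < c0 -> a1 < c1 -> a2 < c2 ->
  (forall z, box a0 b0 a1 b1 a2 b2 (invariants z) ->
    [/\ th z.1 * s z.2.1 = th z.1 * tau z.2.1, th' z.1 * s z.2.1 = th' z.1 * tau z.2.1 &
        th z.1 * s' z.2.1 = 0]) ->
  (\int[lam4 R]_z (bump3 c0 b0 c1 b1 c2 b2 n0 n1 n2 z.2 *
     (A z.2 * (th' z.1 * lift (fun z => e2 z.1 * (z.2.1 * tau z.2.1) * ext g z) z +
               th z.1 * lift (fun z => e1 z.1 * tau z.2.1 * ext mu z) z)))%:E = 0)%E.
Proof.
move=> mg mmu [lg [lmu weak]] dth ds cth' cs' mtau me1 me2 tau1 e1p e2p par1 par2 thC th'C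
  h0 h1 h2 BO ac0 ac1 ac2 loc.
pose xi := tens U0 th s (bump c0 b0 n0) (bump c1 b1 n1) (bump c2 b2 n2).
pose b3 := bump3 c0 b0 c1 b1 c2 b2 n0 n1 n2.
have tE (f h : R -> R) z : tens U0 f h (bump c0 b0 n0) (bump c1 b1 n1) (bump c2 b2 n2) z =
    f z.1 * h z.2.1 * b3 (invariants z).
  by apply: esym; exact: mulrA.
have xiE z : xi z = th z.1 * s z.2.1 * b3 (invariants z) by exact: tE.
have b3B y : b3 y != 0 -> box a0 b0 a1 b1 a2 b2 y by exact: bump3_neq0.
have bE := box_lt h0 h1 h2 BO.
have C1xi : C1c Om xi.
  apply: (C1c_tens dU cF dth ds (is_derive_bump c0 b0 n0) (is_derive_bump c1 b1 n1)
    (is_derive_bump c2 b2 n2) cth' cs' (@continuous_dbump _ _ _ _) (@continuous_dbump _ _ _ _)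
    (@continuous_dbump _ _ _ _) (compact_invariant_box (a0 := a0) (a1 := a1) (b1 := b1) (a2 := a2) (b2 := b2) bE)
    (box_Omega0 BO)) => z.
  rewrite -/xi xiE => nz; apply: b3B; apply: contraNneq nz => ->; by rewrite mulr0.
(* Only the transport of [th] survives. Where the bump is nonzero, the force term contains
   [th * s' = 0] and [s] may be read as [tau]. *)
have DE z : Dop U0 xi z = z.2.1 * (th' z.1 * tau z.2.1) * b3 (invariants z).
  rewrite (Dop_tens dU dth ds (is_derive_bump c0 b0 n0) (is_derive_bump c1 b1 n1) (is_derive_bump c2 b2 n2)).
  rewrite !tE; have [->|/b3B /loc[_ -> ->]] := eqVneq (b3 (invariants z)) 0; ring.
pose q1 z := b3 (invariants z) * A (invariants z) * (th' z.1 * (z.2.1 * tau z.2.1)) * ext g z.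
pose q2 z := b3 (invariants z) * A (invariants z) * (th z.1 * tau z.2.1) * ext mu z.
have mx : measurable_fun setT (fun z : X => z.1) by exact: measurable_fst.
have mv : measurable_fun setT (fun z : X => z.2.1).
  by apply: (measurableT_comp measurable_fst); exact: measurable_snd.
have mth' : measurable_fun setT (fun z : X => th' z.1).
  by apply: (measurableT_comp _ mx); exact: continuous_measurable_fun.
have mth : measurable_fun setT (fun z : X => th z.1).
  by apply: (measurableT_comp _ mx); apply: continuous_measurable_fun; exact: derive_continuous dth.
have mtv : measurable_fun setT (fun z : X => tau z.2.1) by exact: (measurableT_comp mtau mv).
have mb3 : measurable_fun setT (b3 : Y -> R).
  apply: measurable_funM.
    by apply: (measurableT_comp (measurable_bump _ _ _)); exact: measurable_fst.
  apply: measurable_funM.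
    apply: (measurableT_comp (measurable_bump _ _ _)).
    by apply: (measurableT_comp measurable_fst); exact: measurable_snd.
  apply: (measurableT_comp (measurable_bump _ _ _)).
  by apply: (measurableT_comp measurable_snd); exact: measurable_snd.
have mbA : measurable_fun setT (fun z : X => b3 (invariants z) * A (invariants z)).
  apply: measurable_funM; first exact: (measurableT_comp mb3 measurable_invariants).
  exact: (measurableT_comp measurable_inv_weight measurable_invariants).
have [CA CA0 HA] := box_bound BO.
have [V V0 HV] := velocity_bound a0 a1 b1 a2 b2 bE.
have C0 : 0 <= C := le_trans (normr_ge0 _) (thC 0).
have b31 y : `|b3 y| <= 1.
  have p3 (u v x : R) : `|u| <= 1 -> `|v| <= 1 -> `|x| <= 1 -> `|u * (v * x)| <= 1.
    by move=> u1 v1 w1; rewrite !normrM mulr_ile1 ?mulr_ge0// mulr_ile1.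
  by apply: p3; rewrite ger0_norm ?bump_ge0// bump_le1.
have bA z (t : R) D : 0 <= D -> (box a0 b0 a1 b1 a2 b2 (invariants z) -> `|t| <= D) ->
    `|b3 (invariants z) * A (invariants z) * t| <= CA * D.
  move=> D0 tD; have [->|/b3B Bz] := eqVneq (b3 (invariants z)) 0.
    by rewrite !mul0r normr0 mulr_ge0// ltW.
  rewrite normrM ler_pM ?tD// normrM -[leRHS]mul1r ler_pM//.
  by rewrite ger0_norm ?inv_weight_ge0// HA.
have bn0 z (t : R) : b3 (invariants z) * A (invariants z) * t != 0 -> box a0 b0 a1 b1 a2 b2 (invariants z).
  by move=> nz; apply: b3B; apply: contraNneq nz => ->; rewrite !mul0r.
have i1 : (lam4 R).-integrable setT (EFin \o q1).
  apply: (locint_integrable (C := CA * (C * V)) h0 h1 h2 BO lg) => [||z /bn0//].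
    by apply: measurable_funM => //; apply: measurable_funM => //; exact: measurable_funM.
  move=> z; apply: bA; first by rewrite mulr_ge0// ltW.
  move=> Bz; rewrite normrM ler_pM// normrM -[leRHS]mulr1 ler_pM//; exact: HV.
have i2 : (lam4 R).-integrable setT (EFin \o q2).
  apply: (locint_integrable (C := CA * C) h0 h1 h2 BO lmu) => [||z /bn0//].
    by apply: measurable_funM => //; exact: measurable_funM.
  by move=> z; apply: bA => // Bz; rewrite normrM -[leRHS]mulr1 ler_pM.
have e12 : (\int[lam4 R]_z (q1 z + q2 z)%:E = 0)%E.
  have := weak xi C1xi.
  have -> : (\int[leb4 R]_(z in Om) ((`|w z|)^-1 * g z * Dop U0 xi z)%:E = \int[lam4 R]_z (q1 z)%:E)%E.
    transitivity (\int[lam4 R]_(z in Om) ((`|w z|)^-1 * g z * Dop U0 xi z)%:E)%E; first by [].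
    rewrite integral_mkcond; apply: eq_integral => z _; rewrite patchE /q1 /ext patchE DE.
    by case: ifP => _; rewrite ?mulr0//; congr (_%:E); rewrite phi'_invariants; ring.
  have -> : (\int[leb4 R]_(z in Om) ((`|w z|)^-1 * mu z * xi z)%:E = \int[lam4 R]_z (q2 z)%:E)%E.
    transitivity (\int[lam4 R]_(z in Om) ((`|w z|)^-1 * mu z * xi z)%:E)%E; first by [].
    rewrite integral_mkcond; apply: eq_integral => z _; rewrite patchE /q2 /ext patchE xiE.
    case: ifP => _; rewrite ?mulr0//; congr (_%:E); rewrite phi'_invariants.
    have [->|/b3B /loc[-> _ _]] := eqVneq (b3 (invariants z)) 0; ring.
  move=> e; have -> : (\int[lam4 R]_z (q1 z + q2 z)%:E = \int[lam4 R]_z (q1 z)%:E + \int[lam4 R]_z (q2 z)%:E)%E.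
    rewrite -(@integralD_EFin _ X R (lam4 R) setT measurableT q1 q2 i1 i2).
    by apply: eq_integral.
  rewrite e addeC subee//; exact: integrable_fin_num i2.
have i12 : (lam4 R).-integrable setT (EFin \o (fun z => q1 z + q2 z)).
  by have := integrableD measurableT i1 i2; apply: eq_integrable.
rewrite -[RHS]e12 (integral_lift i12).2; apply: eq_integral => z _; congr (_%:E).
rewrite liftD.
have liftE (f e : R -> R) (h : phase R -> R) : (forall x, 0 < x -> e x = 1) ->
    (forall x, 0 < x -> f (- x) = e (- x) * f x) ->
    lift (fun z => b3 (invariants z) * A (invariants z) * (f z.1 * h z)) z =
    b3 z.2 * A z.2 * (f z.1 * lift (fun z => e z.1 * h z) z).
  move=> ep par; rewrite (lift_invariants (fun y => b3 y * A y)).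
  by rewrite (lift_parity h z ep par).
have -> : lift q1 z = b3 z.2 * A z.2 * (th' z.1 * lift (fun z => e2 z.1 * (z.2.1 * tau z.2.1) * ext g z) z).
  have -> : q1 = (fun z => b3 (invariants z) * A (invariants z) * (th' z.1 * (z.2.1 * tau z.2.1 * ext g z))).
    by apply/funext => z'; rewrite /q1; ring.
  rewrite (liftE th' e2)//; congr (_ * (_ * lift _ _)).
  by apply/funext => z'; ring.
have -> : lift q2 z = b3 z.2 * A z.2 * (th z.1 * lift (fun z => e1 z.1 * tau z.2.1 * ext mu z) z).
  have -> : q2 = (fun z => b3 (invariants z) * A (invariants z) * (th z.1 * (tau z.2.1 * ext mu z))).
    by apply/funext => z'; rewrite /q2; ring.
  rewrite (liftE th e1)//; congr (_ * (_ * lift _ _)).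
  by apply/funext => z'; ring.
by rewrite /b3; ring.
Qed.

(** * Representation of g as a tail integral on almost every orbit *)

Definition odd_lift (g : phase R -> R) := lift (fun z => Num.sg z.1 * z.2.1 * ext g z).

(** Here the Jacobian [1 / |v1|] stays, whereas in [odd_lift] the factor [v1] cancels it. This
    matches [dg/dx = D g / v1]: up to a sign, [odd_lift g] is the tail of [even_lift mu]. *)
Definition even_lift (mu : phase R -> R) := lift (ext mu).

Lemma box_comb_integrable (L1 L2 : X -> R) (p1 p2 : R -> R) (C : R) a0 b0 a1 b1 a2 b2 :
  measurable_fun setT p1 -> measurable_fun setT p2 ->
  (forall x, `|p1 x| <= C) -> (forall x, `|p2 x| <= C) ->
  (lam4 R).-integrable setT
    (EFin \o (fun z => \1_(box a0 b0 a1 b1 a2 b2) z.2 * (A z.2 * L1 z))) ->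
  (lam4 R).-integrable setT
    (EFin \o (fun z => \1_(box a0 b0 a1 b1 a2 b2) z.2 * (A z.2 * L2 z))) ->
  (lam4 R).-integrable setT
    (EFin \o (fun z => \1_(box a0 b0 a1 b1 a2 b2) z.2 * (A z.2 * (p1 z.1 * L1 z + p2 z.1 * L2 z)))).
Proof.
move=> m1 m2 C1 C2 i1 i2.
have mx (p : R -> R) : measurable_fun setT p -> measurable_fun setT (fun z : X => p z.1).
  by move=> mp; apply: (measurableT_comp mp); exact: measurable_fst.
have j1 := @integrable_bounded_mul _ X R (lam4 R) (fun z => p1 z.1) _ C (mx _ m1) (fun z => C1 z.1) i1.
have j2 := @integrable_bounded_mul _ X R (lam4 R) (fun z => p2 z.1) _ C (mx _ m2) (fun z => C2 z.1) i2.
have := integrableD measurableT j1 j2; apply: eq_integrable => // z _ /=.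
by rewrite -EFinD; congr (_%:E); ring.
Qed.

Lemma inv_weight_neq0 y : O y -> A y != 0.
Proof. by move=> /inv_weight_gt0/lt0r_neq0. Qed.

(** The test functions carry no factor in [v1]; with [th] even and [th'] odd, [mu] enters through
    its even part and [g] through its odd part. Such tests are smooth across the turning points and
    need not vanish there, so they see the condition at the end of the orbit. *)
Lemma orbit_representation (g mu : phase R -> R) :
  measurable_fun (Om : set X) g -> measurable_fun (Om : set X) mu -> weakD Om w U0 g mu ->
  {ae lam3 R, forall y, O y ->
    [/\ (leb1 R).-integrable setT (fun x => (odd_lift g (x, y))%:E),
        (leb1 R).-integrable setT (fun x => (even_lift mu (x, y))%:E),
        (\int[leb1 R]_x (even_lift mu (x, y))%:E = 0)%E &
        {ae leb1 R, forall x, 0 < x < R0 ->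
          odd_lift g (x, y) = - tail (fun x => even_lift mu (x, y)) x}]}.
Proof.
move=> mg mmu wD; have [lg [lmu _]] := wD.
have FF := ae_filter_ringOfSetsType (lam3 R).
have mx : measurable_fun setT (fun z : X => z.1) by exact: measurable_fst.
have mv : measurable_fun setT (fun z : X => z.2.1).
  by apply: (measurableT_comp measurable_fst); exact: measurable_snd.
have msg := @measurable_sgr R.
have sg1 (x : R) : `|Num.sg x| <= 1 by rewrite normr_sg; case: (x != 0).
have msgv : measurable_fun setT (fun z : X => Num.sg z.1 * z.2.1).
  by apply: measurable_funM => //; exact: (measurableT_comp msg).
have mG : measurable_fun setT (odd_lift g : X -> R).
  by apply: measurable_lift; apply: measurable_funM => //; exact: measurable_ext.
have mM : measurable_fun setT (even_lift mu : X -> R).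
  by apply: measurable_lift; exact: measurable_ext.
have iG a0 b0 a1 b1 a2 b2 : a0 < b0 -> a1 < b1 -> a2 < b2 -> box a0 b0 a1 b1 a2 b2 `<=` O ->
  (lam4 R).-integrable setT
    (EFin \o (fun z => \1_(box a0 b0 a1 b1 a2 b2) z.2 * (A z.2 * odd_lift g z))).
  move=> h0 h1 h2 BO; apply: box_lift_integrable => // z.
  by rewrite normrM le_max -[X in _ || (_ <= X)]mul1r ler_pM// orbT.
have iM a0 b0 a1 b1 a2 b2 : a0 < b0 -> a1 < b1 -> a2 < b2 -> box a0 b0 a1 b1 a2 b2 `<=` O ->
  (lam4 R).-integrable setT
    (EFin \o (fun z => \1_(box a0 b0 a1 b1 a2 b2) z.2 * (A z.2 * even_lift mu z))).
  move=> h0 h1 h2 BO; have := @box_lift_integrable mu (fun=> 1) _ _ _ _ _ _ h0 h1 h2 BO lmu (measurable_cst _).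
  rewrite /even_lift (_ : (fun z => 1 * ext mu z) = ext mu); last by apply/funext => z; rewrite mul1r.
  by apply => z; rewrite normr1 le_max lexx.
have aG := ae_integrable_section open_invariant_range inv_weight_neq0 iG.
have aM := ae_integrable_section open_invariant_range inv_weight_neq0 iM.
have key (th th' : R -> R) C : (forall x : R, is_derive x 1 th (th' x)) -> continuous th' ->
   (forall x, 0 < x -> th (- x) = th x) -> (forall x, 0 < x -> th' (- x) = - th' x) ->
   (forall x, `|th x| <= C) -> (forall x, `|th' x| <= C) ->
   {ae lam3 R, forall y, O y ->
     fine (\int[leb1 R]_x (th' x * odd_lift g (x, y) + th x * even_lift mu (x, y))%:E)%E = 0}.
  move=> dth cth' even odd thC th'C.
  have mth := continuous_measurable_fun (derive_continuous dth).
  have mth' := continuous_measurable_fun cth'.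
  apply: (@ae_section_eq0 _ O open_invariant_range A measurable_inv_weight inv_weight_neq0
    (fun z => th' z.1 * odd_lift g z + th z.1 * even_lift mu z)).
  - by apply: measurable_funD; apply: measurable_funM => //; apply: (measurableT_comp _ mx).
  - move=> a0 b0 a1 b1 a2 b2 h0 h1 h2 BO.
    exact: (box_comb_integrable mth' mth th'C thC (iG _ _ _ _ _ _ h0 h1 h2 BO) (iM _ _ _ _ _ _ h0 h1 h2 BO)).
  - move=> a0 b0 a1 b1 a2 b2 h0 h1 h2 BO r0 r1 r2 n0 n1 n2 /andP[hr0 _] /andP[hr1 _] /andP[hr2 _].
    have d1 (x : R) : is_derive x 1 (cst 1 : R -> R) ((cst 0 : R -> R) x) by exact: is_derive_cst.
    have c0 : continuous (cst 0 : R -> R) by move=> ?; exact: cvg_cst.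
    have := @weak_orbit g mu th th' (cst 1) (cst 0) (cst 1) (cst 1) (@Num.sg R) C a0 b0 a1 b1 a2 b2
      (ratr r0) (ratr r1) (ratr r2) n0 n1 n2 mg mmu wD dth d1 cth' c0 (measurable_cst _) (measurable_cst _) msg.
    have -> : (fun z : phase R => Num.sg z.1 * (z.2.1 * cst 1 z.2.1) * ext g z) =
      (fun z => Num.sg z.1 * z.2.1 * ext g z) by apply/funext => z; rewrite /= mulr1.
    have -> : (fun z : phase R => cst 1 z.1 * cst 1 z.2.1 * ext mu z) = ext mu.
      by apply/funext => z; rewrite /= !mul1r.
    apply => //.
    + by move=> v; rewrite normr1.
    + by move=> x x0; rewrite gtr0_sg.
    + by move=> x x0; rewrite mul1r even.
    + by move=> x x0; rewrite odd// ltr0_sg ?mulN1r// oppr_lt0.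
    + by move=> z _; rewrite mulr0.
(* With [th = 1] the test function depends on the invariants alone: [D g] integrates to zero along a
   closed orbit. *)
have key1 : {ae lam3 R, forall y, O y -> fine (\int[leb1 R]_x (even_lift mu (x, y))%:E)%E = 0}.
  have c0 : continuous (cst 0 : R -> R) by move=> ?; exact: cvg_cst.
  have := @key (cst 1) (cst 0) 1 (fun x => is_derive_cst _ _ _) c0.
  have p1 (x : R) : 0 < x -> cst 1 (- x) = cst 1 x :> R by [].
  have p2 (x : R) : 0 < x -> cst 0 (- x) = - cst 0 x :> R by rewrite oppr0.
  have p3 (x : R) : `|cst 1 x : R| <= 1 by rewrite normr1.
  have p4 (x : R) : `|cst 0 x : R| <= 1 by rewrite normr0 ler01.
  move=> /(_ p1 p2 p3 p4).
  apply: (@filterS _ _ FF) => y + Oy => /(_ Oy) {1}<-; congr fine.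
  by apply: eq_integral => x _; rewrite /= mul0r add0r mul1r.
(* Here [th] is the primitive of a bump plus its reflection; the bump lives in [x > 0], so on that
   half the reflected terms vanish. The right end is [R0] for all orbits, so that a rational and an
   integer index all tests and one null set of orbits suffices. *)
have key2 : {ae lam3 R, forall y, forall n : nat, forall q : rat * nat, unpickle n = Some q ->
    O y -> 0 < (ratr q.1 : R) < R0 ->
   fine (\int[leb1 R]_x (bump (ratr q.1) R0 q.2 x * odd_lift g (x, y) +
     primitive (bump (ratr q.1) R0 q.2) x * even_lift mu (x, y))%:E)%E = 0}.
  apply: ae_foralln => n; case: (unpickle n) => [[r k]|]; last exact: aeW.
  have [/andP[r0 rR]|nr] := boolP (0 < (ratr r : R) < R0); last first.
    by apply: aeW => y _ [<-] _ /=; rewrite (negbTE nr).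
  pose m := bump (ratr r) R0 k : R -> R.
  pose D := fine (\int[leb1 R]_t (`|m t|)%:E)%E.
  have D0 : 0 <= D by apply: fine_ge0; apply: integral_ge0.
  have dP (x : R) : is_derive x 1 (primitive m) (m x).
    by apply: is_derive_primitive; [exact: bump_integrable|exact: continuous_bump].
  have dN (x : R) : is_derive x 1 (fun x => primitive m (- x)) (- m (- x)).
    have d : is_derive x 1 (fun x : R => - x) (-1) by apply: is_derive_eq.
    have := @is_derive1_comp R (primitive m) (fun x => - x) x _ _ (dP (- x)) d.
    by rewrite mulrN1.
  have Pb x : `|primitive m x| <= D by apply: Rintegral_le_norm => //; exact: bump_integrable.
  have mb x : `|m x| <= 1 by rewrite ger0_norm ?bump_ge0// bump_le1.
  have h1 (x : R) : is_derive x 1 (fun x => primitive m x + primitive m (- x)) (m x - m (- x)).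
    by have ? := dP x; have ? := dN x; apply: is_derive_eq.
  have h2 : continuous (fun x => m x - m (- x)).
    move=> x; apply: cvgB; first exact: continuous_bump.
    by apply: (continuous_comp (f := fun x : R => - x)); [apply: cvgN; exact: cvg_id|exact: continuous_bump].
  have h3 (x : R) : 0 < x -> primitive m (- x) + primitive m (- - x) = primitive m x + primitive m (- x).
    by rewrite opprK addrC.
  have h4 (x : R) : 0 < x -> m (- x) - m (- - x) = - (m x - m (- x)) by rewrite opprK opprB.
  have h5 (x : R) : `|primitive m x + primitive m (- x)| <= D + D + 1 + 1.
    have := ler_normD (primitive m x) (primitive m (- x)); have := Pb x; have := Pb (- x); lra.
  have h6 (x : R) : `|m x - m (- x)| <= D + D + 1 + 1.
    have := ler_normB (m x) (m (- x)); have := mb x; have := mb (- x); lra.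
  have := @key _ _ _ h1 h2 h3 h4 h5 h6.
  apply: (@filterS _ _ FF) => y Hy q [<-] Oy _ /=; rewrite -[RHS](Hy Oy); congr fine.
  apply: eq_integral => x _; congr (_%:E); have [x0|x0] := ltP 0 x; last first.
    by rewrite /odd_lift /even_lift !lift_out ?mulr0//= ltNge x0.
  have mN t : t <= 0 -> m t = 0.
    by move=> t0; rewrite /m bump_out// negb_and -leNgt (le_trans t0 (ltW r0)).
  rewrite -/m (mN (- x)) ?oppr_le0 ?(ltW x0)// subr0 (@primitive_eq0 R m (- x)) ?addr0// => t tx.
  by apply: mN; rewrite (le_trans tx)// oppr_le0 ltW.
have [R0E|R0p] := leP R0 0.
  have FG := @filterI _ _ FF _ _ (@filterI _ _ FF _ _ aG aM) key1.
  apply: (@filterS _ _ FF) FG => y [[yG yM] y1] Oy; split; [exact: yG|exact: yM| |].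
    by rewrite -[LHS]fineK ?y1//; exact: integrable_fin_num (yM Oy).
  by apply: aeW => x /andP[x0 xR]; move: (lt_le_trans (lt_trans x0 xR) R0E); rewrite ltxx.
have FG := @filterI _ _ FF _ _ (@filterI _ _ FF _ _ aG aM) (@filterI _ _ FF _ _ key1 key2).
apply: (@filterS _ _ FF) FG => y [[yG yM] [y1 y2]] Oy.
split; [exact: yG|exact: yM| |].
  by rewrite -[LHS]fineK ?y1//; exact: integrable_fin_num (yM Oy).
apply: (ae_eq_tail R0p (yG Oy) (yM Oy)) => r n rR.
have := y2 (pickle (r, n)) (r, n) (pickleK _) Oy rR => /= e.
rewrite -[LHS]fineK ?e//.
have i1 : (leb1 R).-integrable setT (fun x => (bump (ratr r) R0 n x * odd_lift g (x, y))%:E).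
  apply: (@integrable_bounded_mul _ (measurableTypeR R) R (leb1 R) _ _ 1 _ _ (yG Oy)).
    exact: measurable_bump.
  by move=> x; rewrite ger0_norm ?bump_ge0// bump_le1.
have [mp _ _] := primitive_tail (bump_integrable (ratr r) R0 n) (yM Oy).
have i2 : (leb1 R).-integrable setT (fun x => (primitive (bump (ratr r) R0 n) x * even_lift mu (x, y))%:E).
  apply: (@integrable_bounded_mul _ (measurableTypeR R) R (leb1 R) _ _ _ mp _ (yM Oy)) => x.
  by apply: Rintegral_le_norm => //; exact: bump_integrable.
have := integrableD measurableT i1 i2 => i12.
exact: integrable_fin_num i12.
Qed.

(** * The Hardy inequality carried from orbits to phase space *)

Context (rho : R -> R) (dF : forall x : R, is_derive x 1 F (rho x)) (crho : continuous rho)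
  (rho_ge0 : forall x, 0 <= rho x) (F_gt0 : forall x, 0 < x -> 0 < F x).

(** Because [M] has mean zero, its tail from [x] is minus its integral up to [x]. Either side of [x]
    thus bounds the tail, and the Schur test chooses the side according to the crossing. *)
Lemma tail_bounds (M : R -> R) (r x : R) : (leb1 R).-integrable setT (EFin \o M) ->
  (forall t, ~~ (0 < t < r) -> M t = 0) -> (\int[leb1 R]_t (M t)%:E = 0)%E ->
  ((`|tail M x|)%:E <= \int[leb1 R]_(t in `]0%R, x[) (`|M t|)%:E)%E /\
  ((`|tail M x|)%:E <= \int[leb1 R]_(t in `]x, r[) (`|M t|)%:E)%E.
Proof.
move=> iM M0 int0.
have mM : measurable_fun setT (EFin \o (fun t => `|M t|)).
  by apply/measurable_EFinP; apply: measurableT_comp => //; apply/measurable_EFinP; exact: measurable_int iM.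
have iD (i : interval R) : (leb1 R).-integrable [set` i] (EFin \o M) by exact: integrableS iM.
have tailE : ((tail M x)%:E = \int[leb1 R]_(t in `[x, +oo[) (M t)%:E)%E.
  by rewrite /tail /Rintegral fineK//; exact: integrable_fin_num (iD _).
have le_abs (i : interval R) : (`|\int[leb1 R]_(t in [set` i]) (M t)%:E| <= \int[leb1 R]_(t in [set` i]) (`|M t|)%:E)%E.
  by apply: le_abse_integral => //; exact: measurable_int (iD i).
split.
  have : (\int[leb1 R]_(t in `]-oo, x[) (M t)%:E + \int[leb1 R]_(t in `[x, +oo[) (M t)%:E = 0)%E.
    rewrite -int0 -integral_setU//=.
    - by congr integral; rewrite -itv_bndbnd_setU// set_itvE.
    - rewrite -itv_bndbnd_setU// set_itvE; exact: measurable_int iM.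
    - by apply/disj_setPS => t [] /=; rewrite !in_itv/= andbT => h1 h2; move: (lt_le_trans h1 h2); rewrite ltxx.
  rewrite -tailE => h.
  have -> : ((`|tail M x|)%:E = `|\int[leb1 R]_(t in `]-oo, x[) (M t)%:E|)%E.
    have -> : (\int[leb1 R]_(t in `]-oo, x[) (M t)%:E = (- tail M x)%:E)%E.
      have finI : (\int[leb1 R]_(t in `]-oo, x[) (M t)%:E)%E \is a fin_num.
        by exact: integrable_fin_num (iD _).
      move: h; rewrite -(fineK finI) -EFinD => -[] h; congr EFin; lra.
    by rewrite /= normrN.
  apply: le_trans (le_abs _) _.
  rewrite integral_mkcond [leRHS]integral_mkcond le_eqVlt; apply/orP; left; apply/eqP.
  apply: eq_integral => t _; rewrite !patchE !mem_setE !in_itv/=.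
  have [tx|] := ltP t x; last by rewrite andbF.
  by rewrite andbT; case: ifPn => // t0; rewrite M0 ?normr0// negb_and t0.
rewrite -abse_EFin tailE; apply: le_trans (le_abs _) _.
rewrite -integral_itv_obnd_cbnd; last exact: measurable_funTS.
rewrite integral_mkcond [leRHS]integral_mkcond le_eqVlt; apply/orP; left; apply/eqP.
apply: eq_integral => t _; rewrite !patchE !mem_setE !in_itv/= andbT.
have [xt|//] := ltP x t.
by case: ifPn => // tr; rewrite M0 ?normr0// negb_and tr orbT.
Qed.

(** [r] is the turning point, given by the intermediate value theorem. An energy below [E0 = U0 R0]
    places it inside the support of the density. *)
Lemma orbit_domain y : O y -> U0 0 < y.1 ->
  exists2 r, 0 < r < R0 & U0 r = y.1 /\ forall x, (0 < x) && (U0 x < y.1) = (0 < x < r).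
Proof.
move=> [yE _] Uy; have c : {within `[0, R0], continuous U0}.
  by apply: continuous_subspaceT; exact: continuous_U.
have [r] : exists2 r, r \in `[0, R0] & U0 r = y.1.
  by apply: IVT => //; rewrite ge_min le_max (ltW Uy) (ltW yE) orbT.
rewrite in_itv/= => /andP[r0 rR] Ur.
have r_gt0 : 0 < r by rewrite lt_neqAle r0 andbT; apply: contraTneq Uy => ->; rewrite Ur ltxx.
exists r.
  by rewrite r_gt0/= lt_neqAle rR andbT; apply: contraTneq yE => e; rewrite /E0 -e -Ur ltxx.
split=> // x; have [x0|//] := ltP 0 x; rewrite /=.
have [xr|rx] := ltP x r.
  by apply: (orbit_potential_lt dU F_gt0 Ur); rewrite (ltW x0).
apply/negbTE; rewrite -leNgt -Ur; apply: U_le.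
by rewrite (gtr0_norm r_gt0) gtr0_norm.
Qed.

Lemma hardy_on_orbit (g mu : phase R -> R) y :
  measurable_fun (Om : set X) g -> measurable_fun (Om : set X) mu -> O y ->
  (leb1 R).-integrable setT (fun x => (even_lift mu (x, y))%:E) ->
  (\int[leb1 R]_x (even_lift mu (x, y))%:E = 0)%E ->
  {ae leb1 R, forall x, 0 < x < R0 ->
    odd_lift g (x, y) = - tail (fun x => even_lift mu (x, y)) x} ->
  (\int[leb1 R]_x (jac U0 (x, y) * (orbit_weight F rho x * odd_lift g (x, y) ^+ 2))%:E <=
   \int[leb1 R]_x (speed U0 x y.1 * even_lift mu (x, y) ^+ 2)%:E)%E.
Proof.
move=> mg mmu Oy iM M0 repr.
have [yU|Uy] := leP y.1 (U0 0).
  rewrite !integral0_eq// => x _.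
    have -> : even_lift mu (x, y) = 0.
      by apply: lift_out; rewrite /= negb_and -!leNgt (le_trans yU) ?orbT// U_le// normr0.
    by rewrite expr0n mulr0.
  by rewrite /jac/= ifF ?mul0r//; apply/negbTE; rewrite negb_and -!leNgt (le_trans yU) ?orbT// U_le// normr0.
have [r /andP[r0 rR] [Ur dom]] := orbit_domain Oy Uy.
pose G x := odd_lift g (x, y); pose M x := even_lift mu (x, y).
have mpair (h : X -> R) : measurable_fun setT h -> measurable_fun setT (fun x : measurableTypeR R => h (x, y)).
  by move=> mh; apply: (measurableT_comp mh); exact: measurable_pair2.
have mG : measurable_fun setT G.
  apply: (mpair (odd_lift g)); apply: measurable_lift; apply: measurable_funM; last exact: measurable_ext.
  apply: measurable_funM.
    by apply: (measurableT_comp measurable_sgr); exact: measurable_fst.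
  by apply: (measurableT_comp measurable_fst); exact: measurable_snd.
have mM : measurable_fun setT M.
  by apply: (mpair (even_lift mu)); apply: measurable_lift; exact: measurable_ext.
have Mout x : ~~ (0 < x < r) -> M x = 0 by move=> h; apply: lift_out; rewrite /= dom.
have := @orbit_hardy R U0 F rho y.1 r dU dF crho rho_ge0 F_gt0 r0 Ur G M mG mM.
have -> : (\int[leb1 R]_(x in `]0%R, r[) (orbit_weight F rho x * G x ^+ 2 / Num.sqrt (2 * (y.1 - U0 x)))%:E =
    \int[leb1 R]_x (jac U0 (x, y) * (orbit_weight F rho x * odd_lift g (x, y) ^+ 2))%:E)%E.
  rewrite integral_mkcond; apply: eq_integral => x _; rewrite patchE mem_setE in_itv/= /jac/= dom.
  by case: ifP => _; rewrite ?mul0r// mulrC.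
have -> : (\int[leb1 R]_(x in `]0%R, r[) (Num.sqrt (2 * (y.1 - U0 x)) * M x ^+ 2)%:E =
    \int[leb1 R]_x (speed U0 x y.1 * even_lift mu (x, y) ^+ 2)%:E)%E.
  rewrite integral_mkcond; apply: eq_integral => x _; rewrite patchE mem_setE in_itv/=.
  by case: ifPn => // h; rewrite -/(M x) Mout// expr0n mulr0.
apply; apply: (@filterS _ _ (ae_filter_ringOfSetsType (leb1 R))) repr => x Hx xr.
have [h1 h2] := @tail_bounds M r x iM Mout M0.
rewrite /G Hx ?normrN//; case/andP: xr => -> xr; exact: lt_trans rR.
Qed.

(** Four times the projection onto functions odd in [x] and odd in [v1], as [fold] is for functions
    even in both. *)
Definition odd_fold (f : phase R -> R) (z : phase R) : R :=
  f z - f (- z.1, z.2) - (f (z.1, (- z.2.1, z.2.2)) - f (- z.1, (- z.2.1, z.2.2))).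

Lemma measurable_reflections :
  [/\ measurable_fun setT (fun z : X => (- z.1, z.2) : X),
      measurable_fun setT (fun z : X => (z.1, (- z.2.1, z.2.2)) : X) &
      measurable_fun setT (fun z : X => (- z.1, (- z.2.1, z.2.2)) : X)].
Proof.
have m1 : measurable_fun setT (fun z : X => z.1) by exact: measurable_fst.
have ms : measurable_fun setT (fun z : X => z.2) by exact: measurable_snd.
have mv : measurable_fun setT (fun z : X => z.2.1) by apply: (measurableT_comp measurable_fst).
have mt : measurable_fun setT (fun z : X => z.2.2) by apply: (measurableT_comp measurable_snd).
have n1 : measurable_fun setT (fun z : X => - z.1) by exact: measurableT_comp.
have nv : measurable_fun setT (fun z : X => - z.2.1) by exact: measurableT_comp.
have mvt : measurable_fun setT (fun z : X => (- z.2.1, z.2.2) : Y) by exact: measurable_fun_pair.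
by split; exact: measurable_fun_pair.
Qed.

Lemma measurable_fold (f : X -> R) : measurable_fun setT f ->
  measurable_fun setT (fold f : X -> R) /\ measurable_fun setT (odd_fold f : X -> R).
Proof.
move=> mf; have [m1 m2 m3] := measurable_reflections.
have k1 := measurableT_comp mf m1; have k2 := measurableT_comp mf m2.
have k3 := measurableT_comp mf m3.
by split; [apply: measurable_funD; apply: measurable_funD|apply: measurable_funB; apply: measurable_funB].
Qed.

(** The square of the odd fold takes a single value at the four points of an orbit over
    [(x, E, vbar)], whence the factor 4. The same factor arises in [lift_fold]. *)
Lemma lift_odd_fold (V : R -> R) (h : phase R -> R) z : (forall x, V (- x) = V x) ->
  lift (fun z => V z.1 * odd_fold h z ^+ 2) z =
  4 * (jac U0 z * (V z.1 * lift (fun z => Num.sg z.1 * z.2.1 * h z) z ^+ 2)).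
Proof.
move=> VN; rewrite /lift /jac; case: ifPn => [/andP[x0 xE]|_]; last by rewrite !mul0r mulr0.
have v0 : speed U0 z.1 z.2.1 != 0 by rewrite gt_eqF// sqrtr_gt0 mulr_gt0// subr_gt0.
rewrite /fold /odd_fold /orbit/= !VN !opprK gtr0_sg// ltr0_sg ?oppr_lt0//.
by field.
Qed.

Lemma lift_fold (h : phase R -> R) z :
  lift (fun z => fold h z ^+ 2) z = 4 * (speed U0 z.1 z.2.1 * lift h z ^+ 2).
Proof.
rewrite /lift /jac; case: ifPn => [/andP[x0 xE]|_]; last by rewrite !mul0r expr0n !mulr0.
have v0 : speed U0 z.1 z.2.1 != 0 by rewrite gt_eqF// sqrtr_gt0 mulr_gt0// subr_gt0.
by rewrite /fold /orbit/= !opprK; field.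
Qed.

Lemma ge0_integral_fold (h : X -> R) : measurable_fun setT h -> (forall z, 0 <= h z) ->
  (\int[lam4 R]_z (A (invariants z) * fold h z)%:E =
   4%:E * \int[lam4 R]_z (A (invariants z) * h z)%:E)%E.
Proof.
move=> mh h0; have [mf _] := measurable_fold mh.
have mA := measurable_weight.
have f0 z : 0 <= fold h z by rewrite /fold !addr_ge0.
rewrite (ge0_integral_lift (f := fun z => A (invariants z) * h z)); last 2 first.
- exact: measurable_funM.
- by move=> z; rewrite mulr_ge0// inv_weight_ge0.
rewrite (ge0_integral_lift (f := fun z => A (invariants z) * fold h z)); last 2 first.
- exact: measurable_funM.
- by move=> z; rewrite mulr_ge0// inv_weight_ge0.
rewrite -ge0_integralZl//; last 2 first.
- apply/measurable_EFinP; apply: measurable_lift; exact: measurable_funM.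
- move=> z _; rewrite lee_fin; apply: orbit_fold_ge0 => z'.
  by rewrite mulr_ge0// inv_weight_ge0.
apply: eq_integral => z _; rewrite -EFinM; congr (_%:E).
rewrite !(lift_invariants A) [RHS]mulrCA; congr (_ * _).
by rewrite /lift [RHS]mulrCA; congr (_ * _); rewrite /fold /orbit/= !opprK; ring.
Qed.

(** The inequality on each orbit is integrated over the invariants. The weight is a function of them
    and passes through, and both sides carry the same factor 4. The orbit weight is taken at [|x|]
    since the orbit coordinates have [x > 0]. *)
Lemma weighted_hardy (g mu : phase R -> R) :
  measurable_fun (Om : set X) g -> measurable_fun (Om : set X) mu -> weakD Om w U0 g mu ->
  (\int[lam4 R]_z (A (invariants z) * (orbit_weight F rho `|z.1| * odd_fold (ext g) z ^+ 2))%:E <=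
   \int[lam4 R]_z (A (invariants z) * fold (ext mu) z ^+ 2)%:E)%E.
Proof.
move=> mg mmu wD.
have mA := measurable_weight.
have [_ mog] := measurable_fold (measurable_ext mg).
have [mfm _] := measurable_fold (measurable_ext mmu).
have mW : measurable_fun setT (orbit_weight F rho).
  have mF := continuous_measurable_fun cF; have mrho := continuous_measurable_fun crho.
  apply: measurable_funD => //; apply: measurable_funM; first exact: measurable_funM.
  by apply: measurableT_comp; [exact: measurable_invr|exact: measurable_id].
have W0 x : 0 < x -> 0 <= orbit_weight F rho x.
  by move=> x0; rewrite addr_ge0// divr_ge0 ?mulr_ge0 ?(ltW x0)// ltW// F_gt0.
have mWx : measurable_fun setT (fun z : X => orbit_weight F rho `|z.1|).
  have mabs : measurable_fun setT (fun z : X => `|z.1|).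
    have mx : measurable_fun setT (fun z : X => z.1) by exact: measurable_fst.
    exact: (measurableT_comp (@normr_measurable R setT) mx).
  exact: (measurableT_comp mW mabs).
have W0' (x : R) : 0 <= orbit_weight F rho `|x|.
  have [->|x0] := eqVneq x 0; last by rewrite W0// normr_gt0.
  by rewrite normr0 /orbit_weight invr0 mulr0 addr0.
have mog2 : measurable_fun setT (fun z : X => odd_fold (ext g) z ^+ 2) by exact: measurable_funX.
have mfm2 : measurable_fun setT (fun z : X => fold (ext mu) z ^+ 2) by exact: measurable_funX.
have A0 y : 0 <= A y by exact: inv_weight_ge0.
rewrite (ge0_integral_lift (f := fun z => A (invariants z) * (orbit_weight F rho `|z.1| * odd_fold (ext g) z ^+ 2))
  (measurable_funM mA (measurable_funM mWx mog2))
  (fun z => mulr_ge0 (A0 _) (mulr_ge0 (W0' _) (sqr_ge0 _)))).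
rewrite (ge0_integral_lift (f := fun z => A (invariants z) * fold (ext mu) z ^+ 2)
  (measurable_funM mA mfm2) (fun z => mulr_ge0 (A0 _) (sqr_ge0 _))).
pose K1 (z : X) := A z.2 * (4 * (jac U0 z * (orbit_weight F rho z.1 * odd_lift g z ^+ 2))).
pose K2 (z : X) := A z.2 * (4 * (speed U0 z.1 z.2.1 * even_lift mu z ^+ 2)).
have E1 : (\int[lam4 R]_z (lift (fun z => A (invariants z) * (orbit_weight F rho `|z.1| * odd_fold (ext g) z ^+ 2)) z)%:E =
    \int[lam4 R]_z (K1 z)%:E)%E.
  apply: eq_integral => z _; congr (_%:E); rewrite (lift_invariants A) /K1; congr (_ * _).
  rewrite (lift_odd_fold (V := fun x => orbit_weight F rho `|x|)); last by move=> x; rewrite normrN.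
  rewrite /jac; case: ifPn => [/andP[x0 _]|_]; last by rewrite !mul0r.
  by rewrite gtr0_norm.
have E2 : (\int[lam4 R]_z (lift (fun z => A (invariants z) * fold (ext mu) z ^+ 2) z)%:E =
    \int[lam4 R]_z (K2 z)%:E)%E.
  apply: eq_integral => z _; congr (_%:E); rewrite (lift_invariants A) /K2; congr (_ * _).
  by rewrite lift_fold.
have m2 : measurable_fun setT (fun z : X => A z.2).
  by apply: (measurableT_comp measurable_inv_weight); exact: measurable_snd.
have msp : measurable_fun setT (fun z : X => speed U0 z.1 z.2.1) by exact: measurable_speed measurable_U.
have mx : measurable_fun setT (fun z : X => z.1) by exact: measurable_fst.
have mv : measurable_fun setT (fun z : X => z.2.1).
  by apply: (measurableT_comp measurable_fst); exact: measurable_snd.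
have mjac : measurable_fun setT (jac U0 : X -> R).
  apply: measurable_fun_if.
  - exact: measurableT.
  - apply: measurable_and; first exact: (measurable_fun_ltr (measurable_cst _) mx).
    exact: (measurable_fun_ltr (measurableT_comp measurable_U mx) mv).
  - by apply: measurable_funTS; exact: (measurableT_comp (@measurable_invr R) msp).
  - exact: measurable_cst.
have mo : measurable_fun setT (odd_lift g : X -> R).
  apply: measurable_lift.
  exact: (measurable_funM (measurable_funM (measurableT_comp measurable_sgr mx) mv) (measurable_ext mg)).
have me : measurable_fun setT (even_lift mu : X -> R) by exact: (measurable_lift (measurable_ext mmu)).
have mo2 : measurable_fun setT (fun z : X => odd_lift g z ^+ 2) by exact: measurable_funX.
have me2 : measurable_fun setT (fun z : X => even_lift mu z ^+ 2) by exact: measurable_funX.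
have mWx' : measurable_fun setT (fun z : X => orbit_weight F rho z.1) by exact: (measurableT_comp mW mx).
have k1 := measurable_funM mjac (measurable_funM mWx' mo2).
have k2 := measurable_funM msp me2.
have c4 : measurable_fun setT (fun _ : X => 4 : R) by exact: measurable_cst.
have mK1 : measurable_fun setT K1 by exact: (measurable_funM m2 (measurable_funM c4 k1)).
have mK2 : measurable_fun setT K2 by exact: (measurable_funM m2 (measurable_funM c4 k2)).
have K10 z : 0 <= K1 z.
  rewrite mulr_ge0 ?inv_weight_ge0// mulr_ge0// /jac; case: ifPn => [/andP[x0 _]|_]; last by rewrite mul0r.
  by rewrite mulr_ge0 ?invr_ge0 ?sqrtr_ge0// mulr_ge0 ?sqr_ge0// W0.
have K20 z : 0 <= K2 z.
  by rewrite mulr_ge0 ?inv_weight_ge0// mulr_ge0// mulr_ge0 ?sqrtr_ge0 ?sqr_ge0.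
have ton (K : X -> R) : measurable_fun setT K -> (forall z, 0 <= K z) ->
    (\int[lam4 R]_z (K z)%:E = \int[lam3 R]_y \int[leb1 R]_x (K (x, y))%:E)%E.
  move=> mK K0; apply: (@fubini_tonelli2 _ _ _ Y R (leb1 R) (lam3 R) (EFin \o K)).
    exact/measurable_EFinP.
  by move=> z; rewrite lee_fin.
have mton (K : X -> R) : measurable_fun setT K -> (forall z, 0 <= K z) ->
    measurable_fun setT (fun y : Y => \int[leb1 R]_x (K (x, y))%:E)%E.
  move=> mK K0; apply: (@measurable_fun_fubini_tonelli_G _ _ _ Y R (leb1 R) (EFin \o K)) => //.
  exact/measurable_EFinP.
have mpair (h : X -> R) y : measurable_fun setT h -> measurable_fun setT (fun x : measurableTypeR R => h (x, y)).
  by move=> mh; apply: (measurableT_comp mh); exact: measurable_pair2.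
rewrite E1 E2 (ton _ mK1 K10) (ton _ mK2 K20); apply: ae_ge0_le_integral.
- exact: measurableT.
- by move=> y _; apply: integral_ge0 => x _; rewrite lee_fin.
- exact: (mton _ mK1 K10).
- by move=> y _; apply: integral_ge0 => x _; rewrite lee_fin.
- exact: (mton _ mK2 K20).
have FF := ae_filter_ringOfSetsType (lam3 R).
apply: (@filterS _ _ FF) (orbit_representation mg mmu wD) => y Hy _.
have [Oy|nOy] := pselect (O y); last first.
  rewrite [leLHS]integral0_eq; first by apply: integral_ge0 => x _; rewrite lee_fin.
  have Ay : A y = 0 by exact: inv_weight_out nOy.
  by move=> x _; rewrite /K1 (_ : A (x, y).2 = 0) ?mul0r.
have [iG iM M0 repr] := Hy Oy.
have := hardy_on_orbit mg mmu Oy iM M0 repr => hardy.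
have out (K : X -> R) : measurable_fun setT K -> (forall z, 0 <= K z) ->
   (\int[leb1 R]_x (A (x, y).2 * (4 * K (x, y)))%:E = (A y * 4)%:E * \int[leb1 R]_x (K (x, y))%:E)%E.
  move=> mK K0; rewrite -ge0_integralZl//.
  - by apply: eq_integral => x _; rewrite -EFinM mulrA.
  - by apply/measurable_EFinP; exact: mpair.
  - by move=> x _; rewrite lee_fin.
  - by rewrite lee_fin mulr_ge0// inv_weight_ge0.
have k10 (z : X) : 0 <= jac U0 z * (orbit_weight F rho z.1 * odd_lift g z ^+ 2).
  rewrite /jac; case: ifPn => [/andP[x0 _]|_]; last by rewrite mul0r.
  by rewrite mulr_ge0 ?invr_ge0 ?sqrtr_ge0// mulr_ge0 ?sqr_ge0// W0.
have k20 (z : X) : 0 <= speed U0 z.1 z.2.1 * even_lift mu z ^+ 2.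
  by rewrite mulr_ge0 ?sqrtr_ge0 ?sqr_ge0.
have e1 := out _ k1 k10; have e2 := out _ k2 k20.
apply: (@le_trans _ _ ((A y * 4)%:E * \int[leb1 R]_x (jac U0 (x, y) * (orbit_weight F rho x * odd_lift g (x, y) ^+ 2))%:E)%E).
  by rewrite -e1.
apply: (@le_trans _ _ ((A y * 4)%:E * \int[leb1 R]_x (speed U0 x y.1 * even_lift mu (x, y) ^+ 2)%:E)%E).
  by apply: lee_wpmul2l => //; rewrite lee_fin mulr_ge0// inv_weight_ge0.
by rewrite -e2.
Qed.

(** * Bounds on the flux J *)

Context (rho0 : R -> R)
  (density : forall x, (rho0 x)%:E = (\int[leb1 R]_v (alpha a E0 (v ^+ 2 / 2 + U0 x))%:E)%E)
  (beta_mass : (\int[leb2 R]_v (beta v)%:E)%E = 1%:E).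

Lemma ge0_integral_velocity (p : R -> R) : measurable_fun setT p -> (forall v, 0 <= p v) ->
  (\int[lam3 R]_v (p v.1 * beta v.2)%:E = \int[leb1 R]_v (p v)%:E)%E.
Proof.
move=> mp p0; have mb := continuous_measurable_plane Hbeta_cont.
pose h (v : Y) := p v.1 * beta v.2.
have mh : measurable_fun setT h.
  exact: (measurable_funM (measurableT_comp mp measurable_fst) (measurableT_comp mb measurable_snd)).
transitivity (\int[leb1 R]_v \int[lam2 R]_t (p v * beta t)%:E)%E.
  apply: (@fubini_tonelli1 _ _ (measurableTypeR R) T R (leb1 R) (lam2 R) (EFin \o h)).
    exact/measurable_EFinP.
  by move=> v; rewrite lee_fin mulr_ge0.
apply: eq_integral => v _.
under eq_integral do rewrite EFinM.
rewrite ge0_integralZl//.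
- by rewrite [X in (_ * X)%E]beta_mass mule1.
- exact/measurable_EFinP.
- by move=> t _; rewrite lee_fin.
- by rewrite lee_fin.
Qed.

Lemma JopE (g : phase R -> R) x : Jop Om g x = fine (\int[lam3 R]_v (v.1 * ext g (x, v))%:E)%E.
Proof.
congr fine.
transitivity (\int[lam3 R]_(v in [set v | Om (x, v)]) (v.1 * g (x, v))%:E)%E; first by [].
rewrite integral_mkcond; apply: eq_integral => v _; rewrite patchE /ext patchE.
have -> : (v \in [set v | Om (x, v)]) = ((x, v) \in Om) by apply/idP/idP; rewrite !inE.
by case: ifP => //; rewrite mulr0.
Qed.

Lemma measurable_flux_density (g : X -> R) : measurable_fun (Om : set X) g ->
  measurable_fun setT (fun z : X => z.2.1 * ext g z).
Proof.
move=> mg; apply: measurable_funM; last exact: (measurable_ext mg).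
exact: (measurableT_comp measurable_fst measurable_snd).
Qed.

Lemma measurable_Jop (g : X -> R) : measurable_fun (Om : set X) g -> measurable_fun setT (Jop Om g).
Proof.
move=> mg; have mk := measurable_flux_density mg.
pose k' (z : Y * measurableTypeR R) := z.1.1 * ext g (z.2, z.1).
have ms : measurable_fun setT (fun z : Y * measurableTypeR R => (z.2, z.1) : X).
  exact: (measurable_fun_pair measurable_snd measurable_fst).
have mk' : measurable_fun setT k' by exact: (measurableT_comp mk ms).
rewrite (_ : Jop Om g = fine \o (fun x => \int[lam3 R]_v (k' (v, x))%:E)%E).
  apply: measurableT_comp => //.
  exact: (@measurable_section_integral _ _ Y (measurableTypeR R) R (lam3 R) k' mk').
by apply/funext => x; rewrite JopE.
Qed.

(** Cauchy-Schwarz for the factors [|v1| sqrt|phi'|] and [|g| / sqrt|phi'|]; by [stress_le] the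
    first has square integral at most [rho0]. The bound is on the integral of the modulus and not on
    [J] itself, because it must also serve to prove integrability. *)
Lemma abs_flux_bound (g : X -> R) x : measurable_fun (Om : set X) g ->
  ((\int[lam3 R]_v (`|v.1 * ext g (x, v)|)%:E) * (\int[lam3 R]_v (`|v.1 * ext g (x, v)|)%:E) <= (rho0 x)%:E * \int[lam3 R]_v (A (invariants (x, v)) * ext g (x, v) ^+ 2)%:E)%E.
Proof.
move=> mg; pose k (v : Y) := v.1 * ext g (x, v).
have mp : measurable_fun setT (fun v : Y => (x, v) : X) by exact: measurable_pair1.
have mk : measurable_fun setT k by exact: (measurableT_comp (measurable_flux_density mg) mp).
have me : measurable_fun setT (fun v : Y => ext g (x, v)) by exact: (measurableT_comp (measurable_ext mg) mp).
have mA : measurable_fun setT (fun v : Y => A (invariants (x, v))).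
  exact: (measurableT_comp (measurableT_comp measurable_inv_weight measurable_invariants) mp).
have ms := continuous_measurable_fun (@sqrt_continuous R).
pose W (v : Y) := `|alpha' a E0 (v.1 ^+ 2 / 2 + U0 x) * beta v.2|.
have WA v : A (invariants (x, v)) = (W v)^-1 by [].
have mW : measurable_fun setT W.
  have m1 : measurable_fun setT (fun v : Y => v.1 ^+ 2 / 2 + U0 x).
    exact: (measurableT_comp (measurable_kinetic _) measurable_fst).
  have m2 : measurable_fun setT (fun v : Y => alpha' a E0 (v.1 ^+ 2 / 2 + U0 x)).
    by apply: measurableT_comp; [exact: measurable_alpha'|exact: m1].
  have m3 : measurable_fun setT (fun v : Y => beta v.2).
    exact: (measurableT_comp (continuous_measurable_plane Hbeta_cont) measurable_snd).
  exact: (measurableT_comp (@normr_measurable R setT) (measurable_funM m2 m3)).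
have W0 v : 0 <= W v by exact: normr_ge0.
pose f (v : Y) := `|v.1| * Num.sqrt (W v).
pose h (v : Y) := `|ext g (x, v)| * Num.sqrt (A (invariants (x, v))).
have A0 y : 0 <= A y by exact: inv_weight_ge0.
have fh v : f v * h v = `|k v|.
  rewrite /f /h /k normrM; have [e|nz] := eqVneq (W v) 0.
    have -> : ext g (x, v) = 0; last by rewrite normr0 !(mul0r, mulr0).
    rewrite /ext patchE; case: ifPn => //; rewrite inE => /Omega0P/inv_weight_gt0.
    by rewrite -/(A _) WA e invr0 ltxx.
  rewrite WA sqrtrV//; field.
  by rewrite sqrtr_eq0 -ltNge lt0r nz W0.
have mf : measurable_fun setT f.
  exact: (measurable_funM (measurableT_comp (@normr_measurable R setT) measurable_fst) (measurableT_comp ms mW)).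
have mh : measurable_fun setT h.
  exact: (measurable_funM (measurableT_comp (@normr_measurable R setT) me) (measurableT_comp ms mA)).
have f0 v : 0 <= f v by rewrite mulr_ge0 ?sqrtr_ge0.
have h0 v : 0 <= h v by rewrite mulr_ge0 ?sqrtr_ge0.
have cs := @ge0_integral_cauchy_schwarz _ Y R (lam3 R) f h mf mh f0 h0.
have NE : (\int[lam3 R]_v (f v * h v)%:E = \int[lam3 R]_v (`|k v|)%:E)%E.
  by apply: eq_integral => v _; rewrite fh.
have F2 : (\int[lam3 R]_v (f v ^+ 2)%:E <= (rho0 x)%:E)%E.
  rewrite density; apply: le_trans (stress_le E0 Ha (U0 x)).
  rewrite -(ge0_integral_velocity (p := fun v => v ^+ 2 * `|alpha' a E0 (v ^+ 2 / 2 + U0 x)|)).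
  - rewrite le_eqVlt; apply/orP; left; apply/eqP; apply: eq_integral => v _; congr (_%:E).
    rewrite /f exprMn real_normK ?num_real// sqr_sqrtr// /W normrM mulrA.
    by rewrite (ger0_norm (Hbeta_ge0 _)).
  - apply: measurable_funM; first exact: measurable_funX.
    apply: (measurableT_comp (@normr_measurable R setT)).
    by apply: measurableT_comp; [exact: measurable_alpha'|exact: measurable_kinetic].
  - by move=> v; rewrite mulr_ge0// sqr_ge0.
have H2 : (\int[lam3 R]_v (h v ^+ 2)%:E = \int[lam3 R]_v (A (invariants (x, v)) * ext g (x, v) ^+ 2)%:E)%E.
  apply: eq_integral => v _; congr (_%:E).
  by rewrite /h exprMn real_normK ?num_real// sqr_sqrtr// mulrC.
rewrite -H2; apply: (@le_trans _ _ ((\int[lam3 R]_v (f v ^+ 2)%:E) * (\int[lam3 R]_v (h v ^+ 2)%:E))%E); last first.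
  by apply: lee_wpmul2r => //; apply: integral_ge0 => v _; rewrite lee_fin sqr_ge0.
by apply: le_trans cs; rewrite NE.
Qed.

(** [Jop] is the [fine] part of an integral, hence 0 when that integral is infinite; the bound
    therefore holds at every [x]. *)
Lemma Jop_le (g : X -> R) x : measurable_fun (Om : set X) g ->
  ((`|Jop Om g x|)%:E <= \int[lam3 R]_v (`|v.1 * ext g (x, v)|)%:E)%E.
Proof.
move=> mg; pose k (v : Y) := v.1 * ext g (x, v).
have mk : measurable_fun setT k.
  exact: (measurableT_comp (measurable_flux_density mg) (measurable_pair1 _)).
rewrite JopE.
have N0 : (0 <= \int[lam3 R]_v (`|k v|)%:E)%E by apply: integral_ge0 => v _; rewrite lee_fin.
have fine_le (I N : \bar R) : (0 <= N -> `|I| <= N -> (`|fine I|%R)%:E <= N)%E.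
  by case: I => [r| |] //= N0' _; rewrite normr0.
have mEk : measurable_fun setT (EFin \o k) by exact/measurable_EFinP.
exact: fine_le N0 (@le_abse_integral _ Y R (lam3 R) setT (EFin \o k) measurableT mEk).
Qed.

Lemma flux_bound (g : X -> R) x : measurable_fun (Om : set X) g ->
  ((Jop Om g x ^+ 2)%:E <= (rho0 x)%:E * \int[lam3 R]_v (A (invariants (x, v)) * ext g (x, v) ^+ 2)%:E)%E.
Proof.
move=> mg; apply: le_trans (abs_flux_bound x mg).
by rewrite -real_normK ?num_real// expr2 EFinM; apply: lee_pmul; rewrite ?lee_fin//; exact: Jop_le.
Qed.

Lemma flux_energy (g : X -> R) : measurable_fun (Om : set X) g -> measurable_fun setT rho0 ->
  (forall x, 0 <= rho0 x) ->
  (\int[leb1 R]_x (Jop Om g x ^+ 2)%:E <=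
   \int[lam4 R]_z (A (invariants z) * (rho0 z.1 * ext g z ^+ 2))%:E)%E.
Proof.
move=> mg mr r0; pose K (z : X) := A (invariants z) * (rho0 z.1 * ext g z ^+ 2).
have me2 : measurable_fun setT (fun z : X => ext g z ^+ 2).
  by apply: measurable_funX; exact: (measurable_ext mg).
have mA := measurable_weight.
have mK : measurable_fun setT K.
  exact: (measurable_funM mA (measurable_funM (measurableT_comp mr measurable_fst) me2)).
have A0 y : 0 <= A y by exact: inv_weight_ge0.
have K0 z : 0 <= K z by rewrite mulr_ge0// mulr_ge0 ?sqr_ge0.
have e : (\int[lam4 R]_z (K z)%:E = \int[leb1 R]_x \int[lam3 R]_v (K (x, v))%:E)%E.
  apply: (@fubini_tonelli1 _ _ (measurableTypeR R) Y R (leb1 R) (lam3 R) (EFin \o K)).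
    exact/measurable_EFinP.
  by move=> z; rewrite lee_fin.
rewrite e; apply: ge0_le_integral.
- exact: measurableT.
- by move=> x _; rewrite lee_fin sqr_ge0.
- by apply/measurable_EFinP; apply: measurable_funX; exact: measurable_Jop.
- apply: (@measurable_fun_fubini_tonelli_F _ _ (measurableTypeR R) Y R (lam3 R) (EFin \o K)).
    exact/measurable_EFinP.
  by move=> z; rewrite lee_fin.
- move=> x _; apply: le_trans (flux_bound x mg) _.
  rewrite -ge0_integralZl//; last 3 first.
  + apply/measurable_EFinP.
    exact: (measurableT_comp (measurable_funM mA me2) (measurable_pair1 _)).
  + by move=> v _; rewrite lee_fin mulr_ge0 ?sqr_ge0.
  + by rewrite lee_fin.
  rewrite le_eqVlt; apply/orP; left; apply/eqP; apply: eq_integral => v _.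
  by rewrite -EFinM /K/= mulrCA.
Qed.

(** * Coercivity of the quadratic form *)

Context (rhoE : forall x, rho x = 4 * pi * rho0 x) (kappa : R) (kappa_gt0 : 0 < kappa)
  (F_lower : forall x, 0 <= x <= R0 -> kappa * x <= F x)
  (rho0_ge0 : forall x, 0 <= rho0 x) (mrho0 : measurable_fun setT rho0)
  (rho0_even : forall x, rho0 (- x) = rho0 x).

Lemma Hnorm2E (g : phase R -> R) :
  Hnorm2 Om w g = (\int[lam4 R]_z (A (invariants z) * ext g z ^+ 2)%:E)%E.
Proof.
transitivity (\int[lam4 R]_(z in Om) ((`|w z|)^-1 * g z ^+ 2)%:E)%E; first by [].
rewrite integral_mkcond; apply: eq_integral => z _; rewrite patchE /ext patchE.
by case: ifP => _; rewrite ?expr0n ?mulr0.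
Qed.

Lemma integral_indic_phase (N : set X) : measurable N ->
  (\int[lam4 R]_z (\1_N z)%:E = lam4 R N)%E.
Proof. by move=> mN; rewrite (@integral_indic _ X R (lam4 R) setT measurableT N mN) setIT. Qed.

(** The fold is invariant under the reflection of [x], so the indicators of a set and of its mirror
    image have the same lift and the same integral; null sets are reflected to null sets. *)
Lemma ae_reflect (P : X -> Prop) : {ae lam4 R, forall z, P z} -> {ae lam4 R, forall z, P (- z.1, z.2)}.
Proof.
move=> [N [mN N0 PN]].
have [mr _ _] := measurable_reflections.
pose r (z : X) : X := (- z.1, z.2).
have mrN : measurable (r @^-1` N) by rewrite -[X in measurable X]setTI; exact: mr.
have m1 : measurable_fun setT (\1_N : X -> R) by exact: measurable_indic.
have m2 : measurable_fun setT (\1_(r @^-1` N) : X -> R) by exact: measurable_indic.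
have i2 : (\int[lam4 R]_z (\1_(r @^-1` N) z)%:E = \int[lam4 R]_z (\1_N z)%:E)%E.
  rewrite (ge0_integral_lift m1 (fun z => ler0n _ _)) (ge0_integral_lift m2 (fun z => ler0n _ _)).
  apply: eq_integral => z _; congr (_%:E); rewrite /lift; congr (_ * _).
  have E u : \1_(r @^-1` N) u = \1_N (r u) :> R.
    rewrite !indicE; congr (_%:R); congr nat_of_bool; apply/idP/idP; rewrite !inE//.
  by rewrite /fold /orbit !E /r/= !opprK; ring.
exists (r @^-1` N); split; first exact: mrN.
  by rewrite -(integral_indic_phase mrN) i2 (integral_indic_phase mN).
by move=> z Pz; apply: PN.
Qed.

Lemma ae_position_neq0 : {ae lam4 R, forall z : X, z.1 != 0}.
Proof.
pose N : set X := (fun z => z.1) @^-1` [set 0].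
have mN : measurable N by rewrite -[X in measurable X]setTI; exact: measurable_fst.
have m1 : measurable_fun setT (\1_N : X -> R) by exact: measurable_indic.
exists N; split; first exact: mN.
  rewrite -(integral_indic_phase mN) (ge0_integral_lift m1 (fun z => ler0n _ _)).
  apply: integral0_eq => z _.
  rewrite /lift /jac; case: ifPn => [/andP[x0 _]|_]; last by rewrite mul0r.
  have nN (x : R) (v : Y) : x != 0 -> \1_N (x, v) = 0 :> R.
    by move=> xn; rewrite indicE memNset//= => /eqP; rewrite (negbTE xn).
  by rewrite /fold /orbit/= !nN ?oppr_eq0 ?gt_eqF// !addr0 mulr0.
by move=> z /negP; rewrite negbK => /eqP.
Qed.

(** The two relations at [z] link three of the four points. The fourth, [(-x, -v1)], needs the
    velocity relation at the mirror point [(-x, v1)], which [ae_reflect] provides almost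
    everywhere. *)
Lemma ae_odd_fold (g : phase R -> R) :
  {ae lam4 R, forall z, Om z -> g z = - g (- z.1, z.2) /\ g z = - g (z.1, (- z.2.1, z.2.2))} ->
  {ae lam4 R, forall z : X, odd_fold (ext g) z = 4 * ext g z}.
Proof.
move=> odd; have odd' := ae_reflect odd.
have FF := ae_filter_ringOfSetsType (lam4 R).
apply: (@filterS _ _ FF _ _ _ (@filterI _ _ FF _ _ odd odd')) => -[x [v t]] /= [q1 q2].
have OmE (z z' : phase R) : invariants z = invariants z' -> (z \in Om) = (z' \in Om).
  by move=> e; apply/idP/idP; rewrite !inE => /Omega0P h; apply/Omega0P; move: h; rewrite e.
have E1 : ((- x, (v, t)) \in Om) = ((x, (v, t)) \in Om).
  by apply: OmE; rewrite /invariants /energy/= potential_even.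
have E2 : ((x, (- v, t)) \in Om) = ((x, (v, t)) \in Om).
  by apply: OmE; rewrite /invariants /energy/= sqrrN.
have E3 : ((- x, (- v, t)) \in Om) = ((x, (v, t)) \in Om).
  by apply: OmE; rewrite /invariants /energy/= sqrrN potential_even.
rewrite /odd_fold /ext !patchE/= E1 E2 E3; case: ifPn => [zOm|_]; last by rewrite /point/=; ring.
have := q1 ltac:(by rewrite -inE) => -[e1 e2].
have [_ e3] := q2 ltac:(by rewrite -inE E1).
rewrite /= in e1 e2 e3; lra.
Qed.

Lemma Omega0_position (z : phase R) : Om z -> `|z.1| < R0.
Proof.
move=> /Omega0P[]; rewrite /= ltNge => h _; rewrite ltNge; apply: contra h => Rz.
have : U0 R0 <= U0 z.1 by apply: U_le; rewrite ger0_norm.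
by move/le_trans; apply; rewrite /energy lerDr divr_ge0// sqr_ge0.
Qed.

(** On the support the weight is at least [3 kappa + 4 pi rho0], and its second part dominates the
    flux by [flux_energy]. The factor 16 is the square in [odd_fold (ext g) = 4 * ext g]. *)
Lemma coercive (g mu : phase R -> R) :
  measurable_fun (Om : set X) g -> measurable_fun (Om : set X) mu -> weakD Om w U0 g mu ->
  {ae lam4 R, forall z, Om z -> g z = - g (- z.1, z.2) /\ g z = - g (z.1, (- z.2.1, z.2.2))} ->
  (16%:E * ((3 * kappa)%:E * \int[lam4 R]_z (A (invariants z) * ext g z ^+ 2)%:E +
            (4 * pi)%:E * \int[leb1 R]_x (Jop Om g x ^+ 2)%:E) <=
   \int[lam4 R]_z (A (invariants z) * fold (ext mu) z ^+ 2)%:E)%E.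
Proof.
move=> mg mmu wD odd; apply: le_trans (weighted_hardy mg mmu wD).
have A0 y : 0 <= A y by exact: inv_weight_ge0.
have mA := measurable_weight.
have me2 : measurable_fun setT (fun z : X => ext g z ^+ 2).
  by apply: measurable_funX; exact: (measurable_ext mg).
have mr : measurable_fun setT (fun z : X => rho0 z.1) by exact: (measurableT_comp mrho0 measurable_fst).
have pi4 : 0 <= 4 * pi :> R by rewrite mulr_ge0// pi_ge0.
pose K1 (z : X) := A (invariants z) * ext g z ^+ 2.
pose K2 (z : X) := A (invariants z) * (rho0 z.1 * ext g z ^+ 2).
have mK1 : measurable_fun setT K1 by exact: (measurable_funM mA me2).
have mK2 : measurable_fun setT K2 by exact: (measurable_funM mA (measurable_funM mr me2)).
have K10 z : 0 <= K1 z by rewrite mulr_ge0 ?sqr_ge0.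
have K20 z : 0 <= K2 z by rewrite mulr_ge0// mulr_ge0 ?sqr_ge0.
have c0 : 0 <= 3 * kappa by rewrite mulr_ge0// ltW.
apply: (@le_trans _ _ (16%:E * ((3 * kappa)%:E * \int[lam4 R]_z (K1 z)%:E + (4 * pi)%:E * \int[lam4 R]_z (K2 z)%:E))%E).
  apply: lee_wpmul2l; first by rewrite lee_fin.
  apply: leeD; first exact: lexx.
  by apply: lee_wpmul2l; [rewrite lee_fin|exact: flux_energy].
have mE (K : X -> R) : measurable_fun setT K -> measurable_fun setT (EFin \o K) by move=> mK; exact/measurable_EFinP.
have -> : (16%:E * ((3 * kappa)%:E * \int[lam4 R]_z (K1 z)%:E + (4 * pi)%:E * \int[lam4 R]_z (K2 z)%:E))%E =
    (\int[lam4 R]_z (16 * (3 * kappa * K1 z + 4 * pi * K2 z))%:E)%E.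
  have cst_m (k : R) : measurable_fun [set: X] (fun=> k) by exact: measurable_cst.
  have n1 := measurable_funM (cst_m (3 * kappa)) mK1; have n2 := measurable_funM (cst_m (4 * pi)) mK2.
  have -> : (\int[lam4 R]_z (16 * (3 * kappa * K1 z + 4 * pi * K2 z))%:E = 16%:E * \int[lam4 R]_z (3 * kappa * K1 z + 4 * pi * K2 z)%:E)%E.
    rewrite -(@ge0_integralZl _ X R (lam4 R) setT measurableT); last 3 first.
    - exact: (mE _ (measurable_funD n1 n2)).
    - by move=> z _; rewrite lee_fin; exact: (addr_ge0 (mulr_ge0 c0 (K10 z)) (mulr_ge0 pi4 (K20 z))).
    - by rewrite lee_fin.
    by apply: eq_integral => z _; rewrite -EFinM.
  congr (_ * _)%E.
  rewrite -(@ge0_integralZl _ X R (lam4 R) setT measurableT); last 3 first.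
  - exact: (mE _ mK1).
  - by move=> z _; rewrite lee_fin.
  - by rewrite lee_fin.
  rewrite -(@ge0_integralZl _ X R (lam4 R) setT measurableT); last 3 first.
  - exact: (mE _ mK2).
  - by move=> z _; rewrite lee_fin.
  - by rewrite lee_fin.
  rewrite -(@ge0_integralD _ X R (lam4 R) setT measurableT).
  - by apply: eq_integral => z _; rewrite -!EFinM -EFinD.
  - by move=> z _; rewrite -EFinM lee_fin mulr_ge0.
  - exact: (mE _ n1).
  - by move=> z _; rewrite -EFinM lee_fin mulr_ge0.
  - exact: (mE _ n2).
have FF := ae_filter_ringOfSetsType (lam4 R).
have W0 (x : R) : 0 <= orbit_weight F rho `|x|.
  have [->|x0] := eqVneq x 0; first by rewrite normr0 /orbit_weight invr0 mulr0 addr0.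
  rewrite addr_ge0// divr_ge0 ?mulr_ge0// ltW// F_gt0// normr_gt0//.
have mW : measurable_fun setT (orbit_weight F rho).
  have mF := continuous_measurable_fun cF; have mrho := continuous_measurable_fun crho.
  apply: measurable_funD => //; apply: measurable_funM; first exact: measurable_funM.
  by apply: measurableT_comp; [exact: measurable_invr|exact: measurable_id].
have mWx : measurable_fun setT (fun z : X => orbit_weight F rho `|z.1|).
  have mx : measurable_fun setT (fun z : X => z.1) by exact: measurable_fst.
  exact: (measurableT_comp mW (measurableT_comp (@normr_measurable R setT) mx)).
have [_ mog] := measurable_fold (measurable_ext mg).
have mog2 : measurable_fun setT (fun z : X => odd_fold (ext g) z ^+ 2) by exact: measurable_funX.
apply: (@ae_ge0_le_integral _ X R (lam4 R)).
- exact: measurableT.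
- move=> z _; rewrite lee_fin; apply: mulr_ge0 => //.
  exact: (addr_ge0 (mulr_ge0 c0 (K10 z)) (mulr_ge0 pi4 (K20 z))).
- have cst_m (k : R) : measurable_fun [set: X] (fun=> k) by exact: measurable_cst.
  have n1 := measurable_funM (cst_m (3 * kappa)) mK1; have n2 := measurable_funM (cst_m (4 * pi)) mK2.
  exact: (mE _ (measurable_funM (cst_m 16) (measurable_funD n1 n2))).
- by move=> z _; rewrite lee_fin mulr_ge0// mulr_ge0 ?sqr_ge0.
- exact: (mE _ (measurable_funM mA (measurable_funM mWx mog2))).
(* The plane [x = 0] is discarded: division by zero makes [F x / x] vanish there, and the lower
   bound [kappa] would fail. *)
apply: (@filterS _ _ FF _ _ _ (@filterI _ _ FF _ _ (ae_odd_fold odd) ae_position_neq0)) => z [-> x0] _.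
rewrite lee_fin /K1 /K2 /A.
have [zO|nO] := pselect (O (invariants z)); last first.
  have -> : inv_weight (invariants z) = 0 by exact: inv_weight_out nO.
  by rewrite !(mul0r, mulr0, addr0).
have xR : `|z.1| < R0 by apply: Omega0_position; exact/Omega0P.
have wc : 3 * kappa + 4 * pi * rho0 z.1 <= orbit_weight F rho `|z.1|.
  rewrite /orbit_weight rhoE (_ : rho0 `|z.1| = rho0 z.1); last first.
    by have [h|h] := leP 0 z.1; [rewrite ger0_norm|rewrite ltr0_norm// rho0_even].
  rewrite addrC lerD2l ler_pdivlMr ?normr_gt0// -mulrA ler_wpM2l//.
  by apply: F_lower; rewrite normr_ge0 ltW.
have e2 : 0 <= ext g z ^+ 2 by exact: sqr_ge0.
have := ler_wpM2r (mulr_ge0 (A0 (invariants z)) e2) wc; rewrite /A.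
have -> : (4 * ext g z) ^+ 2 = 16 * ext g z ^+ 2 by ring.
set t := inv_weight (invariants z); set q := ext g z ^+ 2; set W := orbit_weight _ _ _.
by lra.
Qed.

(** A sum of four terms has square at most 4 times the sum of squares, and folding an integrand
    multiplies its weighted integral by 4. Equality holds for [mu] even under both reflections, so
    nothing is lost against the 16 of [coercive]. *)
Lemma fold_energy_le (mu : phase R -> R) : measurable_fun (Om : set X) mu ->
  (\int[lam4 R]_z (A (invariants z) * fold (ext mu) z ^+ 2)%:E <=
   16%:E * \int[lam4 R]_z (A (invariants z) * ext mu z ^+ 2)%:E)%E.
Proof.
move=> mmu; have [mf _] := measurable_fold (measurable_ext mmu).
have mA := measurable_weight.
have A0 y : 0 <= A y by exact: inv_weight_ge0.
pose h (z : X) := 4 * ext mu z ^+ 2.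
have mm2 : measurable_fun setT (fun z : X => ext mu z ^+ 2).
  by apply: measurable_funX; exact: (measurable_ext mmu).
have mh : measurable_fun setT h by exact: (measurable_funM (measurable_cst _) mm2).
have h0 z : 0 <= h z by rewrite mulr_ge0 ?sqr_ge0.
have [mfh _] := measurable_fold mh.
have -> : (16%:E * \int[lam4 R]_z (A (invariants z) * ext mu z ^+ 2)%:E =
    \int[lam4 R]_z (A (invariants z) * fold h z)%:E)%E.
  rewrite (ge0_integral_fold mh h0).
  rewrite -(@ge0_integralZl _ X R (lam4 R) setT measurableT); last 3 first.
  - by apply/measurable_EFinP; exact: (measurable_funM mA mm2).
  - by move=> z _; rewrite lee_fin mulr_ge0 ?sqr_ge0.
  - by rewrite lee_fin.
  rewrite -(@ge0_integralZl _ X R (lam4 R) setT measurableT); last 3 first.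
  - by apply/measurable_EFinP; exact: (measurable_funM mA mh).
  - by move=> z _; rewrite lee_fin mulr_ge0.
  - by rewrite lee_fin.
  by apply: eq_integral => z _; rewrite -!EFinM /h /A; congr (_%:E); ring.
have mf2 : measurable_fun setT (fun z : X => fold (ext mu) z ^+ 2) by exact: measurable_funX.
apply: ge0_le_integral.
- exact: measurableT.
- by move=> z _; rewrite lee_fin mulr_ge0 ?sqr_ge0.
- by apply/measurable_EFinP; exact: (measurable_funM mA mf2).
- by apply/measurable_EFinP; exact: (measurable_funM mA mfh).
move=> z _; rewrite lee_fin ler_wpM2l// /fold /h.
set p := ext mu z; set q := ext mu (- z.1, z.2); set r := ext mu (z.1, _); set s := ext mu (- z.1, (_, _)).
have := sqr_ge0 (p - q); have := sqr_ge0 (p - r); have := sqr_ge0 (p - s).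
have := sqr_ge0 (q - r); have := sqr_ge0 (q - s); have := sqr_ge0 (r - s).
rewrite !expr2; nra.
Qed.

(** * The kernel equation on orbits *)

Lemma lift_ae (f h : X -> R) : measurable_fun setT f -> measurable_fun setT h ->
  {ae lam4 R, forall z, f z = h z} -> {ae lam4 R, forall z, lift f z = lift h z}.
Proof.
(* The lift of [|f - h|] is nonnegative, dominates the difference of the lifts and has the same
   integral, zero. This is what lets an equation valid almost everywhere in phase space be read on
   almost every orbit. *)
move=> mf mh fh; pose e (z : X) := `|f z - h z|.
have me : measurable_fun setT e by exact: (measurableT_comp (@normr_measurable R setT) (measurable_funB mf mh)).
have e0 z : 0 <= e z by exact: normr_ge0.
have me' : measurable_fun setT (EFin \o e) by exact/measurable_EFinP.
have i0 : (\int[lam4 R]_z (e z)%:E = 0)%E.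
  transitivity (\int[lam4 R]_z (cst 0 : X -> \bar R) z)%E; last by rewrite integral0.
  apply: (@ae_eq_integral _ X R (lam4 R)) => //.
  have FF := ae_filter_ringOfSetsType (lam4 R).
  by apply: (@filterS _ _ FF _ _ _ fh) => z E _; rewrite /e E subrr normr0.
have mL : measurable_fun setT (lift e : X -> R) by exact: measurable_lift.
have L0 z : 0 <= lift e z by apply: orbit_fold_ge0; exact: e0.
have mL' : measurable_fun setT (EFin \o lift e : X -> \bar R) by exact/measurable_EFinP.
rewrite (ge0_integral_lift me e0) in i0.
have i1 : (\int[lam4 R]_z `|(EFin \o lift e) z| = 0)%E.
  by rewrite -[RHS]i0; apply: eq_integral => z _; rewrite /= ger0_norm.
have := (@ae_eq_integral_abs _ X R (lam4 R) _ measurableT _ mL').1 i1.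
have FF := ae_filter_ringOfSetsType (lam4 R).
apply: (@filterS _ _ FF) => z /(_ I) [] E.
apply/eqP; rewrite -subr_eq0 -normr_le0 -E /lift -mulrBr normrM.
have j0 : 0 <= jac U0 z by rewrite /jac; case: ifP => // _; rewrite invr_ge0 sqrtr_ge0.
rewrite (ger0_norm j0) ler_wpM2l// /fold /e.
have T4 (p q r s p' q' r' s' : R) :
    `|p + q + (r + s) - (p' + q' + (r' + s'))| <= `|p - p'| + `|q - q'| + (`|r - r'| + `|s - s'|).
  rewrite (_ : _ - _ = (p - p' + (q - q')) + ((r - r') + (s - s'))); last by ring.
  by apply: (le_trans (ler_normD _ _)); apply: lerD; exact: ler_normD.
exact: T4.
Qed.

Lemma lift_speed (h : phase R -> R) z :
  lift (fun z => 1 * (z.2.1 * Num.sg z.2.1) * h z) z = speed U0 z.1 z.2.1 * lift h z.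
Proof.
rewrite /lift /jac; case: ifPn => [/andP[x0 xE]|_]; last by rewrite !mul0r mulr0.
have v0 : 0 < speed U0 z.1 z.2.1 by rewrite sqrtr_gt0 mulr_gt0// subr_gt0.
by rewrite /fold /orbit/= (ltr0_sg (x := - speed _ _ _)) ?oppr_lt0// !(gtr0_sg v0); field; rewrite gt_eqF.
Qed.

(** The factor 2 counts the two signs of [v1], and the difference comes from the weight [sgn(x)] on
    the fold in [x]. The cut-off confines the function to the orbit, hence to a bounded range of
    [x]. *)
Definition orbit_flux (g : phase R -> R) (z : R * (R * (R * R))) : R :=
  if (0 < z.1) && (U0 z.1 < z.2.1) then 2 * (Jop Om g z.1 - Jop Om g (- z.1)) else 0.

Definition lift_field (g : phase R -> R) :=
  lift (fun z => Num.sg z.1 * Num.sg z.2.1 * ext (fun z => - Bop Om w g z) z).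

Lemma invariants_orbit (x v : R) (z : R * (R * (R * R))) : U0 z.1 < z.2.1 ->
  `|x| = z.1 -> `|v| = speed U0 z.1 z.2.1 -> invariants (x, (v, z.2.2)) = z.2.
Proof.
move=> xE ex ev; rewrite /invariants /energy/= -(real_normK (num_real v)) ev sqr_sqrtr; last first.
  by rewrite mulr_ge0// subr_ge0 ltW.
have -> : U0 x = U0 z.1 by apply: le_anti; rewrite !U_le// -?ex ?normr_id.
by case: (z.2) => p q /=; congr pair; field.
Qed.

(** In the forcing [B g] the factor [|phi'|] cancels the weight, and [v1 sgn(v1)] cancels the
    Jacobian: on its orbit the forcing depends on the position only. *)
Lemma lift_fieldE (g : phase R -> R) z : O z.2 ->
  A z.2 * lift_field g z = - (4 * pi * orbit_flux g z).
Proof.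
move=> Oz; have A0 : inv_weight z.2 != 0 by exact: inv_weight_neq0.
rewrite /lift_field /orbit_flux /lift /jac; case: ifPn => [/andP[x0 xE]|_]; last by rewrite !(mul0r, mulr0) oppr0.
have v0 : 0 < speed U0 z.1 z.2.1 by rewrite sqrtr_gt0 mulr_gt0// subr_gt0.
have inv x v : `|x| = z.1 -> `|v| = speed U0 z.1 z.2.1 -> invariants (x, (v, z.2.2)) = z.2.
  exact: invariants_orbit.
have E x v : `|x| = z.1 -> `|v| = speed U0 z.1 z.2.1 ->
    ext (fun z => - Bop Om w g z) (x, (v, z.2.2)) = - (4 * pi * (inv_weight z.2)^-1 * v * Jop Om g x).
  move=> ex ev; rewrite /ext patchE mem_set; last by apply/Omega0P; rewrite inv.
  have -> : (inv_weight z.2)^-1 = `|w (x, (v, z.2.2))|.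
    by rewrite -[in LHS](inv _ _ ex ev); exact: invrK.
  by [].
rewrite /fold /orbit/= !E ?normrN ?(gtr0_norm x0) ?(gtr0_norm v0)//.
rewrite (ltr0_sg (x := - z.1)) ?oppr_lt0// (ltr0_sg (x := - speed _ _ _)) ?oppr_lt0//.
rewrite (gtr0_sg x0) (gtr0_sg v0) /A.
by field; rewrite A0 gt_eqF.
Qed.

Lemma measurable_Bop (g : X -> R) : measurable_fun (Om : set X) g -> measurable_fun setT (Bop Om w g : X -> R).
Proof.
move=> mg; have mJ := measurableT_comp (measurable_Jop mg) (@measurable_fst _ _ (measurableTypeR R) Y).
have mv : measurable_fun setT (fun z : X => z.2.1) by exact: (measurableT_comp measurable_fst measurable_snd).
have mA := measurable_weight.
have mw : measurable_fun setT (fun z : X => `|w z|).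
  rewrite (_ : (fun z : X => `|w z|) = (fun z : X => (A (invariants z))^-1)).
    exact: (measurableT_comp (@measurable_invr R) mA).
  by apply/funext => z; rewrite -[LHS]invrK.
exact: (measurable_funM (measurable_funM (measurable_funM (measurable_cst _) mw) mv) mJ).
Qed.

(** The weak equation for [mu1], with [sgn(v1)] in the test function: the lift of [|v1| mu1] is
    [speed] times [even_lift mu1], and the forcing enters through its part odd in [x]. As [p] has
    mean zero, its primitive also vanishes beyond [t]; the test lives in [|x| < t], short of the
    turning point of every orbit of energy above [U0 t]. *)
Lemma orbit_antiderivative (g mu1 mu2 : phase R -> R) (p : R -> R) (C t : R) :
  measurable_fun (Om : set X) g -> measurable_fun (Om : set X) mu1 -> measurable_fun (Om : set X) mu2 ->
  weakD Om w U0 mu1 mu2 ->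
  {ae lam4 R, forall z : X, Om z -> mu2 z = - Bop Om w g z} ->
  continuous p -> (leb1 R).-integrable setT (EFin \o p) -> (forall x, `|p x| <= C) ->
  (forall x, ~~ (0 < x < t) -> p x = 0) -> (\int[leb1 R]_x (p x)%:E = 0)%E ->
  {ae lam3 R, forall y : Y, O y -> U0 t < y.1 ->
    fine (\int[leb1 R]_x (p x * (speed U0 x y.1 * even_lift mu1 (x, y)) +
      primitive p x * lift_field g (x, y))%:E)%E = 0}.
Proof.
move=> mg m1 m2 wD mu2E cp ip pC pout p0.
have [lmu1 [lmu2 _]] := wD.
have FF := ae_filter_ringOfSetsType (lam4 R).
pose D := fine (\int[leb1 R]_t (`|p t|)%:E)%E.
have D0 : 0 <= D by apply: fine_ge0; apply: integral_ge0.
have C0 : 0 <= C := le_trans (normr_ge0 _) (pC 0).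
have Pb x : `|primitive p x| <= D by exact: Rintegral_le_norm.
have Pneg x : x <= 0 -> primitive p x = 0.
  by move=> x0; apply: primitive_eq0 => s sx; apply: pout; rewrite negb_and -leNgt (le_trans sx x0).
have Ppos x : t <= x -> primitive p x = 0.
  move=> tx; rewrite /primitive /Rintegral.
  have -> : (\int[leb1 R]_(s in `]-oo, x]) (p s)%:E = \int[leb1 R]_s (p s)%:E)%E.
    rewrite integral_mkcond; apply: eq_integral => s _; rewrite patchE mem_setE in_itv/=.
    by case: ifPn => //; rewrite -ltNge => xs; rewrite pout// negb_and -!leNgt (le_trans tx (ltW xs)) orbT.
  by rewrite p0.
(* Odd extension of the primitive; on [x > 0] the reflected terms vanish because [p] is supported in
   []0, t[]. *)
pose th x := primitive p x - primitive p (- x); pose th' x := p x + p (- x).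
have dP (x : R) : is_derive x 1 (primitive p) (p x) by exact: is_derive_primitive.
have dN (x : R) : is_derive x 1 (fun x => primitive p (- x)) (- p (- x)).
  have d : is_derive x 1 (fun x : R => - x) (-1) by apply: is_derive_eq.
  have := @is_derive1_comp R (primitive p) (fun x => - x) x _ _ (dP (- x)) d.
  by rewrite mulrN1.
have dth (x : R) : is_derive x 1 th (th' x).
  by have ? := dP x; have ? := dN x; apply: is_derive_eq; rewrite /th' opprK.
have cth' : continuous th'.
  move=> x; apply: cvgD; first exact: cp.
  by apply: (continuous_comp (f := fun x : R => - x)); [apply: cvgN; exact: cvg_id|exact: cp].
have thb x : `|th x| <= D + D + (C + C).
  have := ler_normB (primitive p x) (primitive p (- x)); have := Pb x; have := Pb (- x); rewrite /th; lra.
have th'b x : `|th' x| <= D + D + (C + C).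
  have := ler_normD (p x) (p (- x)); have := pC x; have := pC (- x); rewrite /th'; lra.
have thN x : th (- x) = - th x by rewrite /th opprK opprB.
have th'N x : th' (- x) = th' x by rewrite /th' opprK addrC.
have thout x : t <= `|x| -> th x = 0.
  move=> tx; have [x0|x0] := leP 0 x.
    by rewrite ger0_norm// in tx; rewrite /th Ppos// Pneg ?subr0// oppr_le0.
  by rewrite ltr0_norm// in tx; rewrite /th Pneg ?(ltW x0)// Ppos ?subr0.
have th'out x : t <= `|x| -> th' x = 0.
  move=> tx; have [x0|x0] := leP 0 x.
    rewrite ger0_norm// in tx; rewrite /th' !pout ?addr0// negb_and -!leNgt ?tx ?orbT//.
    by rewrite oppr_le0 x0.
  rewrite ltr0_norm// in tx; rewrite /th' !pout ?addr0// negb_and -!leNgt ?tx ?orbT//.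
  by rewrite (ltW x0).
have mth := continuous_measurable_fun (derive_continuous dth).
have mth' := continuous_measurable_fun cth'.
have mx : measurable_fun setT (fun z : X => z.1) by exact: measurable_fst.
have mv : measurable_fun setT (fun z : X => z.2.1) by exact: (measurableT_comp measurable_fst measurable_snd).
have msx : measurable_fun setT (fun z : X => Num.sg z.1) by exact: (measurableT_comp measurable_sgr mx).
have msv : measurable_fun setT (fun z : X => Num.sg z.2.1) by exact: (measurableT_comp measurable_sgr mv).
have mc1 : measurable_fun setT (fun _ : X => 1 : R) by exact: measurable_cst.
have sg1 (x : R) : `|Num.sg x| <= 1 by rewrite normr_sg; case: (x != 0).
pose L1 := lift (fun z => 1 * (z.2.1 * Num.sg z.2.1) * ext mu1 z).
pose L2 := lift (fun z => Num.sg z.1 * Num.sg z.2.1 * ext mu2 z).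
pose L3 := lift_field g.
have mvs : measurable_fun setT (fun z : X => 1 * (z.2.1 * Num.sg z.2.1)).
  exact: (measurable_funM mc1 (measurable_funM mv msv)).
have mss : measurable_fun setT (fun z : X => Num.sg z.1 * Num.sg z.2.1) by exact: measurable_funM msx msv.
have mL1 : measurable_fun setT (L1 : X -> R).
  by apply: measurable_lift; exact: (measurable_funM mvs (measurable_ext m1)).
have me2 : measurable_fun setT (fun z : X => Num.sg z.1 * Num.sg z.2.1 * ext mu2 z).
  exact: (measurable_funM mss (measurable_ext m2)).
have mB : measurable_fun (Om : set X) (fun z => - Bop Om w g z).
  apply: measurable_funTS; exact: (measurableT_comp (@oppr_measurable R setT) (measurable_Bop mg)).
have me3 : measurable_fun setT (fun z : X => Num.sg z.1 * Num.sg z.2.1 * ext (fun z => - Bop Om w g z) z).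
  exact: (measurable_funM mss (measurable_ext mB)).
have mL2 : measurable_fun setT (L2 : X -> R) by exact: (measurable_lift me2).
have mL3 : measurable_fun setT (L3 : X -> R) by exact: (measurable_lift me3).
have L23 : {ae lam4 R, forall z : X, L2 z = L3 z}.
  apply: (lift_ae me2 me3); apply: (@filterS _ _ FF _ _ _ mu2E) => z h.
  by rewrite /ext !patchE; case: ifPn => //; rewrite inE => /h ->.
(* The orbits that reach beyond [t]. The set is open, so boxes in it have energies bounded away from
   [U0 t]. *)
pose Ot := [set y : R * (R * R) | O y /\ U0 t < y.1].
have oOt : open Ot.
  apply: openI; first exact: open_invariant_range.
  apply: (@open_comp _ _ (fun y : R * (R * R) => y.1) [set e | U0 t < e]); last exact: open_gt.
  by move=> y _; exact: cvg_fst.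
have AOt y : Ot y -> inv_weight y != 0 by move=> [Oy _]; exact: inv_weight_neq0.
have bOt a0 b0 a1 b1 a2 b2 : box a0 b0 a1 b1 a2 b2 `<=` Ot -> box a0 b0 a1 b1 a2 b2 `<=` O.
  by move=> h y /h[].
pose k (L : X -> R) (z : X) := th' z.1 * L1 z + th z.1 * L z.
have mA : measurable_fun setT (fun z : X => inv_weight z.2) by exact: (measurableT_comp measurable_inv_weight measurable_snd).
have mk L : measurable_fun setT L -> measurable_fun setT (k L).
  move=> mL; have mt' := measurableT_comp mth' mx; have mt := measurableT_comp mth mx.
  exact: (measurable_funD (measurable_funM mt' mL1) (measurable_funM mt mL)).
have ik2 a0 b0 a1 b1 a2 b2 : a0 < b0 -> a1 < b1 -> a2 < b2 -> box a0 b0 a1 b1 a2 b2 `<=` Ot ->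
    (lam4 R).-integrable setT (EFin \o (fun z => \1_(box a0 b0 a1 b1 a2 b2) z.2 * (inv_weight z.2 * k L2 z))).
  move=> h0 h1 h2 /bOt BO.
  have i1 := @box_lift_integrable mu1 (fun z => 1 * (z.2.1 * Num.sg z.2.1)) _ _ _ _ _ _ h0 h1 h2 BO lmu1 mvs.
  have i2 := @box_lift_integrable mu2 (fun z => Num.sg z.1 * Num.sg z.2.1) _ _ _ _ _ _ h0 h1 h2 BO lmu2 mss.
  apply: (box_comb_integrable mth' mth th'b thb (i1 _) (i2 _)) => z.
    by rewrite mul1r normrM le_max -[X in _ || (_ <= X)]mulr1 ler_pM// orbT.
  by rewrite le_max normrM mulr_ile1.
have ae23 (q : Y -> R) : {ae lam4 R, forall z : X, q z.2 * (inv_weight z.2 * k L2 z) = q z.2 * (inv_weight z.2 * k L3 z)}.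
  by apply: (@filterS _ _ FF _ _ _ L23) => z; rewrite /k => ->.
have mqk (q : Y -> R) L : measurable_fun setT q -> measurable_fun setT L ->
    measurable_fun setT (EFin \o (fun z : X => q z.2 * (inv_weight z.2 * k L z))).
  move=> mq mL; apply/measurable_EFinP.
  exact: (measurable_funM (measurableT_comp mq measurable_snd) (measurable_funM mA (mk _ mL))).
have main := @ae_section_eq0 R Ot oOt inv_weight measurable_inv_weight AOt (k L3) (mk _ mL3).
have FF3 := ae_filter_ringOfSetsType (lam3 R).
apply: (@filterS _ _ FF3 _ _ _ (main _ _)).
- move=> y h Oy ty; rewrite -[RHS](h (conj Oy ty)); congr fine; apply: eq_integral => x _; congr (_%:E).
  rewrite /k /L1 lift_speed/=; have [x0|x0] := ltP 0 x; last first.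
    by rewrite /L3 /even_lift /lift_field !lift_out/= ?mulr0// ltNge x0.
  rewrite /th /th' (Pneg (- x)) ?oppr_le0 ?(ltW x0)// subr0 (pout (- x)) ?addr0//.
  by rewrite negb_and oppr_gt0 -leNgt (ltW x0).
- move=> a0 b0 a1 b1 a2 b2 h0 h1 h2 BO.
  have mI : measurable_fun setT (\1_(box a0 b0 a1 b1 a2 b2 : set Y) : Y -> R).
    by apply: measurable_indic; apply: measurableX => //; exact: measurableX.
  apply: (integrable_ae_eq (ik2 _ _ _ _ _ _ h0 h1 h2 BO)); first exact: (mqk _ _ mI mL3).
  apply: (@filterS _ _ FF _ _ _ (ae23 \1_(box a0 b0 a1 b1 a2 b2 : set Y))) => z /= h.
  by congr (_%:E).
move=> a0 b0 a1 b1 a2 b2 h0 h1 h2 BO r0 r1 r2 n0 n1 n2 /andP[hr0 _] /andP[hr1 _] /andP[hr2 _].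
have ta0 : U0 t < a0.
  have := BO (a0, (a1, a2)) => -[|_ //].
  by split => /=; [|split => /=]; rewrite in_itv/= lexx ?ltW.
(* On [|x| < t] an energy of at least [a0] forces [v1^2 >= 2 (a0 - U0 t)], so at this scale the
   smooth sign coincides with the sign wherever the test function lives. *)
have [s [s' [ds cs' sE]]] := @smooth_sign R (Num.sqrt (2 * (a0 - U0 t))) ltac:(by rewrite sqrtr_gt0 mulr_gt0// subr_gt0).
have := @weak_orbit mu1 mu2 th th' s s' (@Num.sg R) (@Num.sg R) (cst 1) (D + D + (C + C)) a0 b0 a1 b1 a2 b2
  (ratr r0) (ratr r1) (ratr r2) n0 n1 n2 m1 m2 wD dth ds cth' cs' measurable_sgr measurable_sgr (measurable_cst _) sg1.
move=> /(_ (@gtr0_sg R) (fun _ _ => erefl)) /(_ _ _ thb th'b h0 h1 h2 (bOt _ _ _ _ _ _ BO) hr0 hr1 hr2) H.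
pose b3 := bump3 (ratr r0) b0 (ratr r1) b1 (ratr r2) b2 n0 n1 n2.
have mb3 : measurable_fun setT (b3 : Y -> R).
  apply: measurable_funM.
    by apply: (measurableT_comp (measurable_bump _ _ _)); exact: measurable_fst.
  apply: measurable_funM.
    apply: (measurableT_comp (measurable_bump _ _ _)).
    by apply: (measurableT_comp measurable_fst); exact: measurable_snd.
  apply: (measurableT_comp (measurable_bump _ _ _)).
  by apply: (measurableT_comp measurable_snd); exact: measurable_snd.
transitivity (\int[lam4 R]_z (b3 z.2 * (inv_weight z.2 * k L2 z))%:E)%E.
  apply: (@ae_eq_integral _ X R (lam4 R)); [exact: measurableT|exact: (mqk _ _ mb3 mL3)|exact: (mqk _ _ mb3 mL2)|].
  by apply: (@filterS _ _ FF _ _ _ (ae23 b3)) => z /= h _; congr (_%:E).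
apply: H.
- by move=> x x0; rewrite thN ltr0_sg ?oppr_lt0// mulN1r.
- by move=> x x0; rewrite th'N mul1r.
move=> z [/=]; rewrite in_itv/= => /andP[az _] _.
have [zt|tz] := ltP `|z.1| t; last by rewrite thout// th'out// !mul0r.
have Ut : U0 z.1 <= U0 t by apply: U_le; rewrite (le_trans (ltW zt))// ler_norm.
have [|-> ->] := sE z.2.1; last by rewrite mulr0.
rewrite -(sqrtr_sqr z.2.1) ler_wsqrtr// mulrC -ler_pdivlMr// lerBlDr (le_trans az)// /energy lerD2l; exact: Ut.
Qed.

Lemma lift_flux (g h : phase R -> R) z :
  lift (fun z => Jop Om g z.1 * (z.2.1 * odd_fold h z)) z =
  orbit_flux g z * lift (fun z => Num.sg z.1 * z.2.1 * h z) z.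
Proof.
rewrite /orbit_flux /lift /jac; case: ifPn => [/andP[x0 xE]|_]; last by rewrite !mul0r.
have v0 : speed U0 z.1 z.2.1 != 0 by rewrite gt_eqF// sqrtr_gt0 mulr_gt0// subr_gt0.
rewrite /fold /odd_fold /orbit/= !opprK gtr0_sg// ltr0_sg ?oppr_lt0//.
by field.
Qed.

Lemma odd_lift_out (g : phase R -> R) z : ~ O z.2 -> odd_lift g z = 0.
Proof.
move=> nO; rewrite /odd_lift /lift /jac; case: ifPn => [/andP[x0 xE]|_]; last by rewrite mul0r.
have E x v : `|x| = z.1 -> `|v| = speed U0 z.1 z.2.1 -> ext g (x, (v, z.2.2)) = 0.
  move=> ex ev; rewrite /ext patchE memNset// => /Omega0P.
  by rewrite (invariants_orbit xE ex ev).
have v0 : 0 < speed U0 z.1 z.2.1 by rewrite sqrtr_gt0 mulr_gt0// subr_gt0.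
by rewrite /fold /orbit/= !E ?normrN ?(gtr0_norm x0) ?(gtr0_norm v0)// !mulr0 !addr0 mulr0.
Qed.

(** Both integrals are at most [rho0 0] times the squared norm of [g]. For the second, the velocity
    integral of the modulus is [|J|] times [int |v1 g|], hence at most the square of the latter. *)
Lemma Jop_energy_lt (g : X -> R) : measurable_fun (Om : set X) g ->
  (forall x, rho0 x <= rho0 0) ->
  (\int[lam4 R]_z (A (invariants z) * ext g z ^+ 2)%:E < +oo)%E ->
  (leb1 R).-integrable setT (fun x => (Jop Om g x ^+ 2)%:E) /\
  (lam4 R).-integrable setT (fun z : X => (Jop Om g z.1 * (z.2.1 * ext g z))%:E).
Proof.
move=> mg r0 N.
have me2 : measurable_fun setT (fun z : X => ext g z ^+ 2).
  by apply: measurable_funX; exact: (measurable_ext mg).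
have mA := measurable_weight.
have A0 y : 0 <= A y by exact: inv_weight_ge0.
pose K (z : X) := A (invariants z) * ext g z ^+ 2.
have mK : measurable_fun setT K by exact: (measurable_funM mA me2).
have K0 z : 0 <= K z by rewrite mulr_ge0 ?sqr_ge0.
have mEK : measurable_fun setT (EFin \o K) by exact/measurable_EFinP.
pose S x : \bar R := (\int[lam3 R]_v (K (x, v))%:E)%E.
have S0 x : (0 <= S x)%E by apply: integral_ge0 => v _; rewrite lee_fin.
have mS : measurable_fun setT S.
  by apply: (@measurable_fun_fubini_tonelli_F _ _ (measurableTypeR R) Y R (lam3 R) (EFin \o K)).
have eS : (\int[lam4 R]_z (K z)%:E = \int[leb1 R]_x S x)%E.
  by apply: (@fubini_tonelli1 _ _ (measurableTypeR R) Y R (leb1 R) (lam3 R) (EFin \o K)).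
have bound : (\int[leb1 R]_x ((rho0 0)%:E * S x) < +oo)%E.
  rewrite (_ : (\int[leb1 R]_x ((rho0 0)%:E * S x) = (rho0 0)%:E * \int[leb1 R]_x S x)%E); last first.
    by apply: (@ge0_integralZl _ (measurableTypeR R) R (leb1 R) setT) => //; rewrite lee_fin.
  rewrite -eS lte_mul_pinfty ?lee_fin ?rho0_ge0 //.
have le0 x : ((rho0 x)%:E * S x <= (rho0 0)%:E * S x)%E by apply: lee_wpmul2r => //; rewrite lee_fin.
have mJ := measurable_Jop mg.
split.
  apply/integrableP; split; first by apply/measurable_EFinP; exact: measurable_funX.
  have -> : (\int[leb1 R]_x `|(Jop Om g x ^+ 2)%:E| = \int[leb1 R]_x (Jop Om g x ^+ 2)%:E)%E.
    by apply: eq_integral => x _; rewrite /= ger0_norm ?sqr_ge0.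
  apply: le_lt_trans bound; apply: ge0_le_integral => //.
  - by move=> x _; rewrite lee_fin sqr_ge0.
  - by apply/measurable_EFinP; exact: measurable_funX.
  - exact: (measurable_funeM _ mS).
  by move=> x _; apply: le_trans (flux_bound x mg) (le0 x).
have mf : measurable_fun setT (fun z : X => Jop Om g z.1 * (z.2.1 * ext g z)).
  exact: (measurable_funM (measurableT_comp mJ measurable_fst) (measurable_flux_density mg)).
apply/integrableP; split; first exact/measurable_EFinP.
pose f (z : X) := `|Jop Om g z.1 * (z.2.1 * ext g z)|.
have mEf : measurable_fun setT (EFin \o f).
  by apply/measurable_EFinP; exact: (measurableT_comp (@normr_measurable R setT) mf).
have -> : (\int[lam4 R]_z `|(Jop Om g z.1 * (z.2.1 * ext g z))%:E| = \int[leb1 R]_x \int[lam3 R]_v (f (x, v))%:E)%E.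
  apply: (@fubini_tonelli1 _ _ (measurableTypeR R) Y R (leb1 R) (lam3 R) (EFin \o f) mEf).
  by move=> z; rewrite lee_fin; exact: normr_ge0.
apply: le_lt_trans bound; apply: ge0_le_integral => //.
- by move=> x _; apply: integral_ge0 => v _; rewrite lee_fin; exact: normr_ge0.
- apply: (@measurable_fun_fubini_tonelli_F _ _ (measurableTypeR R) Y R (lam3 R) (EFin \o f)) => //.
  by move=> z; rewrite lee_fin; exact: normr_ge0.
- exact: (measurable_funeM _ mS).
move=> x _; apply: le_trans (le0 x); apply: le_trans (abs_flux_bound x mg).
have -> : (\int[lam3 R]_v (f (x, v))%:E = (`|Jop Om g x|)%:E * \int[lam3 R]_v (`|v.1 * ext g (x, v)|)%:E)%E.
  rewrite -(@ge0_integralZl _ Y R (lam3 R) setT measurableT); last 3 first.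
  - apply/measurable_EFinP; apply: (measurableT_comp (@normr_measurable R setT)).
    exact: (measurableT_comp (measurable_flux_density mg) (measurable_pair1 _)).
  - by move=> v _; rewrite lee_fin.
  - by rewrite lee_fin.
  by apply: eq_integral => v _; rewrite -EFinM /f/= normrM.
apply: lee_wpmul2r; last exact: Jop_le.
by apply: integral_ge0 => v _; rewrite lee_fin.
Qed.

Lemma measurable_orbit_flux (g : X -> R) : measurable_fun (Om : set X) g ->
  measurable_fun setT (orbit_flux g : X -> R).
Proof.
move=> mg; have mJ := measurable_Jop mg.
have mx : measurable_fun setT (fun z : X => z.1) by exact: measurable_fst.
have mv : measurable_fun setT (fun z : X => z.2.1) by exact: (measurableT_comp measurable_fst measurable_snd).
have m1 : measurable_fun setT (fun z : X => Jop Om g z.1) by exact: (measurableT_comp mJ mx).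
have m2 : measurable_fun setT (fun z : X => Jop Om g (- z.1)).
  exact: (measurableT_comp mJ (measurableT_comp (@oppr_measurable R setT) mx)).
apply: measurable_fun_if.
- exact: measurableT.
- apply: measurable_and; first exact: (measurable_fun_ltr (measurable_cst _) mx).
  exact: (measurable_fun_ltr (measurableT_comp measurable_U mx) mv).
- by apply: measurable_funTS; exact: (measurable_funM (measurable_cst _) (measurable_funB m1 m2)).
- exact: measurable_cst.
Qed.

(** [J] is only square integrable in [x], but the orbit lies in []0, R0[], where the constant in [2
    |J(x) - J(-x)| <= 4 + 2 (J(x)^2 + J(-x)^2)] is integrable. *)
Lemma orbit_flux_integrable (g : X -> R) y : measurable_fun (Om : set X) g ->
  (leb1 R).-integrable setT (fun x => (Jop Om g x ^+ 2)%:E) -> O y ->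
  (leb1 R).-integrable setT (fun x => (orbit_flux g (x, y))%:E).
Proof.
move=> mg iJ Oy; have mJ := measurable_Jop mg.
have mflux : measurable_fun setT (fun x : measurableTypeR R => orbit_flux g (x, y)).
  by apply: (measurableT_comp (measurable_orbit_flux mg)); exact: measurable_pair2.
pose q (x : R) := Jop Om g x ^+ 2.
have mq : measurable_fun setT q by exact: measurable_funX.
have q0 x : 0 <= q x by exact: sqr_ge0.
have iq : (\int[leb1 R]_x (q x)%:E < +oo)%E.
  have [_] := integrableP _ _ _ iJ; rewrite (_ : (\int[leb1 R]_x `|(Jop Om g x ^+ 2)%:E| = \int[leb1 R]_x (q x)%:E)%E)//.
  by apply: eq_integral => x _; rewrite /= ger0_norm ?sqr_ge0.
have mq2 : measurable_fun setT (fun x : measurableTypeR R => q x + q (- x)).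
  exact: (measurable_funD mq (measurableT_comp mq (@oppr_measurable R setT))).
have iK : (leb1 R).-integrable (`]0%R, +oo[%classic : set (measurableTypeR R)) (fun x => (q x + q (- x))%:E).
  apply/integrableP; split; first by apply/measurable_EFinP; exact: measurable_funTS.
  apply: le_lt_trans iq; rewrite (ge0_integral_fold_line mq q0).
  rewrite le_eqVlt; apply/orP; left; apply/eqP; apply: eq_integral => x _.
  by rewrite /= ger0_norm// addr_ge0.
have i1 : (leb1 R).-integrable (`]0%R, R0[%classic : set (measurableTypeR R)) (fun x => 4%:E + 2%:E * (q x + q (- x))%:E)%E.
  apply: integrableD => //.
    have ic : (leb1 R).-integrable `]0, R0[%classic (EFin \o cst (4 : R)).
      apply: measurable_bounded_integrable => //.
      + by rewrite [X in (X < _)%E]lebesgue_measure_itv/=; case: ifP => // _; rewrite -EFinB ltry.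
      + by exists 4; split => // B kB x _ /=; rewrite ger0_norm//; exact: ltW.
    exact: ic.
  apply: integrableZl => //; apply: integrableS iK => //.
  by move=> x /=; rewrite !in_itv/= andbT => /andP[].
have i2 : (leb1 R).-integrable setT ((fun x => 4%:E + 2%:E * (q x + q (- x))%:E)%E \_ `]0%R, R0[).
  by apply/(integrable_mkcond _ _).1.
apply: (le_integrable measurableT _ _ i2); first exact/measurable_EFinP.
move=> x _; rewrite patchE mem_setE in_itv/= /orbit_flux/=.
case: ifPn => [/andP[x0 xE]|_]; last by rewrite normr0 abse_ge0.
have xR : x < R0.
  rewrite ltNge; apply/negP => Rx; case: Oy => Oy _.
  have : U0 R0 <= U0 x by apply: U_le; rewrite (ger0_norm R0_ge0) (gtr0_norm x0).
  by move/le_lt_trans => /(_ _ xE); rewrite ltNge ltW.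
rewrite x0 xR/= lee_fin.
rewrite (ger0_norm (x := 4 + _)) ?addr_ge0 ?mulr_ge0 ?addr_ge0//.
exact: norm_sub_le_squares.
Qed.

(** With [M] for [even_lift mu1], the orbit equation says that [inv_weight * speed * M] and the tail
    of [4 pi orbit_flux] differ by a constant. Pairing with [M] through [integral_mean_zero_dual]
    produces [- tail M], which is [odd_lift g] by the first-order representation. *)
Lemma orbit_energy (g mu1 mu2 : phase R -> R) :
  measurable_fun (Om : set X) g -> measurable_fun (Om : set X) mu1 -> measurable_fun (Om : set X) mu2 ->
  weakD Om w U0 g mu1 -> weakD Om w U0 mu1 mu2 ->
  {ae lam4 R, forall z : X, Om z -> mu2 z = - Bop Om w g z} ->
  (leb1 R).-integrable setT (fun x => (Jop Om g x ^+ 2)%:E) ->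
  {ae lam3 R, forall y : Y, O y ->
    (\int[leb1 R]_x (inv_weight y * (speed U0 x y.1 * even_lift mu1 (x, y) ^+ 2))%:E =
     \int[leb1 R]_x (4 * pi * orbit_flux g (x, y) * odd_lift g (x, y))%:E)%E}.
Proof.
move=> mg m1 m2 wD1 wD2 mu2E iJ.
have FF := ae_filter_ringOfSetsType (lam3 R).
(* The countable family of tests is fixed before the orbit; each test speaks only about the orbits
   whose turning point lies beyond its support. *)
have key : {ae lam3 R, forall y, forall n : nat, forall u : (rat * rat) * (rat * nat), unpickle n = Some u ->
    O y -> 0 <= (ratr u.2.1 : R) -> U0 (Num.max (ratr u.1.1) (ratr u.1.2)) < y.1 ->
    let p := mean_zero_bump (ratr u.1.1) (ratr u.1.2) (ratr u.2.1) u.2.2 in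
    fine (\int[leb1 R]_x (p x * (speed U0 x y.1 * even_lift mu1 (x, y)) +
      primitive p x * lift_field g (x, y))%:E)%E = 0}.
  apply: ae_foralln => n; case: (unpickle n) => [[[q s] [r1 k]]|]; last exact: aeW.
  have [r10|nr] := boolP (0 <= (ratr r1 : R)); last by apply: aeW => y _ [<-] _ /=; rewrite (negbTE nr).
  have [cp ip [C pC] pout p0] := @mean_zero_bumpP R (ratr q) (ratr s) (ratr r1) k r10.
  have := orbit_antiderivative mg m1 m2 wD2 mu2E cp ip pC pout p0.
  by apply: (@filterS _ _ FF) => y h _ [<-] Oy _ ty /=; exact: h.
apply: (@filterS _ _ FF _ _ _ (@filterI _ _ FF _ _ (orbit_representation mg m1 wD1) key)).
move=> y [rep Hk] Oy; have [iG iM M0 repr] := rep Oy.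
have A0 : inv_weight y != 0 by exact: inv_weight_neq0.
have [yU|Uy] := leP y.1 (U0 0).
  have out x : ~~ ((0 < x) && (U0 x < y.1)).
    by rewrite negb_and -!leNgt (le_trans yU) ?orbT// U_le// normr0.
  rewrite !integral0_eq// => x _.
    by rewrite /orbit_flux/= (negbTE (out x)) mulr0 mul0r.
  by rewrite /even_lift lift_out//= expr0n !mulr0.
have [r /andP[r0 rR] [Ur dom]] := orbit_domain Oy Uy.
pose M x := even_lift mu1 (x, y); pose j x := 4 * pi * orbit_flux g (x, y).
pose f x := inv_weight y * speed U0 x y.1 * M x.
have mpair (h : X -> R) : measurable_fun setT h -> measurable_fun setT (fun x : measurableTypeR R => h (x, y)).
  by move=> mh; apply: (measurableT_comp mh); exact: measurable_pair2.
have msp : measurable_fun setT (fun x : measurableTypeR R => speed U0 x y.1).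
  exact: (mpair _ (measurable_speed measurable_U)).
have Mout x : ~~ (0 < x < r) -> M x = 0 by move=> h; apply: lift_out; rewrite /= dom.
have iF : (leb1 R).-integrable setT (EFin \o f).
  apply: (@integrable_bounded_mul _ (measurableTypeR R) R (leb1 R) (fun x => inv_weight y * speed U0 x y.1) M
    (`|inv_weight y| * Num.sqrt (2 * (y.1 - U0 0))) _ _ iM).
    exact: (measurable_funM (measurable_cst _) msp).
  move=> x; rewrite normrM ler_wpM2l// ger0_norm ?sqrtr_ge0// ler_wsqrtr// ler_wpM2l// lerB// U_le// normr0.
  by [].
have iflux := orbit_flux_integrable mg iJ Oy.
have ij : (leb1 R).-integrable setT (EFin \o j).
  rewrite (_ : EFin \o j = (fun x => (4 * pi)%:E * (orbit_flux g (x, y))%:E)%E); last by apply/funext => x.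
  exact: integrableZl.
have E := @integral_mean_zero_dual R f M j r r0 iF iM ij Mout M0.
have -> : (\int[leb1 R]_x (inv_weight y * (speed U0 x y.1 * even_lift mu1 (x, y) ^+ 2))%:E =
    \int[leb1 R]_x (f x * M x)%:E)%E.
  by apply: eq_integral => x _; rewrite /f expr2 !mulrA.
have [_ mtM _] := primitive_tail iM iM.
have tb x : `|tail M x| <= fine (\int[leb1 R]_t (`|M t|)%:E)%E by exact: Rintegral_le_norm.
have it := @integrable_bounded_mul _ (measurableTypeR R) R (leb1 R) _ _ _ mtM tb ij.
have mj : measurable_fun setT j by apply/measurable_EFinP; exact: measurable_int ij.
rewrite E.
  have -> : (- (\int[leb1 R]_x (j x * tail M x)%:E) = \int[leb1 R]_x (-1 * (tail M x * j x))%:E)%E.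
    transitivity (-1%:E * \int[leb1 R]_x (tail M x * j x)%:E)%E.
      by rewrite mulN1e; congr (- _)%E; apply: eq_integral => x _; rewrite mulrC.
    by rewrite -(integralZl measurableT it); apply: eq_integral => x _; rewrite -EFinM.
  have mG : measurable_fun setT (fun x : measurableTypeR R => odd_lift g (x, y)).
    by apply/measurable_EFinP; exact: measurable_int iG.
  have F1 := ae_filter_ringOfSetsType (leb1 R).
  apply: (@ae_eq_integral _ (measurableTypeR R) R (leb1 R)).
  - exact: measurableT.
  - by apply/measurable_EFinP; exact: (measurable_funM (measurable_cst _) (measurable_funM mtM mj)).
  - by apply/measurable_EFinP; exact: (measurable_funM mj mG).
  apply: (@filterS _ _ F1 _ _ _ repr) => x hx _ /=; congr (_%:E).
  rewrite -/(j x); have [xr|xr] := boolP (0 < x < r); last first.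
    by rewrite /j /orbit_flux/= dom (negbTE xr) !(mulr0, mul0r).
  rewrite hx; first by rewrite -/M; ring.
  by case/andP: xr => -> xr; exact: lt_trans xr rR.
move=> q s r1 n /andP[q0 qr] /andP[r10 r1s] sr.
have tr : U0 (Num.max (ratr q) (ratr s)) < y.1.
  have := dom (Num.max (ratr q) (ratr s)); rewrite gt_max qr sr andbT lt_max q0/=.
  by [].
have := Hk (pickle ((q, s), (r1, n))) ((q, s), (r1, n)) (pickleK _) Oy (ltW r10) tr.
rewrite /=; set p := mean_zero_bump _ _ _ _.
have [cp ip [C pC] pout p0] := @mean_zero_bumpP R (ratr q) (ratr s) (ratr r1) n (ltW r10).
rewrite -/p in cp ip pC pout p0.
have mp : measurable_fun setT p by exact: continuous_measurable_fun.
have [mpp _ _] := primitive_tail ip ip.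
have ppb x : `|primitive p x| <= fine (\int[leb1 R]_t (`|p t|)%:E)%E by exact: Rintegral_le_norm.
have i1 := @integrable_bounded_mul _ (measurableTypeR R) R (leb1 R) _ _ _ mp pC iF.
have i2 := @integrable_bounded_mul _ (measurableTypeR R) R (leb1 R) _ _ _ mpp ppb ij.
have iB := integrableB measurableT i1 i2.
have f1 := integrable_fin_num measurableT i1; have f2 := integrable_fin_num measurableT i2.
have -> : (\int[leb1 R]_x (p x * (speed U0 x y.1 * even_lift mu1 (x, y)) + primitive p x * lift_field g (x, y))%:E =
   ((inv_weight y)^-1)%:E * (\int[leb1 R]_x (p x * f x)%:E - \int[leb1 R]_x (primitive p x * j x)%:E))%E.
  rewrite -(integralB measurableT i1 i2) -(integralZl measurableT iB).
  apply: eq_integral => x _; rewrite -EFinB -EFinM; congr (_%:E).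
  have := @lift_fieldE g (x, y) Oy; rewrite /= -/(j x) => e.
  have -> : j x = - (inv_weight y * lift_field g (x, y)) by rewrite -[LHS]opprK -e.
  by rewrite /f /M; field.
rewrite -(fineK f1) -(fineK f2) -EFinB -EFinM /= => /eqP; rewrite mulf_eq0 invr_eq0 (negbTE A0)/= subr_eq0.
by move=> /eqP ->.
Qed.

Lemma integral_flux_sq (g : X -> R) : measurable_fun (Om : set X) g ->
  (lam4 R).-integrable setT (fun z : X => (Jop Om g z.1 * (z.2.1 * ext g z))%:E) ->
  (\int[lam4 R]_z (Jop Om g z.1 * (z.2.1 * ext g z))%:E = \int[leb1 R]_x (Jop Om g x ^+ 2)%:E)%E.
Proof.
move=> mg i; pose f (z : X) : \bar R := (Jop Om g z.1 * (z.2.1 * ext g z))%:E.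
have FF := ae_filter_ringOfSetsType (leb1 R).
have iF := @integrable_fubini_F _ _ (measurableTypeR R) Y R (leb1 R) (lam3 R) f i.
have e : (\int[lam4 R]_z f z = \int[leb1 R]_x \int[lam3 R]_v f (x, v))%E.
  exact: (esym (@integral12_prod_meas1 _ _ (measurableTypeR R) Y R (leb1 R) (lam3 R) f i)).
rewrite e; apply: (@ae_eq_integral _ (measurableTypeR R) R (leb1 R)).
- exact: measurableT.
- exact: (measurable_int _ iF).
- by apply/measurable_EFinP; apply: measurable_funX; exact: measurable_Jop.
have ae := @ae_integrable1 _ _ (measurableTypeR R) Y R (leb1 R) (lam3 R) f i.
apply: (@filterS _ _ FF _ _ _ ae) => x ix _.
(* Fubini makes [J(x) v1 g] integrable in velocity for almost every [x]. Where [J(x)] is nonzero one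
   may divide by it and recover the integral defining [J(x)]; elsewhere both sides are 0. *)
have [J0|J0] := eqVneq (Jop Om g x) 0.
  by rewrite J0 expr0n integral0_eq// => v _; rewrite /f/= J0 mul0r.
have ik : (lam3 R).-integrable setT (fun v : Y => (v.1 * ext g (x, v))%:E).
  have := @integrableZl _ Y R (lam3 R) setT measurableT (Jop Om g x)^-1 _ ix.
  apply: eq_integrable => // v _; rewrite /f -EFinM; congr (_%:E) => /=.
  by rewrite mulKf.
transitivity ((Jop Om g x)%:E * \int[lam3 R]_v (v.1 * ext g (x, v))%:E)%E.
  by rewrite -(@integralZl _ Y R (lam3 R) setT measurableT _ ik); apply: eq_integral => v _; rewrite -EFinM.
have fin := @integrable_fin_num _ Y R (lam3 R) setT measurableT _ ik.
by rewrite -(fineK fin) -JopE -EFinM expr2.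
Qed.

(** Of the factor 16, one 4 comes from the square of the fold having a single value at four points,
    the other from [odd_fold (ext g) = 4 * ext g]. It agrees with the factor in [coercive], so that
    the flux terms cancel exactly. *)
Lemma fold_energy_flux (g mu1 mu2 : phase R -> R) :
  measurable_fun (Om : set X) g -> measurable_fun (Om : set X) mu1 -> measurable_fun (Om : set X) mu2 ->
  weakD Om w U0 g mu1 -> weakD Om w U0 mu1 mu2 ->
  {ae lam4 R, forall z : X, Om z -> mu2 z = - Bop Om w g z} ->
  {ae lam4 R, forall z, Om z -> g z = - g (- z.1, z.2) /\ g z = - g (z.1, (- z.2.1, z.2.2))} ->
  (leb1 R).-integrable setT (fun x => (Jop Om g x ^+ 2)%:E) ->
  (lam4 R).-integrable setT (fun z : X => (Jop Om g z.1 * (z.2.1 * ext g z))%:E) ->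
  (\int[lam4 R]_z (A (invariants z) * fold (ext mu1) z ^+ 2)%:E =
   (16 * (4 * pi))%:E * \int[leb1 R]_x (Jop Om g x ^+ 2)%:E)%E.
Proof.
move=> mg m1 m2 wD1 wD2 mu2E odd iJ iJg.
have A0 y : 0 <= inv_weight y by exact: inv_weight_ge0.
have mA := measurable_weight.
have [mfm _] := measurable_fold (measurable_ext m1).
have [_ mog] := measurable_fold (measurable_ext mg).
have mfm2 : measurable_fun setT (fun z : X => fold (ext mu1) z ^+ 2) by exact: measurable_funX.
have mx : measurable_fun setT (fun z : X => z.1) by exact: measurable_fst.
have mv : measurable_fun setT (fun z : X => z.2.1) by exact: (measurableT_comp measurable_fst measurable_snd).
have mJ : measurable_fun setT (fun z : X => Jop Om g z.1) by exact: (measurableT_comp (measurable_Jop mg) mx).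
pose f (z : X) := Jop Om g z.1 * (z.2.1 * odd_fold (ext g) z).
have mf : measurable_fun setT f by exact: (measurable_funM mJ (measurable_funM mv mog)).
have mEf : measurable_fun setT (EFin \o f) by exact/measurable_EFinP.
have i4 := @integrableZl _ X R (lam4 R) setT measurableT 4 _ iJg.
have FF := ae_filter_ringOfSetsType (lam4 R).
have fE : {ae lam4 R, forall z : X, (4%:E * (Jop Om g z.1 * (z.2.1 * ext g z))%:E)%E = (EFin \o f) z}.
  apply: (@filterS _ _ FF _ _ _ (ae_odd_fold odd)) => z e.
  by rewrite /= /f e -EFinM; congr (_%:E); rewrite mulrCA; congr (_ * _); rewrite mulrCA.
have iF : (lam4 R).-integrable setT (EFin \o f) by exact: (integrable_ae_eq i4 mEf fE).
have intf : (\int[lam4 R]_z (f z)%:E = 4%:E * \int[leb1 R]_x (Jop Om g x ^+ 2)%:E)%E.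
  rewrite -(integral_flux_sq mg iJg) -(@integralZl _ X R (lam4 R) setT measurableT _ iJg).
  apply: (@ae_eq_integral _ X R (lam4 R)); [exact: measurableT|exact: mEf|exact: (measurable_int _ i4)|].
  by apply: (@filterS _ _ FF _ _ _ fE) => z -> _.
have [iL eL] := integral_lift iF.
have LE z : lift f z = orbit_flux g z * odd_lift g z by exact: lift_flux.
pose k (z : X) := 4 * (4 * pi) * lift f z.
have ik : (lam4 R).-integrable setT (EFin \o k).
  have := @integrableZl _ X R (lam4 R) setT measurableT (4 * (4 * pi)) _ iL.
  by apply: eq_integrable.
have [aik ifk ek] := integrable_sections ik.
have intk : (\int[lam4 R]_z (k z)%:E = (16 * (4 * pi))%:E * \int[leb1 R]_x (Jop Om g x ^+ 2)%:E)%E.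
  transitivity ((4 * (4 * pi))%:E * \int[lam4 R]_z (lift f z)%:E)%E.
    by rewrite -(@integralZl _ X R (lam4 R) setT measurableT _ iL); apply: eq_integral => z _; rewrite -EFinM.
  by rewrite -eL intf muleA -EFinM; congr (_%:E * _)%E; ring.
rewrite -intk.
rewrite (ge0_integral_lift (f := fun z => A (invariants z) * fold (ext mu1) z ^+ 2)
  (measurable_funM mA mfm2) (fun z => mulr_ge0 (A0 _) (sqr_ge0 _))).
pose K (z : X) := 4 * (inv_weight z.2 * (speed U0 z.1 z.2.1 * even_lift mu1 z ^+ 2)).
have -> : (\int[lam4 R]_z (lift (fun z => A (invariants z) * fold (ext mu1) z ^+ 2) z)%:E =
    \int[lam4 R]_z (K z)%:E)%E.
  apply: eq_integral => z _; congr (_%:E); rewrite (lift_invariants A) /K lift_fold mulrCA.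
  by [].
have mA2 : measurable_fun setT (fun z : X => inv_weight z.2).
  by apply: (measurableT_comp measurable_inv_weight); exact: measurable_snd.
have msp : measurable_fun setT (fun z : X => speed U0 z.1 z.2.1) by exact: measurable_speed measurable_U.
have me : measurable_fun setT (even_lift mu1 : X -> R) by exact: (measurable_lift (measurable_ext m1)).
have me2 : measurable_fun setT (fun z : X => even_lift mu1 z ^+ 2) by exact: measurable_funX.
have mK' : measurable_fun setT (fun z : X => inv_weight z.2 * (speed U0 z.1 z.2.1 * even_lift mu1 z ^+ 2)).
  exact: (measurable_funM mA2 (measurable_funM msp me2)).
have mK : measurable_fun setT K by exact: (measurable_funM (measurable_cst _) mK').
have K'0 z : 0 <= inv_weight z.2 * (speed U0 z.1 z.2.1 * even_lift mu1 z ^+ 2).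
  by rewrite mulr_ge0// mulr_ge0 ?sqrtr_ge0 ?sqr_ge0.
have K0 z : 0 <= K z by rewrite mulr_ge0.
have mEK : measurable_fun setT (EFin \o K) by exact/measurable_EFinP.
have -> : (\int[lam4 R]_z (K z)%:E = \int[lam3 R]_y \int[leb1 R]_x (K (x, y))%:E)%E.
  apply: (@fubini_tonelli2 _ _ (measurableTypeR R) Y R (leb1 R) (lam3 R) (EFin \o K) mEK).
  by move=> z; rewrite lee_fin; exact: K0.
rewrite -ek; apply: (@ae_eq_integral _ Y R (lam3 R)).
- exact: measurableT.
- apply: (@measurable_fun_fubini_tonelli_G _ _ (measurableTypeR R) Y R (leb1 R) (EFin \o K) mEK).
  by move=> z; rewrite lee_fin; exact: K0.
- exact: (measurable_int _ ifk).
have F3 := ae_filter_ringOfSetsType (lam3 R).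
apply: (@filterS _ _ F3 _ _ _ (@filterI _ _ F3 _ _ aik (orbit_energy mg m1 m2 wD1 wD2 mu2E iJ))) => y [iky ey] _.
have mpair (h : X -> R) : measurable_fun setT h -> measurable_fun setT (fun x : measurableTypeR R => h (x, y)).
  by move=> mh; apply: (measurableT_comp mh); exact: measurable_pair2.
rewrite fineK; last exact: integrable_fin_num iky.
have [Oy|nOy] := pselect (O y); last first.
  have Ay : inv_weight y = 0 by exact: inv_weight_out nOy.
  rewrite !integral0_eq// => x _.
    by rewrite /k LE odd_lift_out// !mulr0.
  by rewrite /K/= Ay mul0r mulr0.
transitivity (4%:E * \int[leb1 R]_x (inv_weight y * (speed U0 x y.1 * even_lift mu1 (x, y) ^+ 2))%:E)%E.
  rewrite -(@ge0_integralZl _ (measurableTypeR R) R (leb1 R) setT measurableT); last 3 first.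
  - by apply/measurable_EFinP; exact: (mpair _ mK').
  - by move=> x _; rewrite lee_fin; exact: (K'0 (x, y)).
  - by rewrite lee_fin.
  by apply: eq_integral => x _; rewrite -EFinM.
rewrite (ey Oy).
have i1 : (leb1 R).-integrable setT (fun x => (4 * pi * orbit_flux g (x, y) * odd_lift g (x, y))%:E).
  have := integrableZl measurableT (4^-1) iky.
  apply: eq_integrable => // x _; rewrite -EFinM; congr (_%:E).
  by rewrite /k LE; field.
rewrite -(integralZl measurableT i1); apply: eq_integral => x _; rewrite -EFinM; congr (_%:E).
by rewrite /k LE; ring.
Qed.

Lemma kernel_trivial (g mu1 mu2 : phase R -> R) : (forall x, rho0 x <= rho0 0) ->
  measurable_fun (Om : set X) g -> measurable_fun (Om : set X) mu1 -> measurable_fun (Om : set X) mu2 ->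
  weakD Om w U0 g mu1 -> weakD Om w U0 mu1 mu2 ->
  {ae lam4 R, forall z : X, Om z -> mu2 z = - Bop Om w g z} ->
  {ae lam4 R, forall z, Om z -> g z = - g (- z.1, z.2) /\ g z = - g (z.1, (- z.2.1, z.2.2))} ->
  (\int[lam4 R]_z (A (invariants z) * ext g z ^+ 2)%:E < +oo)%E ->
  {ae lam4 R, forall z : X, Om z -> g z = 0}.
Proof.
move=> r0 mg m1 m2 wD1 wD2 mu2E odd N.
have [iJ iJg] := Jop_energy_lt mg r0 N.
have finJ := integrable_fin_num measurableT iJ.
pose K (z : X) := A (invariants z) * ext g z ^+ 2.
have me2 : measurable_fun setT (fun z : X => ext g z ^+ 2).
  by apply: measurable_funX; exact: (measurable_ext mg).
have mA := measurable_weight.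
have mEK : measurable_fun setT (EFin \o K) by apply/measurable_EFinP; exact: (measurable_funM mA me2).
have K0 z : 0 <= K z by rewrite mulr_ge0 ?sqr_ge0 ?inv_weight_ge0.
have N0 : (0 <= \int[lam4 R]_z (K z)%:E)%E by apply: integral_ge0 => z _; rewrite lee_fin.
have finN : (\int[lam4 R]_z (K z)%:E)%E \is a fin_num by rewrite ge0_fin_numE.
have : (16%:E * ((3 * kappa)%:E * \int[lam4 R]_z (K z)%:E + (4 * pi)%:E * \int[leb1 R]_x (Jop Om g x ^+ 2)%:E) <=
    (16 * (4 * pi))%:E * \int[leb1 R]_x (Jop Om g x ^+ 2)%:E)%E.
  by rewrite -(fold_energy_flux mg m1 m2 wD1 wD2 mu2E odd iJ iJg); exact: coercive.
have [u Eu] : exists u : R, (\int[lam4 R]_z (K z)%:E = u%:E)%E.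
  by exists (fine (\int[lam4 R]_z (K z)%:E)%E); exact: (esym (fineK finN)).
have [v Ev] : exists v : R, (\int[leb1 R]_x (Jop Om g x ^+ 2)%:E = v%:E)%E.
  by exists (fine (\int[leb1 R]_x (Jop Om g x ^+ 2)%:E)%E); exact: (esym (fineK finJ)).
rewrite Eu lee_fin in N0; rewrite Eu Ev => le.
have {}le : 16 * (3 * kappa * u + 4 * pi * v) <= 16 * (4 * pi) * v by exact: le.
(* The flux terms on the two sides are equal and finite, so [48 * kappa * u <= 0] is all that
   remains. *)
have u0 : u = 0.
  apply: le_anti; rewrite N0 andbT -(ler_pM2l kappa_gt0) mulr0.
  by move: (4 * pi) le => p le; lra.
have i0 : (\int[lam4 R]_z `|(EFin \o K) z| = 0)%E.
  rewrite -[RHS]/((0 : R)%:E) -u0 -Eu; apply: eq_integral => z _.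
  by rewrite /= ger0_norm.
have := (@ae_eq_integral_abs _ X R (lam4 R) _ measurableT _ mEK).1 i0.
have FF := ae_filter_ringOfSetsType (lam4 R).
apply: (@filterS _ _ FF) => z /(_ I) [] /eqP.
rewrite /K mulf_eq0 => /orP[|] e Oz.
  by move: e; rewrite (negbTE (inv_weight_neq0 _))//; exact/Omega0P.
by move: e; rewrite sqrf_eq0 /ext patchE mem_set// => /eqP.
Qed.

End linearized.

(** * Coercivity and trivial kernel for the steady state *)

Theorem theorem7p9 (R : realType) (a : ansatz R) (beta : R * R -> R)
  (U0 rho0 : R -> R) (R0 : R)
  (Ha : ansatz_ok a)
  (Hbeta_ge0 : forall v, 0 <= beta v)
  (Hbeta_cont : continuous beta)
  (Hbeta_supp : compact (closure [set v | beta v != 0]))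
  (Hbeta_int : (\int[leb2 R]_v (beta v)%:E)%E = 1%:E)
  (Hrho : forall x, (rho0 x)%:E = (\int[leb3 R]_v (f0 a (U0 R0) U0 beta (x, v))%:E)%E)
  (HU : forall x, (U0 x)%:E = ((2 * pi)%:E * \int[leb1 R]_y (`|x - y| * rho0 y)%:E)%E)
  (HU_even : forall x, U0 (- x) = U0 x)
  (Hrho_even : forall x, rho0 (- x) = rho0 x)
  (Hsupp : closure [set x | rho0 x != 0] = [set x | - R0 <= x <= R0])
  (Hrho0 : 0 < rho0 0) :
  let Om := Omega0 a (U0 R0) U0 beta in
  let w := phi' a (U0 R0) U0 beta in
  (exists c : R, 0 < c /\
     forall g mu : phase R -> R,
       inHodd Om w g -> weakD Om w U0 g mu -> inH Om w mu ->
       c * fine (Hnorm2 Om w g) <= quadform Om w g mu) /\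
  (forall g mu1 mu2 : phase R -> R,
     inHodd Om w g ->
     weakD Om w U0 g mu1 -> inH Om w mu1 ->
     weakD Om w U0 mu1 mu2 -> inH Om w mu2 ->
     {ae leb4 R, forall z, Om z -> - mu2 z - Bop Om w g z = 0} ->
     {ae leb4 R, forall z, Om z -> g z = 0}).
Proof.
move=> Om w.
have dU := is_derive_potential Ha Hbeta_ge0 Hbeta_cont Hbeta_int Hrho HU HU_even Hsupp.
have cF := continuous_force Ha Hbeta_ge0 Hbeta_cont Hbeta_int Hrho HU HU_even Hsupp.
have U_le := potential_le Hbeta_ge0 Hrho HU HU_even.
have dF := is_derive_force Ha Hbeta_ge0 Hbeta_cont Hbeta_int Hrho HU HU_even Hsupp.
have F_gt0 := force_gt0 Ha Hbeta_ge0 Hbeta_cont Hbeta_int Hrho HU HU_even Hsupp Hrho0.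
have R0_ge0 := ltW (support_radius_gt0 Ha Hbeta_ge0 Hbeta_cont Hbeta_int Hrho HU HU_even Hsupp Hrho0).
have crho0 := continuous_density Ha Hbeta_ge0 Hbeta_cont Hbeta_int Hrho HU HU_even Hsupp.
have rho0_ge0 := density_ge0 Hbeta_ge0 Hrho.
have mrho0 := measurable_density Ha Hbeta_ge0 Hbeta_cont Hbeta_int Hrho HU HU_even.
have density := density_energy Ha Hbeta_ge0 Hbeta_cont Hbeta_int Hrho.
have [kappa kappa0 F_lower] := force_lower_bound Ha Hbeta_ge0 Hbeta_cont Hbeta_int Hrho HU HU_even Hsupp Hrho0.
have rho_le x : rho0 x <= rho0 0.
  by apply: (density_le Ha Hbeta_ge0 Hbeta_cont Hbeta_int Hrho HU HU_even); rewrite normr0.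
have crho : continuous (fun x => 4 * pi * rho0 x).
  by move=> x; apply: cvgM; [exact: cvg_cst|exact: crho0].
have rho_ge0 x : 0 <= 4 * pi * rho0 x by rewrite !mulr_ge0// pi_ge0.
have pi0 : 0 <= 4 * pi :> R by rewrite mulr_ge0// pi_ge0.
split.
  (* The margin in the orbit weight once [4 * pi * rho0] has been spent on the flux: the term
     [3 * F x / x], at least [3 * kappa] on the support. *)
  exists (3 * kappa); split; first by rewrite mulr_gt0.
  move=> g mu [[mg gN] odd] wD [mmu muN]; rewrite /quadform.
  (* The flux integral must be shown finite, since [quadform] applies [fine], which would turn an
     infinite value into 0. *)
  have [|iJ _] := Jop_energy_lt Ha Hbeta_ge0 Hbeta_cont dU density Hbeta_int rho0_ge0 mg rho_le.
    by move: gN; rewrite Hnorm2E.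
  have co := coercive R0_ge0 Ha Hbeta_ge0 Hbeta_cont dU cF U_le dF crho rho_ge0 F_gt0 density Hbeta_int
    (fun=> erefl) kappa0 F_lower rho0_ge0 mrho0 Hrho_even mg mmu wD odd.
  have le := le_trans co (fold_energy_le Ha Hbeta_ge0 Hbeta_cont dU U_le mmu).
  rewrite -!Hnorm2E in le.
  have N0 (h : phase R -> R) : (0 <= Hnorm2 Om w h)%E.
    rewrite Hnorm2E; apply: integral_ge0 => z _; rewrite lee_fin.
    by apply: mulr_ge0; [exact: inv_weight_ge0|exact: sqr_ge0].
  have [n En] : exists n : R, Hnorm2 Om w g = n%:E.
    by exists (fine (Hnorm2 Om w g)); rewrite fineK// ge0_fin_numE.
  have [m Em] : exists m : R, Hnorm2 Om w mu = m%:E.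
    by exists (fine (Hnorm2 Om w mu)); rewrite fineK// ge0_fin_numE.
  have [v Ev] : exists v : R, (\int[leb1 R]_x (Jop Om g x ^+ 2)%:E = v%:E)%E.
    exists (fine (\int[leb1 R]_x (Jop Om g x ^+ 2)%:E)%E); apply: esym; apply: fineK.
    exact: (integrable_fin_num measurableT iJ).
  rewrite En Em Ev in le *.
  have {}le : 16 * (3 * kappa * n + 4 * pi * v) <= 16 * m by exact: le.
  by move: le; rewrite ler_pM2l//= lerBrDr.
move=> g mu1 mu2 [[mg gN] odd] wD1 [m1 _] wD2 [m2 _] eq0.
apply: (kernel_trivial R0_ge0 Ha Hbeta_ge0 Hbeta_cont dU cF U_le dF crho rho_ge0 F_gt0 density Hbeta_int
  (fun=> erefl) kappa0 F_lower rho0_ge0 mrho0 Hrho_even rho_le mg m1 m2 wD1 wD2 _ odd).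
- apply: (@filterS _ _ (ae_filter_ringOfSetsType (lam4 R)) _ _ _ eq0) => z h /h/eqP.
  by rewrite subr_eq0 eqr_oppLR => /eqP.
- by move: gN; rewrite Hnorm2E.
Qed.
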